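(* Work in the setting of the context. Assume: (i) $G(\theta,\cdot)$ is $\mathbb P^Z$-integrable for every $\theta\in\Theta$, and $G(\theta_k,\cdot)\to G(\theta,\cdot)$ in $\mathbb P^Z$-probability whenever $\theta_k\to\theta$ in $\Theta$. (ii) There is a strictly positive square $\mathbb P^Z$-integrable $\xi^G:\mathbb R^d\to\mathbb R$ with $\sup_{\theta\in\Theta}|G(\theta,z)|\le\xi^G(z)$ for all $z\in\mathbb R^d$. (iii) $H(\theta,t,\cdot)$ is Borel measurable for all $(\theta,t)\in\Theta\times\mathbb R$, and $H(\theta,\overline\psi(\theta),\cdot)$ is $\mathbb P^Z$-integrable for all $\theta\in\Theta$. (iv) There are nonnegative square $\mathbb P^Z$-integrable $L_1,L_2$ with $|H(\theta,t,z)-H(\vartheta,s,z)|^2\le L_1(z)^2|G(\theta,z)-G(\vartheta,z)|^2+L_2(z)^2|t-s|^2$ for all $\theta,\vartheta\in\Theta$, $t,s\in\mathbb R$, $z\in\mathbb R^d$. (v) $\psi_{H,\Theta}$ has a unique minimizer $\theta^*$ over $\Theta$, and there is $M_1>0$ with $\psi_{H,\Theta}(\theta)-\psi_{H,\Theta}(\theta^* )\ge M_1\|\theta-\theta^*\|_m^2$ for all $\theta\in\Theta$. (vi) For every $\delta>0$ there exist an at most countable $\mathcal C(\mathcal U_\delta)\subseteq\mathcal U_\delta$ and $(\mathbb P^Z)^n$-null sets $N_n^\delta$ ($n\in\mathbb N$) such that $\inf_{\vartheta\in\mathcal C(\mathcal U_\delta)}\{\mathbb E[|G(\theta,Z_1)-G(\vartheta,Z_1)|]+\max_{1\le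 j\le n}|G(\theta,z_j)-G(\vartheta,z_j)|\}=0$ for all $\theta\in\mathcal U_\delta$, $n\in\mathbb N$, $(z_1,\dots,z_n)\in\mathbb R^{dn}\setminus N_n^\delta$. (vii) There exist $\beta\in\,]0,1]$, $\overline M_1,\overline M^1>0$ and square $\mathbb P^Z$-integrable positive envelopes $\xi^G_\delta$ of $\mathbb F^\Theta_\delta$ ($\delta\in\,]0,\Delta(\Theta)]$) such that $\|(L_1\vee1)\xi^G_\delta\|_{\mathbb P^Z,2}\le\overline M_1\delta^\beta$ and $J(\mathbb F^\Theta_\delta,\xi^G_\delta,1/8)\vee J(\mathbb F^\Theta,\xi^G,1/8)\le\overline M^1$ for all $\delta\in\,]0,\Delta(\Theta)]$. (viii) There exist $\delta_1>0$, $K_{\delta_1}\ge0$ and a Borel measurable $m_{\Theta\times\mathbb R}:\Theta\times\mathbb R\to\mathbb R$ such that $|m_{\Theta\times\mathbb R}(\theta,\overline\psi(\theta)+x)-m_{\Theta\times\mathbb R}(\theta^*,\overline\psi(\theta^* )+x)|\le K_{\delta_1}\|(\theta-\theta^*,\overline\psi(\theta)-\overline\psi(\theta^* ))\|_{m+1}$ for all $(\theta,x)\in\Theta\times[-\delta_1,\delta_1]$, and $\mathbb E[H(\theta,t,Z_1)]-\mathbb E[H(\theta,s,Z_1)]=\int_s^t m_{\Theta\times\mathbb R}(\theta,u)\,du$ for all $\theta\in\Theta$ and $t>s$. Then $$\lim_{\varepsilon\to\infty}\ \sup_{n\in\mathbb N}\ \mathbb P\big(\{n^{1/(4-2\bet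a)}\|\widehat\theta_n-\theta^*\|_m>\varepsilon\}\big)=0.$$
   Context: $(\Omega,\mathcal F,\mathbb P)$ is a complete atomless probability space and $(Z_j)_{j\in\mathbb N}$ are i.i.d. $d$-dimensional random vectors on it with common distribution $\mathbb P^Z$. $\Theta\subset\mathbb R^m$ is compact with Euclidean diameter $\Delta(\Theta)>0$; $\|\cdot\|_k$ is the Euclidean norm on $\mathbb R^k$; $x\vee y=\max\{x,y\}$; $\|f\|_{\mathbb Q,2}=(\int f^2\,d\mathbb Q)^{1/2}$. $G:\Theta\times\mathbb R^d\to\mathbb R$ and $H:\Theta\times\mathbb R\times\mathbb R^d\to\mathbb R$ are mappings, $\overline\psi(\theta):=\mathbb E[G(\theta,Z_1)]$, $\psi_{H,\Theta}(\theta):=\mathbb E[H(\theta,\overline\psi(\theta),Z_1)]$. $(\widehat\theta_n)_{n\in\mathbb N}$ is a sequence of $\Theta$-valued random vectors such that $\widehat\theta_n$ minimizes (for each realization) $\theta\mapsto\frac1n\sum_{j=1}^nH\big(\theta,\frac1n\sum_{k=1}^nG(\theta,Z_k),Z_j\big)$ over $\Theta$. $\mathcal U_\delta:=\{\theta\in\Theta:\|\theta-\theta^*\|_m\le\delta\}$; $\mathbb F^\Theta:=\{G(\theta,\cdot):\theta\in\Theta\}$; $\mathbb F^\Theta_\delta:=\{G(\theta,\cdot)-G(\theta^*,\cdot):\theta\in\mathcal U_\delta\}$. A positive envelope of a class $\mathbb F$ of Borel functions on $\mathbb R^d$ is a strictly positive Borel function $C_{\mathbb F}$ with $\sup_{h\in\mathbb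 F}|h|\le C_{\mathbb F}$. $N(\eta,\mathbb F,L^2(\mathbb Q))$ is the minimal number of closed $L^2(\mathbb Q)$-balls of radius $\eta$ with centers in $\mathbb F$ needed to cover $\mathbb F$ ($\infty$ if no finite cover exists). $\mathcal M_{\rm fin}$ is the set of probability measures on $\mathcal B(\mathbb R^d)$ with finite support. $J(\mathbb F,C_{\mathbb F},\delta):=\int_0^\delta\sup_{\mathbb Q\in\mathcal M_{\rm fin}}\sqrt{\ln\big(2N(\varepsilon\|C_{\mathbb F}\|_{\mathbb Q,2},\mathbb F,L^2(\mathbb Q))\big)}\,d\varepsilon$. *)

(* Defs.v *)
From HB Require Import structures.
From mathcomp Require Import all_boot all_order all_algebra.
From mathcomp Require Import all_classical all_reals all_analysis.

Set Implicit Arguments.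
Unset Strict Implicit.
Unset Printing Implicit Defensive.

Import Order.TTheory GRing.Theory Num.Theory.
Import numFieldNormedType.Exports.

Local Open Scope classical_set_scope.
Local Open Scope ring_scope.

(* R^k with its Borel sigma-algebra. The topology that the library puts on
   'rV[R]_k comes from the sup norm; it is the Euclidean topology. *)
Definition borelRV (R : realType) (k : nat) : measurableType _ :=
  g_sigma_algebraType (@open 'rV[R]_k).

Section euclidean.
Variable R : realType.

Definition enorm k (x : 'rV[R]_k) : R := Num.sqrt (\sum_(i < k) x 0 i ^+ 2).

Definition ediam k (A : set 'rV[R]_k) : R :=
  sup [set r | exists x y, [/\ A x, A y & r = enorm (x - y)]].

Definition eball_in k (A : set 'rV[R]_k) (c : 'rV[R]_k) (r : R) :
    set 'rV[R]_k :=
  [set x | A x /\ enorm (x - c) <= r].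

End euclidean.

Section probability_notions.
Context (R : realType).

Definition atomless d (T : measurableType d) (P : probability T R) : Prop :=
  forall A, measurable A -> (0 < P A)%E ->
    exists B, [/\ measurable B, B `<=` A, (0 < P B)%E & (P B < P A)%E].

Definition mutually_independent d d' (T : measurableType d)
    (S : measurableType d') (P : probability T R)
    (X : nat -> {RV P >-> S}) : Prop :=
  forall (s : seq nat) (A : nat -> set S), uniq s ->
    (forall j, measurable (A j)) ->
    P (\bigcap_(j in [set` s]) X j @^-1` A j) =
    (\prod_(j <- s) P (X j @^-1` A j))%E.

Definition iid d d' (T : measurableType d) (S : measurableType d')
    (P : probability T R) (Q : probability S R)
    (X : nat -> {RV P >-> S}) : Prop :=
  mutually_independent X /\
  forall j A, measurable A -> distribution P (X j) A = Q A.

Definition cvg_in_probability d (T : measurableType d) (P : probability T R)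
    (f_ : nat -> T -> R) (f : T -> R) : Prop :=
  forall e : R, 0 < e ->
    P [set z | e < `|f_ k z - f z|] @[k --> \oo] --> 0%E.

Definition finitely_supported d (T : measurableType d)
    (Q : probability T R) : Prop :=
  exists A : set T, finite_set A /\ Q A = 1%E.

End probability_notions.

Section product_power.
Context d (T : measurableType d) (R : realType).

Definition tuple_cons n (x : T * n.-tuple T) : n.+1.-tuple T :=
  [the n.+1.-tuple T of x.1 :: x.2].

Lemma measurable_tuple_cons n :
  measurable_fun [set: T * n.-tuple T] (@tuple_cons n).
Proof. exact: measurable_cons. Qed.

HB.instance Definition _ n :=
  isMeasurableFun.Build _ _ (T * n.-tuple T)%type (n.+1.-tuple T)
    (@tuple_cons n) (@measurable_tuple_cons n).

(* The n-fold product measure of P with itself, on n-tuples. *)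
Fixpoint product_power (P : probability T R) n : probability (n.-tuple T) R :=
  if n is n'.+1 then
    distribution (P \x product_power P n')%E (@tuple_cons n')
  else \d_([tuple] : 0.-tuple T).

End product_power.

Section entropy.
Context d (T : measurableType d) (R : realType).

Definition positive_envelope (F : set (T -> R)) (C : T -> R) : Prop :=
  [/\ measurable_fun setT C, forall z, 0 < C z &
      forall h z, F h -> `|h z| <= C z].

(* +oo when there is no finite cover, as the infimum of the empty set. *)
Definition covering_number (eta : \bar R) (F : set (T -> R))
    (Q : probability T R) : \bar R :=
  ereal_inf [set n%:R%:E | n in [set n : nat |
    exists c : 'I_n -> T -> R, (forall i, F (c i)) /\
      forall f, F f -> exists i,
        (Lnorm Q 2%:E (fun z => (f z - c i z)%:E) <= eta)%E]].

Definition entropy_integral (F : set (T -> R)) (C : T -> R) (delta : R) :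
    \bar R :=
  (\int[lebesgue_measure]_(e in `[0%R, delta])
    ereal_sup [set sqrte (lne (2%:E *
        covering_number (e%:E * Lnorm Q 2%:E (EFin \o C)) F Q))
      | Q in [set Q : probability T R | finitely_supported Q]])%E.

End entropy.

Section m_estimation.
Context (R : realType) (m d : nat) (dO : measure_display).
Context (Omega : measurableType dO) (P : probability Omega R).
Variable Z : nat -> {RV P >-> borelRV R d}.
Variable G : 'rV[R]_m -> borelRV R d -> R.
Variable H : 'rV[R]_m -> R -> borelRV R d -> R.

(* The sequence Z_1, Z_2, ... is indexed from 0, so that Z 0 stands for Z_1. *)
Definition psi_bar (theta : 'rV[R]_m) : R := fine 'E_P[G theta \o Z 0].

Definition psi_H (theta : 'rV[R]_m) : R :=
  fine 'E_P[H theta (psi_bar theta) \o Z 0].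

Definition empirical_mean n (theta : 'rV[R]_m) (w : Omega) : R :=
  n%:R^-1 * \sum_(k < n) G theta (Z k w).

Definition empirical_objective n (theta : 'rV[R]_m) (w : Omega) : R :=
  n%:R^-1 * \sum_(j < n) H theta (empirical_mean n theta w) (Z j w).

End m_estimation.

Section classes.
Context (R : realType) (m d : nat).
Variables (Theta : set 'rV[R]_m) (G : 'rV[R]_m -> borelRV R d -> R).

Definition class_G : set (borelRV R d -> R) :=
  [set G theta | theta in Theta].

Definition local_class_G (thetas : 'rV[R]_m) (delta : R) :
    set (borelRV R d -> R) :=
  [set (fun z => G theta z - G thetas z)
    | theta in eball_in Theta thetas delta].

End classes.

(* Main.v *)
Require Import Defs.
From HB Require Import structures.
From mathcomp Require Import all_boot all_order all_algebra.
From mathcomp Require Import all_classical all_reals all_analysis.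
From mathcomp Require Import measurable_realfun.
From mathcomp Require Import ring lra.

Set Implicit Arguments.
Unset Strict Implicit.
Unset Printing Implicit Defensive.

Import Order.TTheory GRing.Theory Num.Theory.
Import numFieldNormedType.Exports.

Local Open Scope classical_set_scope.
Local Open Scope ring_scope.

(** Peeling. Write [theta0] for the minimizer, and put
    [r = n^(-1/(4-2 beta))] and [q = delta^beta]. If [theta_n]
    lies in the shell [delta/2 < |theta - theta0| <= delta], the quadratic
    growth of [psi_H] makes one of three quantities large: the increment
    [t |-> H(theta, t) - H(theta0, t)] of the centred empirical process at a
    [t] within [A] of the mean of [G(theta0)], the increment of the inner
    empirical mean of [G], or [q] times the error of that mean itself, the last
    one because of the Lipschitz condition on the density
    [m_{Theta x R}]. Each is controlled in mean by a uniform entropy maximal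
    inequality (symmetrization, then Rademacher chaining). The class of the
    [H(theta, t)] is covered by a grid in [t] and by a cover of [F_delta] in
    [L^2(Q)], where [Q] is the empirical measure reweighted by [max(L_1, 1)^2]:
    it has finite support, so the uniform entropy integral applies to it.
    With [A] of order [(delta/r)^(1/2) q], Markov's inequality bounds the
    probability of the shell by a multiple of [(delta/r)^(-1/2)], and summing
    over the shells with [delta > r eps] gives a bound of order [eps^(-1/2)]. *)

(** The exponent comes from [sqrt n * delta^2 >= (delta/r) * q] for [delta >= r], an equality at
    [delta = r]: fluctuations of order [q / sqrt n] compete with a gain of order [delta^2]. The
    radius [A] is a compromise. The bound for the increments of [H] grows with [A], while a small
    [A] makes it likely that the inner mean leaves the interval; with [(delta/r)^(1/2) q] both
    contributions are of order [(delta/r)^(-1/2)]. The weight appears because (iv) compares values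
    of [H] through [L_1 |G - G'|]: a cover that is accurate for the weighted distance has a radius
    relative to the weighted envelope, whose norm is what (vii) bounds. Suprema over uncountable
    classes need not be measurable. Every probabilistic bound is therefore phrased as a measurable
    exceptional set of sample tuples, outside which an inequality holds for all parameters at once.
    It is obtained for finite classes and reaches the whole class through increasing unions,
    rational [t] and the separability condition (vi). Outside the exceptional set the argument is
    deterministic. *)

(** * Rademacher averages and the maximal inequality for finite families *)

Section rademacher.
Context {R : realType}.
Implicit Types (n : nat) (F : seq R -> R).

(** The expectation over [n] independent Rademacher signs, as a finite average over the [2^n] sign
    lists: the signs need no probability space and raise no measurability question. *)
Fixpoint sgn_avg n F : R :=
  if n is n'.+1 then
    2^-1 * (sgn_avg n' (fun s => F (1 :: s)) + sgn_avg n' (fun s => F (-1 :: s)))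
  else F [::].

Definition dot n (s : seq R) (a : 'I_n -> R) : R := \sum_(i < n) s`_i * a i.

(** The entries that occur are signs, and positions past the end read the default 0, so it is enough
    to compare [F1] and [F2] on lists with entries in [-1, 1]. *)
Lemma sgn_avg_le n F1 F2 :
  (forall s, (forall i, `|s`_i| <= 1) -> F1 s <= F2 s) ->
  sgn_avg n F1 <= sgn_avg n F2.
Proof.
elim: n F1 F2 => [|n IH] F1 F2 F12 /=.
  by apply: F12 => i; rewrite nth_nil normr0.
rewrite ler_pM2l ?invr_gt0//; apply: lerD; apply: IH => s s1; apply: F12;
  by case=> [|i] /=; rewrite ?normrN ?normr1.
Qed.

Lemma eq_sgn_avg n F1 F2 : F1 =1 F2 -> sgn_avg n F1 = sgn_avg n F2.
Proof. by move=> F12; congr sgn_avg; exact/funext. Qed.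

Lemma sgn_avg_cst n (c : R) : sgn_avg n (fun=> c) = c.
Proof. by elim: n => //= n ->; field. Qed.

Lemma sgn_avgD n F1 F2 :
  sgn_avg n (fun s => F1 s + F2 s) = sgn_avg n F1 + sgn_avg n F2.
Proof. by elim: n F1 F2 => //= n IH F1 F2; rewrite !IH; field. Qed.

Lemma sgn_avgZ n (c : R) F : sgn_avg n (fun s => c * F s) = c * sgn_avg n F.
Proof. by elim: n F => //= n IH F; rewrite !IH; field. Qed.

Lemma sgn_avg_sum n (T : finType) (F : T -> seq R -> R) :
  sgn_avg n (fun s => \sum_(t : T) F t s) = \sum_(t : T) sgn_avg n (F t).
Proof.
rewrite /index_enum; elim: (Finite.enum T) => [|t e IH] /=.
  rewrite big_nil -[RHS](sgn_avg_cst n 0); apply: eq_sgn_avg => s.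
  by rewrite big_nil.
rewrite big_cons -IH -sgn_avgD; apply: eq_sgn_avg => s.
by rewrite big_cons.
Qed.

Lemma dot_cons n (x : R) s (a : 'I_n.+1 -> R) :
  dot (x :: s) a = x * a ord0 + dot s (fun i => a (lift ord0 i)).
Proof. by rewrite /dot big_ord_recl. Qed.

Lemma dotB n s (a b : 'I_n -> R) :
  dot s (fun i => a i - b i) = dot s a - dot s b.
Proof. by rewrite /dot -sumrB; apply: eq_bigr => i _; rewrite mulrBr. Qed.

(** The sharp exponent is [x^2 / 2]; the factor 2 buys an elementary proof. For [2 x^2 <= 1], the
    bound [expR y <= 1 / (1 - y)] at [x] and [- x] averages to [1 / (1 - x^2) <= 1 + 2 x^2]; for
    larger [x], [|x| <= 2 x^2]. *)
Lemma cosh_le_gauss (x : R) : 2^-1 * (expR x + expR (- x)) <= expR (2 * x ^+ 2).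
Proof.
have expNle (y : R) : y < 1 -> expR y <= (1 - y)^-1.
  move=> y1; rewrite -[expR y]invrK -expRN lef_pV2 ?posrE ?expR_gt0 ?subr_gt0//.
  exact: expR_ge1Dx.
have [x2|x2] := leP (2 * x ^+ 2) 1.
  have x1 : x < 1 by rewrite ltNge; apply/negP => ?; nra.
  have x1' : - x < 1 by rewrite ltNge; apply/negP => ?; nra.
  apply: (@le_trans _ _ (1 + 2 * x ^+ 2)); last exact: expR_ge1Dx.
  apply: (@le_trans _ _ (2^-1 * ((1 - x)^-1 + (1 - - x)^-1))).
    by rewrite ler_pM2l ?invr_gt0//; apply: lerD; exact: expNle.
  rewrite opprK.
  have -> : 2^-1 * ((1 - x)^-1 + (1 + x)^-1) = (1 - x ^+ 2)^-1.
    by field; repeat (apply/andP; split); rewrite lt0r_neq0//; nra.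
  have y0 := sqr_ge0 x; move: (x ^+ 2) y0 x2 => y y0 y2.
  have : 0 <= y * (1 - 2 * y) by rewrite mulr_ge0; lra.
  by move=> h; rewrite -[X in X <= _]div1r ler_pdivrMr; lra.
have : expR `|x| <= expR (2 * x ^+ 2).
  rewrite ler_expR; move: x2 (normr_ge0 x); rewrite -(real_normK (num_real x)).
  move: `|x| => y y1 y0; have [y_ge1|y_lt1] := leP 1 y; first nra.
  have : y ^+ 2 <= y by nra.
  lra.
apply: le_trans; rewrite mulrC ler_pdivrMr// mulr_natr mulr2n.
by apply: lerD; rewrite ler_expR ?ler_norm// -normrN ler_norm.
Qed.

(** By independence the Laplace transform is a product of hyperbolic cosines, split off one
    coordinate at a time. *)
Lemma sgn_avg_expR n (l : R) (a : 'I_n -> R) :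
  sgn_avg n (fun s => expR (l * dot s a))
    <= expR (2 * l ^+ 2 * \sum_(i < n) a i ^+ 2).
Proof.
elim: n a => [|n IH] a /=; first by rewrite /dot !big_ord0 !mulr0 lexx.
have E (x : R) : sgn_avg n (fun s => expR (l * dot (x :: s) a))
    = expR (x * (l * a ord0)) *
      sgn_avg n (fun s => expR (l * dot s (fun i => a (lift ord0 i)))).
  rewrite -sgn_avgZ; apply: eq_sgn_avg => s.
  by rewrite dot_cons mulrDr expRD; congr (expR _ * _); ring.
rewrite (E 1) (E (-1)) mul1r mulN1r; have := IH (fun i => a (lift ord0 i)).
set X := sgn_avg n _ => XB; rewrite -mulrDl mulrA big_ord_recl (mulrDr (2 * l ^+ 2)) expRD.
apply: ler_pM => //.
- rewrite /X -[X in X <= _](sgn_avg_cst n 0) sgn_avg_le// => s _; exact: expR_ge0.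
- by apply: le_trans (cosh_le_gauss _) _; rewrite ler_expR exprMn mulrA.
Qed.

(* The logarithm is bounded by its tangent, which replaces Jensen's
   inequality in the usual bound of E max through the Laplace transform. *)
Lemma sgn_avg_max n (J : finType) (b : J -> 'I_n -> R) (sg L : R) :
  0 < sg -> 0 < L ->
  (forall j, \sum_(i < n) b j i ^+ 2 <= sg ^+ 2) ->
  2 * #|J|%:R <= expR (L ^+ 2) ->
  sgn_avg n (fun s => \big[Num.max/0]_(j : J) `|dot s (b j)|) <= 3 * sg * L.
Proof.
move=> sg0 L0 bsg JL.
have [j0 _|J0] := pickP [pred j : J | true]; last first.
  under eq_sgn_avg do rewrite big_pred0//.
  by rewrite sgn_avg_cst !mulr_ge0// ltW.
(* This scaling turns the exponent [2 l^2 sg^2] of the Laplace bound into [2 L^2]. With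
   [2 #|J| <= exp(L^2)], the mean of [S] is at most [c = exp(3 L^2)], which is the point where the
   tangent of the logarithm is taken. *)
pose l := L / sg; have l0 : 0 < l by rewrite divr_gt0.
pose S s := \sum_(j : J) (expR (l * dot s (b j)) + expR (- l * dot s (b j))).
pose c := expR (3 * L ^+ 2); have c0 : 0 < c by exact: expR_gt0.
have S_le : sgn_avg n S <= c.
  rewrite /S sgn_avg_sum; apply: (@le_trans _ _ (\sum_(j : J) 2 * expR (2 * L ^+ 2))).
    apply: ler_sum => j _; rewrite sgn_avgD mulr_natl mulr2n.
    have lsg : 2 * l ^+ 2 * \sum_(i < n) b j i ^+ 2 <= 2 * L ^+ 2.
      rewrite -mulrA ler_wpM2l//; apply: le_trans (ler_wpM2l _ (bsg j)) _.
        exact: sqr_ge0.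
      by rewrite -exprMn divfK ?gt_eqF.
    apply: lerD; (apply: le_trans (sgn_avg_expR _ _) _); rewrite ?sqrrN ler_expR//.
  rewrite sumr_const -[leLHS]mulr_natr mulrAC.
  apply: (le_trans (ler_wpM2r (expR_ge0 _) JL)).
  by rewrite -expRD ler_expR; lra.
have maxle s : \big[Num.max/0]_(j : J) `|dot s (b j)|
    <= 3 * sg * L - l^-1 + (l * c)^-1 * S s.
  have key j : `|dot s (b j)| <= 3 * sg * L - l^-1 + (l * c)^-1 * S s.
      set x := `|_|.
      have xS : expR (l * x) <= S s.
        rewrite /S (bigD1 j)//= -[leLHS]addr0; apply: lerD; last first.
          by apply: sumr_ge0 => i _; rewrite addr_ge0 ?expR_ge0.
        rewrite /x; case: (ger0P (dot s (b j))) => _.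
          by rewrite lerDl expR_ge0.
        by rewrite mulrN -mulNr lerDr expR_ge0.
      have : 1 + (l * x - 3 * L ^+ 2) <= c^-1 * S s.
        apply: (le_trans (expR_ge1Dx _)).
        by rewrite expRD expRN mulrC ler_wpM2l ?invr_ge0 ?(ltW c0).
      move=> h; rewrite -(ler_pM2l l0).
      have -> : l * (3 * sg * L - l^-1 + (l * c)^-1 * S s) =
          3 * L ^+ 2 - 1 + c^-1 * S s.
        by rewrite /l; field; rewrite !gt_eqF.
      lra.
  apply/bigmax_leP; split=> [|j _]; last exact: key.
  exact: le_trans (normr_ge0 _) (key j0).
apply: (@le_trans _ _ (sgn_avg n (fun s => 3 * sg * L - l^-1 + (l * c)^-1 * S s))).
  by apply: sgn_avg_le => s _; exact: maxle.
(* On average the term in [S] is at most [l^-1] and cancels the [- l^-1] of the tangent. *)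
rewrite sgn_avgD sgn_avg_cst sgn_avgZ -addrA gerDl addrC subr_le0.
rewrite invfM -mulrA ger_pMr ?invr_gt0// mulrC ler_pdivrMr// mul1r.
exact: S_le.
Qed.

End rademacher.

(* The scale starts at 1/8, the upper limit of the entropy integral. *)
HB.lock Definition dyadic {R : realType} (k : nat) : R := 2^-1 ^+ k.+3.
Canonical locked_dyadic := Unlockable dyadic.unlock.

(** * Chaining along dyadic scales *)

Section chaining.
Context {R : realType}.
Local Notation dyadic := (@dyadic R).

Lemma dyadic_gt0 k : 0 < dyadic k.
Proof. by rewrite unlock exprn_gt0. Qed.

Lemma dyadic_le1 k : dyadic k <= 1.
Proof. by rewrite unlock exprn_ile1// invf_le1// ler1n. Qed.

Lemma dyadic0 : dyadic 0 = 8^-1.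
Proof. by rewrite unlock; field. Qed.

Lemma dyadicS k : dyadic k = 2 * dyadic k.+1.
Proof. by rewrite unlock [in RHS]exprS mulrA mulfV ?mul1r. Qed.

Lemma dyadic_le k l : (k <= l)%N -> dyadic l <= dyadic k.
Proof. by move=> kl; rewrite unlock ler_wiXn2l// invf_le1// ler1n. Qed.

Lemma dyadic_small (x : R) : 0 < x -> exists k, dyadic k <= x.
Proof.
move=> x0; exists (Num.truncn x^-1).+1.
have := truncnS_gt x^-1; set m := (Num.truncn x^-1).+1 => xm.
rewrite unlock exprVn invf_ple ?posrE ?exprn_gt0//.
apply: le_trans (ltW xm) _; rewrite -natrX ler_nat.
by rewrite (leq_trans (ltnW (ltn_expl m (isT : (1 < 2)%N))))// leq_exp2l// -addn3 leq_addr.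
Qed.

Lemma bigmax_add (T : finType) (f g h : T -> R) :
  (forall t, 0 <= g t) -> (forall t, 0 <= h t) ->
  (forall t, f t <= g t + h t) ->
  \big[Num.max/0]_(t : T) f t
    <= \big[Num.max/0]_(t : T) g t + \big[Num.max/0]_(t : T) h t.
Proof.
move=> g0 h0 fgh; apply/bigmax_leP; split=> [|t _].
  by rewrite addr_ge0// bigmax_ge_id.
by apply: le_trans (fgh t) _; apply: lerD; exact: le_bigmax.
Qed.

Lemma sqr_sumD n (a b c : 'I_n -> R) (x y z : R) :
  (forall i, c i = a i + b i) ->
  \sum_(i < n) a i ^+ 2 <= x -> \sum_(i < n) b i ^+ 2 <= y ->
  2 * x + 2 * y <= z -> \sum_(i < n) c i ^+ 2 <= z.
Proof.
move=> cE ax bY; apply: le_trans.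
apply: (@le_trans _ _ (\sum_(i < n) (2 * a i ^+ 2 + 2 * b i ^+ 2))).
  apply: ler_sum => i _; rewrite cE -subr_ge0.
  by rewrite (_ : _ - _ = (a i - b i) ^+ 2) ?sqr_ge0//; ring.
by rewrite big_split/= -!mulr_sumr; apply: lerD; rewrite ler_pM2l.
Qed.

(** Two centres of consecutive scales form a pair in [J k * J k.+1], so the finite maximal
    inequality charges a link its length times [L k + L k.+1]. [M] bounds a discretized Dudley
    integral; the constant is not optimized. *)
Lemma sgn_avg_chaining n (T : finType) (a : T -> 'I_n -> R) (r M : R)
    (J : nat -> finType) (c : forall k, J k -> 'I_n -> R) (L : nat -> R) :
  0 < r -> (forall t, \sum_(i < n) a t i ^+ 2 <= r ^+ 2) ->
  (forall k, 0 < L k) -> (forall k, 2 * #|J k|%:R <= expR (L k ^+ 2)) ->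
  (forall k t, exists j,
     \sum_(i < n) (a t i - c k j i) ^+ 2 <= (r * dyadic k) ^+ 2) ->
  (forall K, \sum_(k < K) dyadic k * L k <= M) ->
  sgn_avg n (fun s => \big[Num.max/0]_(t : T) `|dot s (a t)|) <= 72 * r * M.
Proof.
move=> r0 ar L0 NL cov LM.
pose p k t := projT1 (cid (cov k t)).
have pP k t : \sum_(i < n) (a t i - c k (p k t) i) ^+ 2 <= (r * dyadic k) ^+ 2.
  exact: projT2 (cid (cov k t)).
pose U k := sgn_avg n (fun s =>
  \big[Num.max/0]_(t : T) `|dot s (c k (p k t))|).
(* The finite maximal inequality asks every member of the family to be short, but only the selected
   centres are known to be so. Centres that are too long are replaced by 0. *)
have clip (I : finType) (b : I -> 'I_n -> R) (q : T -> I) (sg l : R) :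
    0 < sg -> 0 < l -> 2 * #|I|%:R <= expR (l ^+ 2) ->
    (forall t, \sum_(i < n) b (q t) i ^+ 2 <= sg ^+ 2) ->
    sgn_avg n (fun s => \big[Num.max/0]_(t : T) `|dot s (b (q t))|)
      <= 3 * sg * l.
  move=> sg0 l0 Jl bq.
  pose b' j := if \sum_(i < n) b j i ^+ 2 <= sg ^+ 2 then b j else fun=> 0.
  have bb' t : b (q t) = b' (q t) by rewrite /b' bq.
  apply: (@le_trans _ _ (sgn_avg n (fun s =>
    \big[Num.max/0]_(j : I) `|dot s (b' j)|))).
    apply: sgn_avg_le => s _; apply/bigmax_leP; split=> [|t _].
      exact: bigmax_ge_id.
    by rewrite bb'; exact: (le_bigmax _ (fun j => `|dot s (b' j)|)).
  apply: sgn_avg_max => // j; rewrite /b'; case: ifPn => // _.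
  by rewrite big1 ?sqr_ge0// => i _; rewrite expr0n.
(* A centre within [r / 8] of a vector of norm at most [r] has norm at most [2 r]; 48 is [3 * 2]
   divided by the first scale [1/8]. *)
have U0 : U 0%N <= 48 * r * (dyadic 0 * L 0%N).
  have -> : 48 * r * (dyadic 0 * L 0%N) = 3 * (2 * r) * L 0%N.
    by rewrite dyadic0; field.
  apply: (clip _ (c 0%N) (p 0%N)); rewrite ?mulr_gt0// => t.
  have e0 : (dyadic 0) ^+ 2 <= 1 by rewrite exprn_ile1 ?dyadic_le1// ltW// dyadic_gt0.
  apply: (sqr_sumD (a := a t) (b := fun i => - (a t i - c 0%N (p 0%N t) i)));
    [by move=> i; ring|exact: ar| |].
    by under eq_bigr do rewrite sqrrN; exact: pP.
  by rewrite !exprMn; have := sqr_ge0 r; nra.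
have UE k : U k.+1 <= U k + 3 * (2 * r * dyadic k) * (L k + L k.+1).
  pose b (j : J k * J k.+1) i := c k.+1 j.2 i - c k j.1 i.
  apply: (@le_trans _ _ (U k + sgn_avg n (fun s =>
      \big[Num.max/0]_(t : T) `|dot s (b (p k t, p k.+1 t))|))).
    rewrite /U -sgn_avgD; apply: sgn_avg_le => s _; apply: bigmax_add => // t.
    by rewrite dotB /= -lerBlDl; exact: lerB_dist.
  rewrite lerD2l; apply: (clip _ b (fun t => (p k t, p k.+1 t))).
  - by rewrite !mulr_gt0 ?dyadic_gt0.
  - by rewrite addr_gt0.
  - rewrite card_prod natrM.
    have L0k := L0 k; have L0k1 := L0 k.+1.
    apply: (@le_trans _ _ (expR (L k ^+ 2) * expR (L k.+1 ^+ 2))).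
      rewrite mulrA ler_pM ?mulr_ge0//; apply: le_trans (NL k.+1).
      by rewrite ler_peMl// ler1n.
    by rewrite -expRD ler_expR; nra.
  - move=> t; apply: (sqr_sumD (a := fun i => a t i - c k (p k t) i)
      (b := fun i => - (a t i - c k.+1 (p k.+1 t) i)));
      [by move=> i; rewrite /b/=; ring|exact: pP| |].
      by under eq_bigr do rewrite sqrrN; exact: pP.
    by rewrite (dyadicS k) !exprMn; have := sqr_ge0 r; have := sqr_ge0 (dyadic k.+1); nra.
(* The subtracted term pays for the share of level [K] in the next link, so the induction closes. *)
have Usum K : U K <= 66 * r * \sum_(k < K.+1) dyadic k * L k
    - 12 * r * (dyadic K * L K).
  have eL k : 0 <= r * (dyadic k * L k) by rewrite !mulr_ge0// ltW// dyadic_gt0.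
  elim: K => [|K IH]; first by rewrite big_ord1 (le_trans U0)//; have := eL 0%N; lra.
  apply: le_trans (UE K) _; rewrite big_ord_recr/=.
  have -> : 3 * (2 * r * dyadic K) * (L K + L K.+1) =
      6 * (r * (dyadic K * L K)) + 12 * (r * (dyadic K.+1 * L K.+1)).
    by rewrite (dyadicS K); ring.
  by have := eL K; have := eL K.+1; lra.
have M0 : 0 < M by apply: lt_le_trans (LM 1%N); rewrite big_ord1 mulr_gt0 ?dyadic_gt0.
(* Chaining stops at a scale so fine that the remainder can be bounded coordinate by coordinate: [n]
   entries, each at most [r * dyadic K]. *)
have [K eK] : exists K, n%:R * dyadic K <= M.
  have [k kM] := @dyadic_small (M / n.+1%:R) (divr_gt0 M0 (ltr0Sn _ _)).
  exists k; apply: (@le_trans _ _ (n.+1%:R * dyadic k)).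
    by rewrite ler_wpM2r ?ler_nat// ltW// dyadic_gt0.
  by rewrite mulrC -ler_pdivlMr.
apply: (@le_trans _ _ (U K + n%:R * (r * dyadic K))).
  rewrite -[X in _ + X](sgn_avg_cst n) -sgn_avgD; apply: sgn_avg_le => s s1.
  have rest0 : 0 <= n%:R * (r * dyadic K) by rewrite !mulr_ge0// ltW// dyadic_gt0.
  apply/bigmax_leP; split=> [|t _]; first by rewrite addr_ge0// bigmax_ge_id.
  rewrite -(subrK (dot s (c K (p K t))) (dot s (a t))) addrC.
  apply: le_trans (ler_normD _ _) _; apply: lerD.
    exact: (le_bigmax _ (fun t => `|dot s (c K (p K t))|)).
  rewrite -dotB /dot; apply: le_trans (ler_norm_sum _ _ _) _.
  rewrite -[n in n%:R]card_ord mulr_natl -sumr_const; apply: ler_sum => i _.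
  rewrite normrM; apply: (@le_trans _ _ (`|a t i - c K (p K t) i|)).
    by rewrite ler_piMl.
  rewrite -(@ler_pXn2r _ 2)// ?nnegrE ?mulr_ge0 ?(ltW r0) ?(ltW (dyadic_gt0 _))//.
  rewrite real_normK ?num_real//; apply: le_trans (pP K t).
  by rewrite (bigD1 i)//= lerDl sumr_ge0// => *; exact: sqr_ge0.
apply: (@le_trans _ _ (66 * r * M + M * r)); last nra.
apply: lerD.
  apply: le_trans (Usum K) _.
  apply: (@le_trans _ _ (66 * r * \sum_(k < K.+1) dyadic k * L k)).
    by rewrite gerBl !mulr_ge0// ltW// dyadic_gt0.
  by rewrite ler_pM2l ?mulr_gt0.
by rewrite mulrCA mulrC ler_pM2r.
Qed.

End chaining.

Lemma integral_prob_cst d (T : measurableType d) (R : realType)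
    (P : probability T R) (c : \bar R) : (\int[P]_x c = c)%E.
Proof.
by rewrite (integral_cst P measurableT c) /= -[RHS]mule1; congr (_ * _)%E;
  exact: probability_setT.
Qed.

(** * Symmetrization under the product measure *)

Section symmetrization.
Context d (S : measurableType d) {R : realType} (mu : probability S R).

Lemma measurable_bigmax d' (U : measurableType d') (T : finType)
    (h : T -> U -> R) :
  (forall t, measurable_fun setT (h t)) ->
  measurable_fun setT (fun u => \big[Num.max/0]_(t : T) h t u).
Proof.
move=> mh; rewrite /index_enum; elim: (Finite.enum T) => [|t e IH].
  by rewrite (_ : (fun _ => _) = cst 0) //; apply/funext => u; rewrite big_nil.
rewrite (_ : (fun _ => _) = h t \max (fun u => \big[Num.max/0]_(j <- e) h j u)).
  exact: measurable_maxr.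
by apply/funext => u; rewrite big_cons.
Qed.

Lemma measurable_sgn_avg d' (U : measurableType d') n (F : U -> seq R -> R) :
  (forall s, measurable_fun setT (F ^~ s)) ->
  measurable_fun setT (fun u => sgn_avg n (F u)).
Proof.
elim: n F => [|n IH] F mF /=; first exact: mF.
by apply: measurable_funM => //; apply: measurable_funD;
  apply: (IH (fun u s => F u (_ :: s))) => s; exact: mF.
Qed.

Local Notation pp := (product_power mu).

Lemma tnth_cons n (x : S) (z : n.-tuple S) (i : 'I_n) :
  tnth (tuple_cons (x, z)) (lift ord0 i) = tnth z i.
Proof. exact: tnthS. Qed.

(** Both orders of integration serve in symmetrization: the head coordinate is integrated innermost
    while it is being centred, and outermost when the induction hypothesis is applied to the
    tail. *)
Lemma integral_product_powerS n (F : n.+1.-tuple S -> \bar R) :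
  measurable_fun setT F -> (forall z, 0 <= F z)%E ->
  (\int[pp n.+1]_z F z = \int[mu]_x \int[pp n]_z F (tuple_cons (x, z)) /\
   \int[pp n.+1]_z F z = \int[pp n]_z \int[mu]_x F (tuple_cons (x, z)))%E.
Proof.
move=> mF F0.
have mFc : measurable_fun setT (F \o @tuple_cons _ S n).
  by apply: measurableT_comp => //; exact: measurable_tuple_cons.
rewrite /= ge0_integral_distribution//; split.
  by rewrite (fubini_tonelli1 (F \o @tuple_cons _ S n))// => z; exact: F0.
by rewrite (fubini_tonelli2 (F \o @tuple_cons _ S n))// => z; exact: F0.
Qed.

Context (T : finType) (f : T -> S -> R).
Hypothesis mf : forall t, measurable_fun setT (f t).
Hypothesis intf : forall t, mu.-integrable setT (EFin \o f t).

Local Notation mean t := (fine (\int[mu]_x (f t x)%:E)).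
Local Notation maxabs v := (\big[Num.max/0]_(t : T) `|v t|).

Let maxabs_ge0 (v : T -> R) : 0 <= maxabs v.
Proof. exact: bigmax_ge_id. Qed.

Let measurable_maxabs d' (U : measurableType d') (v : U -> T -> R) :
  (forall t, measurable_fun setT (v ^~ t)) ->
  measurable_fun setT (fun u => maxabs (v u)).
Proof.
move=> mv; apply: (@measurable_bigmax _ _ _ (fun t u => `|v u t|)) => t.
exact: measurableT_comp.
Qed.

(* One coordinate at a time, no ghost sample is needed:
   c + f - m = (c + 2 f) / 2 + (c - 2 m) / 2. *)
Let symm_step (c : T -> R) :
  (\int[mu]_x (maxabs (fun t => c t + (f t x - mean t)))%:E <=
   \int[mu]_x (2^-1 * (maxabs (fun t => c t + 2 * f t x)
                       + maxabs (fun t => c t - 2 * f t x)))%:E)%E.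
Proof.
have mplus : measurable_fun setT (fun x => maxabs (fun t => c t + 2 * f t x)).
  apply: measurable_maxabs => t; apply: measurable_funD => //.
  exact: measurable_funM.
have mminus : measurable_fun setT (fun x => maxabs (fun t => c t - 2 * f t x)).
  apply: measurable_maxabs => t; apply: measurable_funB => //.
  exact: measurable_funM.
set I := (\int[mu]_x (maxabs (fun t => c t - 2 * f t x))%:E)%E.
have I0 : (0 <= I)%E by apply: integral_ge0 => x _; rewrite lee_fin.
have cI t : (`|c t - 2 * mean t|%:E <= I)%E.
  have i2f : mu.-integrable setT (fun x => (c t - 2 * f t x)%:E).
    have -> : (fun x => (c t - 2 * f t x)%:E) =
        (cst (c t)%:E \+ (fun x => (- 2)%:E * (f t x)%:E))%E.
      by apply/funext => x /=; rewrite -EFinM -EFinD mulNr.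
    apply: integrableD => //; first exact: finite_measure_integrable_cst.
    exact: (integrableZl measurableT _ (intf t)).
  have -> : (`|c t - 2 * mean t|%:E = `|\int[mu]_x (c t - 2 * f t x)%:E|)%E.
    have -> : (\int[mu]_x (c t - 2 * f t x)%:E =
        \int[mu]_x ((c t)%:E + (- 2)%:E * (f t x)%:E))%E.
      by apply: eq_integral => x _; rewrite -EFinM -EFinD mulNr.
    rewrite integralD//; [|exact: finite_measure_integrable_cst|exact: (integrableZl measurableT _ (intf t))].
    rewrite integral_prob_cst (integralZl measurableT (intf t)).
    rewrite -[X in ((c t)%:E + (- 2)%:E * X)%E]fineK ?(integrable_fin_num measurableT (intf t))//.
    by rewrite -EFinM -EFinD mulNr.
  apply: (le_trans (le_abse_integral mu measurableT (measurable_int _ i2f))).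
  apply: ge0_le_integral => //=.
  - apply/measurable_EFinP; apply: measurableT_comp => //.
    by apply: measurable_funB => //; exact: measurable_funM.
  - exact/measurable_EFinP.
  - by move=> x _; rewrite lee_fin (le_bigmax _ (fun t => `|c t - 2 * f t x|)).
(* [I] is to be moved inside the integral as a real constant, so the infinite case is set apart;
   there the right-hand side is infinite as well. *)
have [Ioo|Ifin] := eqVneq I +oo%E.
  have -> : (\int[mu]_x (2^-1 * (maxabs (fun t => c t + 2 * f t x)
                       + maxabs (fun t => c t - 2 * f t x)))%:E)%E = +oo%E.
    apply/eqP; rewrite -leye_eq.
    have <- : ((2^-1)%:E * I = +oo)%E by rewrite Ioo gt0_muley// lte_fin.
    rewrite /I -ge0_integralZl//; [|exact/measurable_EFinP|].
      apply: ge0_le_integral => //=.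
      - by move=> x _; rewrite mule_ge0// lee_fin.
      - by apply: emeasurable_funM => //; exact/measurable_EFinP.
      - by apply/measurable_EFinP; apply: measurable_funM => //; exact: measurable_funD.
      - by move=> x _; rewrite -EFinM lee_fin ler_wpM2l// lerDr.
    by move=> x _; rewrite lee_fin.
  exact: leey.
have IE : I = (fine I)%:E by rewrite fineK// ge0_fin_numE// ltey.
apply: (@le_trans _ _ (\int[mu]_x ((2^-1 * maxabs (fun t => c t + 2 * f t x))%:E
    + (2^-1 * fine I)%:E))%E).
  apply: ge0_le_integral => //=.
  - by move=> x _; rewrite lee_fin.
  - apply/measurable_EFinP; apply: measurable_maxabs => t.
    apply: measurable_funD => //; exact: measurable_funB.
  - by apply: emeasurable_funD => //; apply/measurable_EFinP; exact: measurable_funM.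
  - move=> x _; rewrite -EFinD lee_fin; apply/bigmax_leP; split.
      by rewrite addr_ge0 ?mulr_ge0// fine_ge0.
    move=> t _; have -> : c t + (f t x - mean t) =
      2^-1 * (c t + 2 * f t x) + 2^-1 * (c t - 2 * mean t) by field.
    apply: le_trans (ler_normD _ _) _; rewrite !normrM ger0_norm//.
    apply: lerD; rewrite ler_wpM2l//.
      exact: (le_bigmax _ (fun t => `|c t + 2 * f t x|)).
    by rewrite -lee_fin -IE.
rewrite ge0_integralD//; last 3 first.
- by move=> x _; rewrite lee_fin mulr_ge0.
- by apply/measurable_EFinP; exact: measurable_funM.
- by move=> x _; rewrite lee_fin mulr_ge0// fine_ge0.
rewrite integral_prob_cst EFinM -IE /I -ge0_integralZl//.
- rewrite -ge0_integralD//=.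
  + by apply: ge0_le_integral => //=; [move=> *; rewrite adde_ge0 ?lee_fin ?mulr_ge0|
    apply: emeasurable_funD; apply/measurable_EFinP; exact: measurable_funM|
    apply/measurable_EFinP; apply: measurable_funM => //; exact: measurable_funD|
    by move=> x _; rewrite -EFinD mulrDr].
  + by move=> x _; rewrite lee_fin mulr_ge0.
  + by apply/measurable_EFinP; exact: measurable_funM.
  + by move=> x _; rewrite lee_fin mulr_ge0.
  + by apply/measurable_EFinP; exact: measurable_funM.
- exact/measurable_EFinP.
- by move=> x _; rewrite lee_fin.
Qed.

Let measurable_tnthf n t (j : 'I_n) :
  measurable_fun setT (fun z : n.-tuple S => f t (tnth z j)).
Proof. by apply: measurableT_comp => //; exact: measurable_tnth. Qed.

Let dev n (c : T -> R) (z : n.-tuple S) :=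
  maxabs (fun t => c t + \sum_(j < n) (f t (tnth z j) - mean t)).

Let rad n (c : T -> R) (z : n.-tuple S) :=
  sgn_avg n (fun s => maxabs (fun t => c t + 2 * dot s (fun j => f t (tnth z j)))).

Let measurable_dev n d' (U : measurableType d') (c : T -> U -> R)
    (z : U -> n.-tuple S) :
  (forall t, measurable_fun setT (c t)) -> measurable_fun setT z ->
  measurable_fun setT (fun u => dev (c ^~ u) (z u)).
Proof.
move=> mc mz; apply: measurable_maxabs => t; apply: measurable_funD => //.
apply: measurable_sum => j; apply: measurable_funB => //.
exact: (measurableT_comp (measurable_tnthf t j)).
Qed.

Let measurable_rad n d' (U : measurableType d') (c : T -> U -> R)
    (z : U -> n.-tuple S) :
  (forall t, measurable_fun setT (c t)) -> measurable_fun setT z ->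
  measurable_fun setT (fun u => rad (c ^~ u) (z u)).
Proof.
move=> mc mz; apply: measurable_sgn_avg => s.
apply: measurable_maxabs => t; apply: measurable_funD => //.
apply: measurable_funM => //; apply: measurable_sum => j.
by apply: measurable_funM => //; exact: (measurableT_comp (measurable_tnthf t j)).
Qed.

Let rad_ge0 n c (z : n.-tuple S) : 0 <= rad c z.
Proof. by rewrite /rad -[X in X <= _](sgn_avg_cst n 0) sgn_avg_le. Qed.

(** The offset [c] is what makes the induction work: once a coordinate [x] is symmetrized, its
    contribution [2 f t x] or [- 2 f t x] joins the offset, and the hypothesis applies to the other
    [n] coordinates. *)
Let symmetrization_ind n (c : T -> R) :
  (\int[pp n]_z (dev c z)%:E <= \int[pp n]_z (rad c z)%:E)%E.
Proof.
elim: n c => [|n IH] c.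
  apply: ge0_le_integral => //=.
  - by move=> z _; rewrite lee_fin maxabs_ge0.
  - by apply/measurable_EFinP; exact: (measurable_dev (c := fun t _ => c t)).
  - by apply/measurable_EFinP; exact: (measurable_rad (c := fun t _ => c t)).
  - move=> z _; rewrite lee_fin /dev /rad /=.
    by under eq_bigr do rewrite big_ord0 addr0;
       under [leRHS]eq_bigr do rewrite /dot big_ord0 mulr0 addr0.
have mdevS : measurable_fun setT (fun z => (@dev n.+1 c z)%:E).
  by apply/measurable_EFinP; exact: (measurable_dev (c := fun t _ => c t)).
have mradS : measurable_fun setT (fun z => (@rad n.+1 c z)%:E).
  by apply/measurable_EFinP; exact: (measurable_rad (c := fun t _ => c t)).
rewrite (integral_product_powerS mdevS _).2; last first.
  by move=> z; rewrite lee_fin maxabs_ge0.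
rewrite (integral_product_powerS mradS _).1; last first.
  by move=> z; rewrite lee_fin rad_ge0.
pose g (x : S) (z : n.-tuple S) := 2^-1 * (dev (fun t => c t + 2 * f t x) z
  + dev (fun t => c t - 2 * f t x) z).
have mg : measurable_fun setT (fun xz : S * n.-tuple S => (g xz.1 xz.2)%:E).
  apply/measurable_EFinP; apply: measurable_funM => //.
  apply: measurable_funD.
    apply: (measurable_dev (c := fun t (xz : S * n.-tuple S) => c t + 2 * f t xz.1)) => // t.
    apply: measurable_funD => //; apply: measurable_funM => //.
    exact: measurableT_comp.
  apply: (measurable_dev (c := fun t (xz : S * n.-tuple S) => c t - 2 * f t xz.1)) => // t.
  apply: measurable_funB => //; apply: measurable_funM => //.
  exact: measurableT_comp.
have g0 x z : 0 <= g x z by rewrite mulr_ge0// addr_ge0// maxabs_ge0.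
have mcons x : measurable_fun setT (fun z : n.-tuple S => tuple_cons (x, z)).
  exact: (measurable_cons (measurable_cst x) (@measurable_id _ _ setT)).
have mcons' z : measurable_fun setT (fun x : S => @tuple_cons _ S n (x, z)).
  exact: (measurable_cons (@measurable_id _ _ setT) (measurable_cst z)).
apply: (@le_trans _ _ (\int[pp n]_z \int[mu]_x (g x z)%:E)%E).
  apply: ge0_le_integral => //=.
  - by move=> z _; apply: integral_ge0 => x _; rewrite lee_fin maxabs_ge0.
  - apply: (measurable_fun_fubini_tonelli_G (fun xz : S * n.-tuple S => (dev c (tuple_cons xz))%:E)).
      exact: (measurableT_comp mdevS (@measurable_tuple_cons _ S n)).
    by move=> x; rewrite lee_fin maxabs_ge0.
  - apply: (measurable_fun_fubini_tonelli_G (fun xz : S * n.-tuple S => (g xz.1 xz.2)%:E)) => //.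
    by move=> x; rewrite lee_fin.
  - move=> z _.
    pose cz t := c t + \sum_(j < n) (f t (tnth z j) - mean t).
    have E x : dev c (tuple_cons (x, z)) = maxabs (fun t => cz t + (f t x - mean t)).
      rewrite /dev; apply: eq_bigr => t _; rewrite big_ord_recl /=.
      rewrite /cz [X in c t + X]addrC addrA; congr (`|_ + _ + (_ - _)|).
      by apply: eq_bigr => j _; rewrite tnth_cons.
    under eq_integral do rewrite E.
    apply: le_trans (symm_step cz) _; rewrite le_eqVlt; apply/orP; left; apply/eqP.
    apply: eq_integral => x _; congr (_%:E); rewrite /g /dev; congr (_ * (_ + _));
      by apply: eq_bigr => t _; rewrite /cz addrAC.
have -> : (\int[pp n]_z \int[mu]_x (g x z)%:E = \int[mu]_x \int[pp n]_z (g x z)%:E)%E.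
  rewrite -(fubini_tonelli1 (m1 := mu) (m2 := pp n) (fun xz : S * n.-tuple S => (g xz.1 xz.2)%:E))//; last by move=> x; rewrite lee_fin.
  rewrite (fubini_tonelli2 (m1 := mu) (m2 := pp n) (fun xz : S * n.-tuple S => (g xz.1 xz.2)%:E))//; by move=> x; rewrite lee_fin.
apply: ge0_le_integral => //=.
- by move=> x _; apply: integral_ge0 => z _; rewrite lee_fin.
- apply: (measurable_fun_fubini_tonelli_F (fun xz : S * n.-tuple S => (g xz.1 xz.2)%:E)) => //.
  by move=> x; rewrite lee_fin.
- apply: (measurable_fun_fubini_tonelli_F (fun xz : S * n.-tuple S => (rad c (tuple_cons xz))%:E)).
    exact: (measurableT_comp mradS (@measurable_tuple_cons _ S n)).
  by move=> x; rewrite lee_fin rad_ge0.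
move=> x _.
have E z : rad c (tuple_cons (x, z)) = 2^-1 * (rad (fun t => c t + 2 * f t x) z
    + rad (fun t => c t - 2 * f t x) z).
  rewrite /rad /=; congr (_ * (_ + _)); apply: eq_sgn_avg => s;
    apply: eq_bigr => t _; rewrite dot_cons mulrDr ?mul1r ?mulN1r ?mulrN addrA;
    congr (`|_ + _ * _|); apply: eq_bigr => j _; by rewrite tnth_cons.
under [leRHS]eq_integral do rewrite E.
have half (u v : n.-tuple S -> R) : measurable_fun setT u -> measurable_fun setT v ->
    (forall z, 0 <= u z) -> (forall z, 0 <= v z) ->
    (\int[pp n]_z (2^-1 * (u z + v z))%:E =
     (2^-1)%:E * (\int[pp n]_z (u z)%:E + \int[pp n]_z (v z)%:E))%E.
  move=> mu_ mv u0 v0.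
  under eq_integral do rewrite EFinM EFinD.
  rewrite ge0_integralZl//; last 2 first.
  - by apply: emeasurable_funD; exact/measurable_EFinP.
  - by move=> z _; rewrite adde_ge0 ?lee_fin.
  by rewrite ge0_integralD//; [move=> z _; rewrite lee_fin|exact/measurable_EFinP|move=> z _; rewrite lee_fin|exact/measurable_EFinP].
have mdc (c' : T -> R) : measurable_fun setT (@dev n c').
  exact: (measurable_dev (c := fun t _ => c' t)).
have mrc (c' : T -> R) : measurable_fun setT (@rad n c').
  exact: (measurable_rad (c := fun t _ => c' t)).
rewrite /g !half//.
- by rewrite lee_wpmul2l ?lee_fin//; apply: leeD; exact: IH.
- by move=> z; exact: maxabs_ge0.
- by move=> z; exact: maxabs_ge0.
Qed.

Lemma symmetrization n :
  (\int[pp n]_z (\big[Num.max/0]_(t : T)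
      `|\sum_(j < n) (f t (tnth z j) - mean t)|)%:E <=
   \int[pp n]_z (2 * sgn_avg n (fun s => \big[Num.max/0]_(t : T)
      `|dot s (fun j => f t (tnth z j))|))%:E)%E.
Proof.
have := symmetrization_ind n (fun=> 0).
rewrite /dev /rad; under eq_integral do under eq_bigr do rewrite add0r.
move/le_trans; apply; rewrite le_eqVlt; apply/orP; left; apply/eqP.
apply: eq_integral => z _; congr (_%:E); rewrite -sgn_avgZ; apply: eq_sgn_avg => s.
rewrite (big_morph ( *%R 2) (fun x y => maxr_pMr x y (ler0n R 2)) (mulr0 2)).
apply: eq_bigr => t _.
by rewrite add0r normrM ger0_norm.
Qed.

End symmetrization.

(** * Finitely supported weighted measures *)

Section weighted_dirac.
Context d (S : measurableType d) {R : realType}.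
Variables (n : nat) (z : nat -> S) (q : nat -> {nonneg R}).

Definition weighted_dirac := msum (fun k => mscale (q k) (\d_(z k) : {measure set S -> \bar R})) n.

HB.instance Definition _ := Measure.on weighted_dirac.

Lemma integral_weighted_dirac (f : S -> \bar R) :
  measurable_fun setT f -> (forall x, 0 <= f x)%E ->
  (\int[weighted_dirac]_x f x = \sum_(k < n) (q k)%:num%:E * f (z k))%E.
Proof.
move=> mf f0; rewrite ge0_integral_measure_sum//; apply: eq_bigr => k _.
rewrite ge0_integral_mscale//.
by rewrite integral_dirac// diracE in_setT mul1e.
Qed.

Hypothesis q1 : \sum_(k < n) (q k)%:num = 1 :> R.

Let weighted_dirac_setT : weighted_dirac setT = 1%E.
Proof.
rewrite /weighted_dirac /msum -q1 -sumEFin; apply: eq_bigr => k _.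
by apply: etrans (mule1 _); congr (_ * _)%E; exact: diracT.
Qed.

HB.instance Definition _ :=
  Measure_isProbability.Build _ _ _ weighted_dirac weighted_dirac_setT.

Definition weighted_prob : probability S R := weighted_dirac.

Lemma weighted_prob_finitely_supported : finitely_supported weighted_prob.
Proof.
exists [set z k | k in `I_n]; split; first exact: finite_image.
rewrite /weighted_prob /= /weighted_dirac /msum -q1 -sumEFin.
apply: eq_bigr => k _; apply: etrans (mule1 _); congr (_ * _)%E.
have h : (\d_(z k) [set z k | k in `I_n] = 1 :> \bar R)%E.
  by rewrite diracE mem_set//; exists k => //=.
exact: h.
Qed.

End weighted_dirac.

(** * Weighted covers from the uniform entropy integral *)

Section entropy_covers.
Context d (S : measurableType d) {R : realType}.

(** The integral of a nonnegative function is a supremum over the simple functions below it, hence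
    monotone for arbitrary functions. This spares measurability proofs for the entropy integrand and
    for the Rademacher averages of a sample. *)
Lemma le_integral_nomeas d' (U : measurableType d')
    (mu : {measure set U -> \bar R}) (D : set U) (f g : U -> \bar R) :
  (forall x, D x -> 0 <= f x)%E -> (forall x, D x -> f x <= g x)%E ->
  (\int[mu]_(x in D) f x <= \int[mu]_(x in D) g x)%E.
Proof.
move=> f0 fg; rewrite !ge0_integralE//; last first.
  by move=> x Dx; exact: le_trans (f0 x Dx) (fg x Dx).
apply: le_ereal_sup => _ [h hf <-]; exists h => // x.
apply: le_trans (hf x) _; rewrite /patch; case: ifPn => //.
by rewrite inE; exact: fg.
Qed.

Lemma sqrte_lne_le (x y : \bar R) : (0 <= x)%E -> (x <= y)%E ->
  (sqrte (lne x) <= sqrte (lne y))%E.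
Proof.
move=> x0 xy; have y0 := le_trans x0 xy.
have lxy : (lne x <= lne y)%E by rewrite lee_lne// in_itv/= leey andbT.
have [ly0|ly0] := leP 0%E (lne y); first by rewrite lee_sqrt.
apply: le_trans (sqrte_ge0 _); move: (lt_le_trans (le_lt_trans lxy ly0) (lexx _)).
by case: (lne x) => [r||]//=; rewrite lte_fin lee_fin => /ltW/ler0_sqrtr ->.
Qed.

Lemma Lnorm2_sq d' (U : measurableType d') (mu : {measure set U -> \bar R}) (f : U -> R) :
  (Lnorm mu 2%:E (EFin \o f) `^ 2 = \int[mu]_x (f x ^+ 2)%:E)%E.
Proof.
rewrite poweR_Lnorm ?pnatr_eq0//; apply: eq_integral => x _ /=.
by rewrite ?poweR_EFin powR_mulrn// real_normK ?num_real.
Qed.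

Variables (F : set (S -> R)) (C : S -> R).
Hypothesis F0 : F !=set0.
Hypothesis mF : forall f, F f -> measurable_fun setT f.
Hypothesis mC : measurable_fun setT C.

Definition unif_entropy (e : R) : \bar R :=
  ereal_sup [set sqrte (lne (2%:E *
        covering_number (e%:E * Lnorm Q 2%:E (EFin \o C)) F Q))
      | Q in [set Q : probability S R | finitely_supported Q]]%E.

Lemma covering_number_ge0 eta (Q : probability S R) : (0 <= covering_number eta F Q)%E.
Proof. by apply: le_ereal_inf_tmp => _ [n _ <-]; rewrite lee_fin. Qed.

(** The supremum ranges over a nonempty set, since the Dirac mass at [point] is finitely supported;
    every member is a square root. *)
Lemma unif_entropy_ge0 e : (0 <= unif_entropy e)%E.
Proof.
pose Q : probability S R := \d_point.
apply: (@le_trans _ _ (sqrte (lne (2%:E *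
    covering_number (e%:E * Lnorm Q 2%:E (EFin \o C)) F Q)))%E).
  exact: sqrte_ge0.
apply: ereal_sup_ubound; exists Q => //=.
exists [set point]; split; first exact: finite_set1.
have h : (\d_point [set (point : S)] = 1 :> \bar R)%E by rewrite diracE mem_set.
exact: h.
Qed.

Lemma unif_entropy_nincr e1 e2 : e1 <= e2 -> (unif_entropy e2 <= unif_entropy e1)%E.
Proof.
move=> e12; apply: ge_ereal_sup => _ [Q Qf <-].
apply: (@le_trans _ _ (sqrte (lne (2%:E *
    covering_number (e1%:E * Lnorm Q 2%:E (EFin \o C)) F Q)))%E); last first.
  by apply: ereal_sup_ubound; exists Q.
apply: sqrte_lne_le; first by rewrite mule_ge0 ?covering_number_ge0.
rewrite lee_wpmul2l//; apply: le_ereal_inf => _ [n [c [cF cov]] <-].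
exists n => //; exists c; split=> // f /cov[i ci]; exists i.
by apply: le_trans ci _; rewrite lee_wpmul2r ?Lnorm_ge0// lee_fin.
Qed.

(** The integrand is nonincreasing, so the step function that takes on []dyadic k.+1, dyadic k]] its
    value at the right endpoint stays below it. These intervals are disjoint, lie in [0, 1/8] and
    have length [dyadic k.+1]. *)
Lemma unif_entropy_sum (M : R) (K : nat) :
  (entropy_integral F C 8^-1 <= M%:E)%E ->
  (\sum_(k < K) unif_entropy (dyadic k) * (dyadic k.+1)%:E <= M%:E)%E.
Proof.
apply: le_trans; rewrite /entropy_integral.
pose step (e : R) := (\sum_(k < K) unif_entropy (dyadic k) *
   (\1_(`]dyadic k.+1, dyadic k]) e)%:E)%E.
have -> : (\sum_(k < K) unif_entropy (dyadic k) * (dyadic k.+1)%:E =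
    \int[lebesgue_measure]_(e in `[0%R, 8^-1%R]) step e)%E.
  rewrite ge0_integral_sum//=; last 2 first.
  - move=> k; apply: emeasurable_funM => //.
    by apply/measurable_EFinP; apply: measurable_indic.
  - by move=> k e _; rewrite mule_ge0 ?unif_entropy_ge0// lee_fin.
  apply: eq_bigr => k _; rewrite ge0_integralZl//=; do ?[exact: unif_entropy_ge0
    |by move=> e _; rewrite lee_fin|by apply/measurable_EFinP; apply: measurable_indic].
  congr (_ * _)%E; rewrite integral_indic//.
  have -> : `]dyadic k.+1, dyadic k] `&` `[0, 8^-1] = `](dyadic k.+1 : R), dyadic k]%classic.
    apply: setIidl => e /=; rewrite !in_itv/= => /andP[e1 e2].
    rewrite (le_trans (ltW (dyadic_gt0 k.+1)) (ltW e1))/=.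
    by apply: (le_trans e2); rewrite -dyadic0 dyadic_le.
  apply/esym; apply: etrans (lebesgue_measure_itv `](dyadic k.+1), (dyadic k : R)]) _.
  rewrite /= lte_fin.
  have d0 := @dyadic_gt0 R k.+1; have dS := @dyadicS R k.
  by rewrite ifT; [rewrite -EFinB dS; congr (_%:E); ring|rewrite dS; lra].
apply: le_integral_nomeas => [e _|e _].
  by apply: sume_ge0 => k _; rewrite mule_ge0 ?unif_entropy_ge0// lee_fin.
rewrite -/(unif_entropy e) /step.
have [[k0 /andP[ek0 ek0']]|noek] := pselect (exists k : 'I_K, dyadic k.+1 < e <= dyadic k).
  rewrite (bigD1 k0)//= big1 ?adde0.
    rewrite indicE mem_set/= ?in_itv/= ?ek0 ?ek0'// mule1.
    exact: unif_entropy_nincr.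
  move=> k kk0; rewrite indicE memNset ?mule0//= in_itv/= => /andP[ek ek'].
  move: kk0; rewrite -val_eqE neq_ltn => /orP[kk0|kk0].
    by have := lt_le_trans ek (le_trans ek0' (dyadic_le kk0)); rewrite ltxx.
  by have := lt_le_trans ek0 (le_trans ek' (dyadic_le kk0)); rewrite ltxx.
rewrite big1 ?unif_entropy_ge0// => k _.
rewrite indicE memNset ?mule0//= in_itv/= => kP; apply: noek; by exists k.
Qed.

(** An infinite value at one scale would make the lower sum infinite. *)
Lemma unif_entropy_fin (M : R) k : (entropy_integral F C 8^-1 <= M%:E)%E ->
  unif_entropy (dyadic k) \is a fin_num.
Proof.
move=> /(unif_entropy_sum k.+1); rewrite big_ord_recr/= => sumM.
rewrite ge0_fin_numE ?unif_entropy_ge0// ltey; apply/eqP => uoo.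
move: sumM; rewrite uoo gt0_mulye ?lte_fin ?dyadic_gt0// addey; last first.
  rewrite gt_eqF// (lt_le_trans ltNy0)// sume_ge0// => i _.
  by rewrite mule_ge0 ?unif_entropy_ge0// lee_fin ltW// dyadic_gt0.
by rewrite leye_eq.
Qed.

(** A finite covering number is an infimum of natural numbers, hence a minimum. *)
Lemma covering_number_attained (eta : \bar R) (Q : probability S R) :
  (covering_number eta F Q < +oo)%E ->
  exists N (c : 'I_N -> S -> R), [/\ covering_number eta F Q = N%:R%:E,
    forall i, F (c i) &
    forall f, F f -> exists i,
      (Lnorm Q 2%:E (fun z => (f z - c i z)%:E) <= eta)%E].
Proof.
rewrite /covering_number; set A := [set n : nat | _] => Aoo.
have [n0 An0] : A !=set0.
  apply/set0P; apply/eqP => A0; move: Aoo.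
  by rewrite A0 image_set0 ereal_inf0 ltxx.
have exA : exists n, `[< A n >] by exists n0; apply/asboolP.
pose N := ex_minn exA; have [/asboolP AN Nmin] : `[< A N >] /\ forall n, `[< A n >] -> (N <= n)%N.
  by rewrite /N; case: ex_minnP.
have [c [cF cov]] := AN; exists N, c; split => //.
apply/eqP; rewrite eq_le; apply/andP; split.
  by apply: ereal_inf_lbound; exists N.
apply: le_ereal_inf_tmp => _ [n An <-]; rewrite lee_fin ler_nat.
by apply: Nmin; apply/asboolP.
Qed.

(** [D] depends on neither [n], [z] nor [w]: the normalized squares of the weights make the sample a
    finitely supported probability measure, and [unif_entropy] is a supremum over all of these.
    Multiplying by the total weight turns the [L^2] radius into the weighted sum of squares. The
    factor 2 of the sum is the ratio of [dyadic k] to the length of the interval below it. *)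
Lemma entropy_covers (M : R) :
  (entropy_integral F C 8^-1 <= M%:E)%E ->
  exists D : nat -> R, [/\ forall k, 0 <= D k,
    forall K, \sum_(k < K) dyadic k * D k <= 2 * M &
    forall n (z : 'I_n.+1 -> S) (w : 'I_n.+1 -> R) k, (forall j, 0 < w j) ->
      exists N (c : 'I_N -> S -> R), [/\ forall i, F (c i),
        2 * N%:R <= expR (D k ^+ 2) &
        forall f, F f -> exists i,
          \sum_(j < n.+1) w j ^+ 2 * (f (z j) - c i (z j)) ^+ 2
          <= dyadic k ^+ 2 * \sum_(j < n.+1) w j ^+ 2 * C (z j) ^+ 2]].
Proof.
move=> JM; exists (fun k => fine (unif_entropy (dyadic k))).
have ufin k := unif_entropy_fin k JM.
split=> [k|K|n z w k w0].
- exact/fine_ge0/unif_entropy_ge0.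
- have := unif_entropy_sum K JM; under eq_bigr do rewrite -(fineK (ufin _)) -EFinM.
  rewrite sumEFin lee_fin => sumM.
  rewrite (eq_bigr (fun k : 'I_K => 2 * (fine (unif_entropy (dyadic k)) * dyadic k.+1))).
    by rewrite -mulr_sumr ler_pM2l.
  by move=> k _; rewrite (dyadicS k); ring.
pose W := \sum_(j < n.+1) w j ^+ 2.
have W0 : 0 < W.
  rewrite /W big_ord_recl ltr_wpDr ?exprn_gt0// sumr_ge0// => i _; exact: sqr_ge0.
(* The atoms are indexed by [nat], hence [inord]; only indices below [n.+1] enter the measure. *)
have q0 (j : nat) : 0 <= w (inord j) ^+ 2 / W by rewrite divr_ge0 ?sqr_ge0 ?ltW.
pose q j : {nonneg R} := NngNum (q0 j).
have q1 : \sum_(j < n.+1) (q j)%:num = 1 :> R.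
  rewrite /= -mulr_suml /W; under eq_bigr do rewrite inord_val.
  by rewrite divff// gt_eqF.
pose Q := weighted_prob (fun j => z (inord j)) q1.
have intQ (g : S -> R) : measurable_fun setT g ->
    (Lnorm Q 2%:E (EFin \o g) `^ 2 =
     (W^-1 * \sum_(j < n.+1) w j ^+ 2 * g (z j) ^+ 2)%:E)%E.
  move=> mg; rewrite Lnorm2_sq integral_weighted_dirac.
  - rewrite mulr_sumr -sumEFin; apply: eq_bigr => j _ /=.
    by rewrite inord_val -EFinM; congr (_%:E); ring.
  - by apply/measurable_EFinP; exact: measurable_funX.
  - by move=> x; rewrite lee_fin sqr_ge0.
set eta := ((dyadic k)%:E * Lnorm Q 2%:E (EFin \o C))%E.
have uQ : (sqrte (lne (2%:E * covering_number eta F Q)) <= unif_entropy (dyadic k))%E.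
  apply: ereal_sup_ubound; exists Q => //; exact: weighted_prob_finitely_supported.
have covoo : (covering_number eta F Q < +oo)%E.
  rewrite ltey; apply/eqP => coo; move: uQ (ufin k); rewrite coo gt0_muley ?lte_fin//=.
  by rewrite leye_eq => /eqP ->.
have [N [c [NE cF cov]]] := covering_number_attained covoo.
exists N, c; split => //.
  move: uQ; rewrite NE -EFinM.
  (* [F] is nonempty, so [N >= 1] and [ln (2 N)] is a nonnegative real number. *)
  have [i _] : exists i : 'I_N, True by have [f /cov[i _]] := F0; exists i.
  have N0 : 0 < N%:R :> R by rewrite ltr0n (leq_ltn_trans _ (ltn_ord i)).
  have N20 : 0 < 2 * N%:R :> R by rewrite mulr_gt0.
  rewrite lne_EFin//= -(fineK (ufin k)) lee_fin => h.
  rewrite -[leLHS]lnK ?posrE// ler_expR.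
  have lnN0 : 0 <= ln (2 * N%:R : R).
    by rewrite ln_ge0// -natrM ler1n muln_gt0 -!(ltr0n R) N0 andbT.
  rewrite -(sqr_sqrtr lnN0) ler_pXn2r ?nnegrE ?sqrtr_ge0//=.
  exact/fine_ge0/unif_entropy_ge0.
move=> f Ff; have [i ci] := cov f Ff; exists i.
have mfc : measurable_fun setT (fun x => f x - c i x).
  by apply: measurable_funB; exact: mF.
have := gt0_ler_poweR (ler0n R 2) _ _ ci.
rewrite !in_itv/= !leey !andbT /eta mule_ge0 ?Lnorm_ge0 ?lee_fin ?(ltW (dyadic_gt0 _))//.
move=> /(_ isT isT); rewrite poweRM ?Lnorm_ge0 ?lee_fin ?(ltW (dyadic_gt0 _))//.
rewrite (intQ _ mfc) (intQ _ mC) poweR_EFin powR_mulrn ?(ltW (dyadic_gt0 _))//.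
by rewrite -EFinM lee_fin mulrCA ler_pM2l ?invr_gt0.
Qed.

End entropy_covers.

(** * From [L^1] to weighted [L^1] smallness *)

Section uniform_weighted.
Context d (S : measurableType d) {R : realType} (mu : probability S R).

(** Dominated convergence: the integrand vanishes at [x] as soon as [m] exceeds [w x], and is
    dominated by [w * xi]. *)
Lemma truncation_cvg0 (w xi : S -> R) (e : R) :
  (forall x, 0 <= w x) -> (forall x, 0 <= xi x) -> measurable_fun setT w ->
  measurable_fun setT xi ->
  mu.-integrable setT (fun x => (w x * xi x)%:E) -> 0 < e ->
  exists m : nat, \int[mu]_x ((w x - Num.min (w x) m%:R) * xi x) <= e.
Proof.
move=> w0 xi0 mw mxi iwxi e0.
pose f_ (m : nat) x := ((w x - Num.min (w x) m%:R) * xi x)%:E.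
have f0 m x : 0 <= (w x - Num.min (w x) m%:R) * xi x.
  by rewrite mulr_ge0// subr_ge0 ge_min lexx.
have [|||||_ _ cvg0] := @dominated_convergence _ _ _ mu setT measurableT f_ (cst 0%E)
  (fun x => (w x * xi x)%:E) => //.
- move=> m; apply/measurable_EFinP; apply: measurable_funM => //.
  by apply: measurable_funB => //; exact: measurable_minr.
- apply/aeW => x _; apply: cvg_near_cst.
  exists (Num.truncn (w x)).+1 => // m /= wm.
  have /min_idPl wE : w x <= m%:R.
    by rewrite (le_trans (ltW (truncnS_gt _)))// ler_nat.
  by rewrite /f_ wE subrr mul0r.
- apply/aeW => x m _; rewrite /f_ /= lee_fin ger0_norm// ler_wpM2r// gerBl.
  by rewrite le_min w0 ler0n.
rewrite integral0 in cvg0.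
have /cvg_ballP/(_ e e0) : fine (\int[mu]_x f_ m x)%E @[m --> \oo] --> (0 : R).
  exact: fine_cvg cvg0.
move=> [m _ /(_ m (leqnn m))]; rewrite /ball /= sub0r normrN => /ltW fe.
by exists m; apply: le_trans fe; exact: ler_norm.
Qed.

Lemma integrable_bound (f g : S -> R) : measurable_fun setT f ->
  mu.-integrable setT (EFin \o g) -> (forall x, `|f x| <= g x) ->
  mu.-integrable setT (EFin \o f).
Proof.
move=> mf ig fg; apply: (le_integrable measurableT _ _ ig).
  exact/measurable_EFinP.
by move=> x _ /=; rewrite lee_fin (le_trans (fg x))// ler_norm.
Qed.

(** Separability provides closeness of [G] in plain [L^1], whereas the means of [H] are compared
    through [w |G - G'|] with [w] unbounded. Truncating [w] at [m] bridges the gap: the bounded part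
    costs a factor [m], and the rest is small uniformly in [g] by domination. *)
Lemma uniform_weighted_L1 (w xi : S -> R) (e : R) :
  (forall x, 1 <= w x) -> (forall x, 0 <= xi x) -> measurable_fun setT w ->
  measurable_fun setT xi ->
  mu.-integrable setT (fun x => (w x * xi x)%:E) -> 0 < e ->
  exists2 eta : R, 0 < eta & forall g : S -> R, measurable_fun setT g ->
    (forall x, `|g x| <= xi x) -> \int[mu]_x `|g x| <= eta ->
    \int[mu]_x (w x * `|g x|) <= e.
Proof.
move=> w1 xi0 mw mxi iwxi e0.
have w0 x : 0 <= w x := le_trans ler01 (w1 x).
have e20 : 0 < e / 2 by rewrite divr_gt0.
have [m mP] := truncation_cvg0 w0 xi0 mw mxi iwxi e20.
exists (e / 2 / m.+1%:R); first by rewrite divr_gt0.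
move=> g mg gxi gint.
have mng : measurable_fun setT (fun x => `|g x|) by exact: measurableT_comp.
have ixi : mu.-integrable setT (EFin \o xi).
  apply: (integrable_bound (g := fun x => w x * xi x)) => // x.
  by rewrite ger0_norm// ler_peMl.
have ig : mu.-integrable setT (fun x => `|g x|%:E).
  by apply: (integrable_bound (g := xi)) => // x; rewrite normr_id.
have iwg : mu.-integrable setT (fun x => (w x * `|g x|)%:E).
  apply: (integrable_bound (g := fun x => w x * xi x)) => //.
    exact: measurable_funM.
  by move=> x; rewrite normrM normr_id ger0_norm// ler_wpM2l.
have itr : mu.-integrable setT (fun x => ((w x - Num.min (w x) m%:R) * xi x)%:E).
  apply: (integrable_bound (g := fun x => w x * xi x)) => //.
    apply: measurable_funM => //.
    by apply: measurable_funB => //; exact: measurable_minr.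
  move=> x; rewrite ger0_norm ?mulr_ge0 ?subr_ge0 ?ge_min ?lexx//.
  by rewrite ler_wpM2r// gerBl le_min w0 ler0n.
have img : mu.-integrable setT (fun x => (m.+1%:R * `|g x|)%:E).
  exact: (integrableZl measurableT m.+1%:R ig).
apply: (@le_trans _ _ (\int[mu]_x (m.+1%:R * `|g x| +
    (w x - Num.min (w x) m%:R) * xi x))).
  apply: le_Rintegral => //; first exact: (integrableD measurableT img itr).
  move=> x _; rewrite -lerBlDl -mulrBl.
  apply: (@le_trans _ _ ((w x - Num.min (w x) m%:R) * `|g x|)).
    rewrite ler_wpM2r// lerB// ge_min; apply/orP; right.
    by rewrite ler_nat.
  by rewrite ler_wpM2l// subr_ge0 ge_min lexx.
rewrite RintegralD// RintegralZl//.
rewrite [leRHS]splitr; apply: lerD => //.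
by rewrite mulrC -ler_pdivlMr.
Qed.

End uniform_weighted.

(** * Maximal inequality for a class indexed by [i] and [t] *)

Section maximal_inequality.
Context d (S : measurableType d) {R : realType} (mu : probability S R).
Local Notation pp := (product_power mu).

Lemma integral_tnth n (j : 'I_n) (g : S -> \bar R) :
  measurable_fun setT g -> (forall x, 0 <= g x)%E ->
  (\int[pp n]_z g (tnth z j) = \int[mu]_x g x)%E.
Proof.
move=> mg g0; elim: n j => [[]//|n IH] j.
have mgj : measurable_fun setT (fun z : n.+1.-tuple S => g (tnth z j)).
  by apply: measurableT_comp => //; exact: measurable_tnth.
case: (unliftP ord0 j) => [i|] jE; rewrite jE in mgj *.
  rewrite (integral_product_powerS mu mgj _).2//.
  under eq_integral do under eq_integral do rewrite tnth_cons.
  by under eq_integral do rewrite integral_prob_cst.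
rewrite (integral_product_powerS mu mgj _).1//.
by apply: eq_integral => x _; exact: (integral_prob_cst (pp n) (g x)).
Qed.

(** The grid consists of the midpoints of the [2^(k+3)] equal cells of [[-A, A]], whose half-width
    is [A * dyadic k]. *)
Lemma grid_approx (A x : R) k : 0 <= A -> `|x| <= A ->
  exists l : 'I_(2 ^ k.+3),
    `|x - (- A + (2 * l%:R + 1) * (A * dyadic k))| <= A * dyadic k.
Proof.
move=> A0 xA; have g0 : (0 < 2 ^ k.+3)%N by rewrite expn_gt0.
have gE : dyadic k * (2 ^ k.+3)%:R = 1 :> R.
  by rewrite dyadic.unlock natrX -exprMn mulVf// expr1n.
have [A00|A00] := eqVneq A 0.
  exists (Ordinal g0); move: xA; rewrite A00 normr_le0 => /eqP ->.
  by rewrite mul0r mulr0 oppr0 addr0 subr0 normr0.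
have {}A0 : 0 < A by rewrite lt_def A00.
set g := (2 ^ k.+3)%N in g0 gE *.
pose y := (x + A) / (2 * A) * g%:R.
have y0 : 0 <= y.
  rewrite !mulr_ge0// ?invr_ge0 ?mulr_ge0// ?(ltW A0)//.
  by rewrite -lerBlDr sub0r; move: xA; rewrite ler_norml => /andP[].
have yg : y <= g%:R.
  rewrite -[leRHS]mul1r ler_wpM2r// ler_pdivrMr ?mulr_gt0// mul1r.
  by move: xA; rewrite ler_norml => /andP[_]; lra.
have [l /andP[ly yl]] : exists l : 'I_g, l%:R <= y <= l%:R + 1.
  have [yltg|] := ltP y g%:R.
    have lg : (Num.truncn y < g)%N.
      by rewrite -(ltr_nat R) (le_lt_trans _ yltg)// truncn_le.
    exists (Ordinal lg) => /=; apply/andP; split; first by rewrite truncn_le.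
    by rewrite natr1 ltW// truncnS_gt.
  (* The right end [y = g] lies in no half-open cell and is given to the last one. *)
  move=> gy; have gg : (g.-1 < g)%N by rewrite prednK.
  exists (Ordinal gg) => /=; rewrite natr1 prednK// yg andbT.
  by rewrite (le_trans _ gy)// ler_nat leq_pred.
exists l; have -> : x = - A + 2 * y * (A * dyadic k).
  have -> : 2 * y * (A * dyadic k) = (x + A) * (dyadic k * g%:R).
    by rewrite /y; field; rewrite gt_eqF.
  by rewrite gE; ring.
have -> : - A + 2 * y * (A * dyadic k) - (- A + (2 * l%:R + 1) * (A * dyadic k))
  = (2 * (y - l%:R) - 1) * (A * dyadic k) by ring.
have Ad0 : 0 <= A * dyadic k := mulr_ge0 (ltW A0) (ltW (dyadic_gt0 k)).
rewrite normrM (ger0_norm Ad0) ler_piMl// ler_norml; apply/andP; lra.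
Qed.

(** The price of the grids in [t] in the chaining sum; the closed form of the partial sums is proved
    by induction. *)
Lemma sum_dyadic_linear K : \sum_(k < K) dyadic k * (k%:R + 3) <= 1 :> R.
Proof.
have -> : \sum_(k < K) dyadic k * (k%:R + 3) = 1 - 2 * (K%:R + 4) * dyadic K :> R.
  elim: K => [|K IH]; first by rewrite big_ord0 dyadic0; field.
  by rewrite big_ord_recr/= IH (dyadicS K) -natr1; ring.
by rewrite gerBl !mulr_ge0 ?ltW ?dyadic_gt0// addr_gt0.
Qed.

Context (I : choiceType) (U : set I) (G : I -> S -> R) (H : I -> R -> S -> R).
Variables (i0 : I) (t0 : R) (w L2 xi : S -> R) (A M V : R).
Hypothesis Ui0 : U i0.
Hypothesis mG : forall i, U i -> measurable_fun setT (G i).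
Hypothesis intH : forall i t, U i -> mu.-integrable setT (EFin \o H i t).
Hypothesis w_gt0 : forall z, 0 < w z.
Hypothesis mw : measurable_fun setT w.
Hypothesis mL2 : measurable_fun setT L2.
Hypothesis mxi : measurable_fun setT xi.
Hypothesis xi_gt0 : forall z, 0 < xi z.
Hypothesis G_xi : forall i z, U i -> `|G i z - G i0 z| <= xi z.
Hypothesis lipH : forall i j t s z, U i -> U j ->
  (H i t z - H j s z) ^+ 2 <=
  w z ^+ 2 * (G i z - G j z) ^+ 2 + L2 z ^+ 2 * (t - s) ^+ 2.
Hypothesis entropy :
  (entropy_integral [set (fun z => G i z - G i0 z)%R | i in U] xi 8^-1 <= M%:E)%E.
Hypothesis A_ge0 : 0 <= A.

(** The squared envelope of the increments [H i t - H i0 t0] with [|t - t0| <= A], as given by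
    [lipH]. *)
Local Notation b := (fun z => w z ^+ 2 * xi z ^+ 2 + A ^+ 2 * L2 z ^+ 2).

Hypothesis M_ge0 : 0 <= M.
Hypothesis V_gt0 : 0 < V.
Hypothesis b_V : (\int[mu]_z (b z)%:E <= (V ^+ 2)%:E)%E.

Section finite_class.
Context (T : finType) (theta : T -> I) (tau : T -> R).
Hypothesis U_theta : forall t, U (theta t).
Hypothesis tau_A : forall t, `|tau t - t0| <= A.

Let f t z := H (theta t) (tau t) z - H i0 t0 z.

(** The centres at level [k] are the [H j s] with [j] from the weighted cover and [s] on the grid.
    Since [lipH] bounds squares by a sum of squares, the two errors add up to exactly
    [dyadic k ^+ 2] times the sum of [b] over the sample. In [2 * M + 1] the first part comes from
    the cover, the 1 from the grids. *)
Lemma sgn_avg_class n (z : n.+1.-tuple S) :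
  sgn_avg n.+1 (fun s => \big[Num.max/0]_(t : T)
      `|dot s (fun j => f t (tnth z j))|)
  <= 72 * Num.sqrt (\sum_(j < n.+1) b (tnth z j)) * (2 * M + 1).
Proof.
have F0 : [set (fun z => G i z - G i0 z) | i in U] !=set0 by exists (fun z => G i0 z - G i0 z); exists i0.
have mF g : [set (fun z => G i z - G i0 z) | i in U] g -> measurable_fun setT g.
  by move=> [i Ui <-]; apply: measurable_funB; exact: mG.
have [D [D0 Dsum Dcov]] := entropy_covers F0 mF mxi entropy.
pose r2 := \sum_(j < n.+1) b (tnth z j).
have r2E : r2 = \sum_(j < n.+1) w (tnth z j) ^+ 2 * xi (tnth z j) ^+ 2
    + A ^+ 2 * \sum_(j < n.+1) L2 (tnth z j) ^+ 2.
  by rewrite /r2 big_split/= mulr_sumr.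
have b0 x : 0 < b x.
  by rewrite ltr_wpDr ?mulr_gt0 ?exprn_gt0// mulr_ge0 ?sqr_ge0.
have r20 : 0 < r2.
  by rewrite /r2 big_ord_recl ltr_wpDr// sumr_ge0// => *; exact/ltW.
(* The cover consists of functions [G j - G i0]; indices [j] in [U] are recorded instead, because
   [H] has to be evaluated at them. *)
pose ok k (p : {N : nat & 'I_N -> I}) := [/\ forall i, U (projT2 p i),
  2 * (projT1 p)%:R <= expR (D k ^+ 2) &
  forall i, U i -> exists l : 'I_(projT1 p),
    \sum_(j < n.+1) w (tnth z j) ^+ 2 *
       (G i (tnth z j) - G (projT2 p l) (tnth z j)) ^+ 2
    <= dyadic k ^+ 2 * \sum_(j < n.+1) w (tnth z j) ^+ 2 * xi (tnth z j) ^+ 2].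
have /choice [p pP] : forall k, exists p, ok k p.
  move=> k; have [N [c [cF N2 cov]]] :=
    Dcov n (tnth z) (fun j => w (tnth z j)) k (fun j => w_gt0 _).
  have /choice[q qP] : forall l, exists i, U i /\ (fun z => G i z - G i0 z) = c l.
    by move=> l; have [i Ui <-] := cF l; exists i.
  exists (existT _ N q); split => //= [l|i Ui]; first by have [] := qP l.
  have [|l lP] := cov (fun z => G i z - G i0 z); first by exists i.
  exists l; apply: le_trans lP; rewrite le_eqVlt; apply/orP; left; apply/eqP.
  apply: eq_bigr => j _; have [_ <-] := qP l; congr (_ * _ ^+ 2); ring.
pose tg k (l : nat) : R := t0 + (- A + (2 * l%:R + 1) * (A * dyadic k)).
pose c k (jl : 'I_(projT1 (p k)) * 'I_(2 ^ k.+3)) (j : 'I_n.+1) :=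
  H (projT2 (p k) jl.1) (tg k jl.2) (tnth z j) - H i0 t0 (tnth z j).
(* [D k] pays for the cover and [k + 3] for the [2^(k+3)] grid points, by [2 <= e] and
   [D^2 + (k + 3) <= (D + (k + 3))^2]. *)
apply: (sgn_avg_chaining (c := c) (L := fun k => D k + (k%:R + 3))).
- by rewrite sqrtr_gt0.
- move=> t; rewrite sqr_sqrtr ?(ltW r20)//; apply: ler_sum => j _.
  apply: (le_trans (lipH _ _ _ (U_theta t) Ui0)); apply: lerD.
    rewrite ler_wpM2l ?sqr_ge0// -[leLHS]real_normK ?num_real//.
    by rewrite ler_pXn2r ?nnegrE ?(ltW (xi_gt0 _))// G_xi.
  rewrite mulrC ler_wpM2r ?sqr_ge0// -[leLHS]real_normK ?num_real//.
  by rewrite ler_pXn2r ?nnegrE.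
- by move=> k; rewrite ltr_wpDl// addr_gt0.
- move=> k; have [_ N2 _] := pP k.
  rewrite card_prod !card_ord natrM mulrA.
  apply: (@le_trans _ _ (expR (D k ^+ 2) * expR (k%:R + 3))).
    apply: ler_pM => //.
    have -> : k%:R + 3 = (k.+3)%:R :> R by rewrite -!natr1; ring.
    rewrite -[X in expR X]mulr1 -[X in expR (X * _)]mulr_natl mulr1.
    rewrite expRM_natl natrX lerXn2r ?nnegrE ?expR_ge0//.
    by have := expR_ge1Dx (1 : R); rewrite -[2]/(1 + 1).
  rewrite -expRD ler_expR.
  have := D0 k; have : 0 <= k%:R :> R by []; nra.
- move=> k t; have [_ _ cov] := pP k; have [l lP] := cov _ (U_theta t).
  have [g gP] := grid_approx k A_ge0 (tau_A t).
  exists (l, g); have [UP _ _] := pP k.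
  rewrite exprMn sqr_sqrtr ?(ltW r20)// -/r2 r2E mulrDl.
  apply: (@le_trans _ _ (\sum_(j < n.+1) (w (tnth z j) ^+ 2 *
       (G (theta t) (tnth z j) - G (projT2 (p k) l) (tnth z j)) ^+ 2
       + L2 (tnth z j) ^+ 2 * (tau t - tg k g) ^+ 2))).
    apply: ler_sum => j _; apply: le_trans (lipH _ _ _ (U_theta t) (UP l)).
    by rewrite /f /c /= le_eqVlt; apply/orP; left; apply/eqP; congr (_ ^+ 2); ring.
  rewrite big_split/=; apply: lerD; first by rewrite mulrC.
  rewrite -mulr_suml mulrAC mulrC ler_wpM2r//.
    by apply: sumr_ge0 => *; exact: sqr_ge0.
  rewrite -exprMn -[leLHS]real_normK ?num_real// ler_pXn2r ?nnegrE ?mulr_ge0 ?(ltW (dyadic_gt0 _))//.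
  by rewrite /tg opprD addrA.
- move=> K; under eq_bigr do rewrite mulrDr; rewrite big_split/=.
  by apply: lerD; [exact: Dsum|exact: sum_dyadic_linear].
Qed.

Let mean t := fine (\int[mu]_x (f t x)%:E).

Let intf t : mu.-integrable setT (EFin \o f t).
Proof.
have -> : EFin \o f t = ((EFin \o H (theta t) (tau t)) \- (EFin \o H i0 t0))%E.
  by apply/funext.
by apply: integrableB => //; exact: intH.
Qed.

Let mf t : measurable_fun setT (f t).
Proof. by apply/measurable_EFinP; exact: measurable_int (intf t). Qed.

Lemma maximal_ineq n :
  (\int[pp n.+1]_z (\big[Num.max/0]_(t : T)
      `|\sum_(j < n.+1) (f t (tnth z j) - mean t)|)%:E
   <= (144 * (2 * M + 1) * (Num.sqrt n.+1%:R * V))%:E)%E.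
Proof.
apply: (le_trans (symmetrization mf intf n.+1)).
(* [c ^+ 2] bounds the mean of the sum of [b] over the sample, so linearizing the square root at [c]
   loses nothing in the final bound; 144 is 72 times the 2 of symmetrization. *)
pose c := Num.sqrt n.+1%:R * V; have c0 : 0 < c by rewrite mulr_gt0 ?sqrtr_gt0.
have c2 : c ^+ 2 = n.+1%:R * V ^+ 2 by rewrite exprMn sqr_sqrtr.
pose K : R := 72 * (2 * M + 1); have K0 : 0 <= K by rewrite mulr_ge0 ?addr_ge0 ?mulr_ge0.
have b0 x : 0 <= b x by apply: addr_ge0; rewrite mulr_ge0 ?sqr_ge0.
have mb : measurable_fun setT (fun x => (b x)%:E).
  apply/measurable_EFinP; apply: measurable_funD.
    by apply: measurable_funM; exact: measurable_funX.
  by apply: measurable_funM => //; exact: measurable_funX.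
have mbj j : measurable_fun setT (fun z : n.+1.-tuple S => (b (tnth z j))%:E).
  by apply: (measurableT_comp mb); exact: measurable_tnth.
apply: (@le_trans _ _ (\int[pp n.+1]_z
    ((K / c)%:E * (\sum_(j < n.+1) (b (tnth z j))%:E) + (K * c)%:E))%E).
  apply: le_integral_nomeas => z _.
    rewrite lee_fin mulr_ge0// -[X in X <= _](sgn_avg_cst n.+1 0).
    by apply: sgn_avg_le => s _; exact: bigmax_ge_id.
  rewrite sumEFin -EFinM -EFinD lee_fin.
  apply: (@le_trans _ _ (2 * (72 * Num.sqrt (\sum_(j < n.+1) b (tnth z j)) * (2 * M + 1)))).
    by rewrite ler_pM2l//; exact: sgn_avg_class.
  set y := \sum_(j < n.+1) b (tnth z j).
  have y0 : 0 <= y by apply: sumr_ge0.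
  have -> : 2 * (72 * Num.sqrt y * (2 * M + 1)) = K * (2 * Num.sqrt y) by rewrite /K; ring.
  have -> : K / c * y + K * c = K * (y / c + c) by field; rewrite gt_eqF.
  (* AM-GM replaces Jensen's inequality for the square root. *)
  rewrite ler_wpM2l// -subr_ge0.
  have -> : y / c + c - 2 * Num.sqrt y = (Num.sqrt y - c) ^+ 2 / c.
    by rewrite -{1}(sqr_sqrtr y0); field; rewrite gt_eqF.
  by rewrite divr_ge0 ?sqr_ge0// ltW.
rewrite ge0_integralD//=; last 3 first.
- by move=> z _; rewrite mule_ge0 ?lee_fin ?divr_ge0 ?(ltW c0)// sume_ge0// => j _; rewrite lee_fin.
- by apply: emeasurable_funM => //; exact: emeasurable_sum.
- by move=> z _; rewrite lee_fin mulr_ge0// ltW.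
rewrite integral_prob_cst ge0_integralZl//; last 3 first.
- exact: emeasurable_sum.
- by move=> z _; apply: sume_ge0 => j _; rewrite lee_fin.
- by rewrite lee_fin divr_ge0// ltW.
rewrite ge0_integral_sum//; last by move=> j z _; rewrite lee_fin.
under eq_bigr do rewrite (integral_tnth _ mb (fun x => b0 x)).
have -> : 144 * (2 * M + 1) * (Num.sqrt n.+1%:R * V) = K / c * c ^+ 2 + K * c.
  by rewrite -/c /K; field; rewrite gt_eqF.
rewrite EFinD; apply: leeD2r; rewrite (EFinM (K / c)); apply: lee_wpmul2l.
  by rewrite lee_fin divr_ge0// ltW.
rewrite sumr_const card_ord c2 -[leLHS]mule_natl EFinM.
exact: lee_wpmul2l.
Qed.

End finite_class.

(** Markov's inequality for the maximum over the first [N] members, with a bound free of [N]; these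
    events increase to [E]. *)
Lemma maximal_tail n (theta : nat -> I) (tau : nat -> R) (c : R) :
  (forall k, U (theta k)) -> (forall k, `|tau k - t0| <= A) -> 0 < c ->
  let f k z := H (theta k) (tau k) z - H i0 t0 z in
  let E := [set z : n.+1.-tuple S | exists k, c <
     `|\sum_(j < n.+1) (f k (tnth z j) - fine (\int[mu]_x (f k x)%:E))|] in
  measurable E /\
  (pp n.+1 E <= (144 * (2 * M + 1) * (Num.sqrt n.+1%:R * V) / c)%:E)%E.
Proof.
move=> Utheta tauA c0 f E.
pose X k (z : n.+1.-tuple S) :=
  `|\sum_(j < n.+1) (f k (tnth z j) - fine (\int[mu]_x (f k x)%:E))|.
have mX k : measurable_fun setT (X k).
  apply: measurableT_comp => //; apply: measurable_sum => j.
  apply: measurable_funB => //; apply: measurable_funB; apply: measurableT_comp.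
  - by apply/measurable_EFinP; exact: measurable_int (intH _ (Utheta k)).
  - exact: measurable_tnth.
  - by apply/measurable_EFinP; exact: measurable_int (intH _ Ui0).
  - exact: measurable_tnth.
pose B N := [set z | c < \big[Num.max/0]_(k < N) X k z].
have mB N : measurable (B N).
  rewrite /B -[X in measurable X]setTI -preimage_itvoy.
  exact: (measurable_bigmax (h := fun k : 'I_N => X k)).
have EB : E = \bigcup_N B N.
  apply/seteqP; split => [z [k ck]|z [N _]].
    exists k.+1 => //; apply: (lt_le_trans ck).
    exact: (le_bigmax _ (fun k : 'I_(k.+1) => X k z) ord_max).
  rewrite /B /= => cN; apply: contrapT => noE.
  suff : \big[Num.max/0]_(k < N) X k z <= c by rewrite leNgt cN.
  apply/bigmax_leP; split=> [|k _]; first exact: ltW.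
  by rewrite leNgt; apply/negP => ck; apply: noE; exists k.
have mE : measurable E by rewrite EB; exact: bigcup_measurable.
split=> //.
have ndB : {homo B : n0 m0 / (n0 <= m0)%N >-> (n0 <= m0)%O}.
  move=> N N' NN'; apply/subsetPset => z; rewrite /B /= => /lt_le_trans; apply.
  apply/bigmax_leP; split=> [|k _]; first exact: bigmax_ge_id.
  exact: (le_bigmax _ (fun k : 'I_N' => X k z) (widen_ord NN' k)).
have cvgB : pp n.+1 (B N) @[N --> \oo] --> pp n.+1 E.
  rewrite EB; apply: nondecreasing_cvg_mu => //.
  exact: bigcup_measurable.
rewrite -(cvg_lim _ cvgB)//; apply: lime_le; first by apply/cvg_ex; exists (pp n.+1 E).
apply: nearW => N; rewrite EFinM lee_pdivlMr//.
have := @maximal_ineq 'I_N (fun k => theta k) (fun k => tau k)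
  (fun k => Utheta k) (fun k => tauA k) n.
apply: le_trans; rewrite muleC -(setIT (B N)) -integral_indic//.
rewrite -ge0_integralZl//; last 2 first.
- by apply/measurable_EFinP; exact: measurable_indic.
- by rewrite lee_fin ltW.
apply: le_integral_nomeas => z _; rewrite -EFinM lee_fin.
  by rewrite mulr_ge0// ltW.
rewrite indicE; case: (boolP (z \in B N)) => [|_]; last first.
  by rewrite mulr0 bigmax_ge_id.
by rewrite mulr1 inE => /ltW.
Qed.

Hypothesis w_ge1 : forall z, 1 <= w z.
Hypothesis L2_ge0 : forall z, 0 <= L2 z.
Hypothesis iL2 : mu.-integrable setT (EFin \o L2).
Hypothesis iwxi : mu.-integrable setT (fun z => (w z * xi z)%:E).

Let lip1 i j t s z : U i -> U j ->
  `|H i t z - H j s z| <= w z * `|G i z - G j z| + L2 z * `|t - s|.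
Proof.
move=> Ui Uj; have w0 := ltW (w_gt0 z).
rewrite -(@ler_pXn2r _ 2)// ?nnegrE ?addr_ge0 ?mulr_ge0//.
rewrite real_normK ?num_real//; apply: (le_trans (lipH t s z Ui Uj)).
rewrite -(real_normK (num_real (G i z - G j z))) -(real_normK (num_real (t - s))).
rewrite sqrrD !exprMn lerD2r lerDl mulrn_wge0//.
by rewrite !mulr_ge0.
Qed.

(** The centring terms must also survive the passage to a countable subclass: the mean of [H] is
    uniformly continuous for the [L^1] distance of the [G i] and for [t]. *)
Let mean_dist (e : R) : 0 < e -> exists2 eta : R, 0 < eta &
  forall i j t s, U i -> U j -> \int[mu]_x `|G i x - G j x| <= eta ->
  `|t - s| <= eta ->
  `|\int[mu]_x H i t x - \int[mu]_x H j s x| <= e.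
Proof.
move=> e0; have e20 : 0 < e / 2 by rewrite divr_gt0.
have iw2xi : mu.-integrable setT (fun z => (w z * (2 * xi z))%:E).
  have -> : (fun z => (w z * (2 * xi z))%:E) = (fun z => 2%:E * (w z * xi z)%:E)%E.
    by apply/funext => z; rewrite -EFinM mulrCA.
  exact: integrableZl.
have [|||||eta1 eta10 etaP] := @uniform_weighted_L1 _ _ _ mu w (fun z => 2 * xi z) (e / 2) w_ge1 => //.
- by move=> z; rewrite mulr_ge0// ltW.
- exact: measurable_funM.
pose EL2 := \int[mu]_x L2 x.
have EL20 : 0 <= EL2 by exact: Rintegral_ge0.
exists (Num.min eta1 (e / 2 / (EL2 + 1))).
  by rewrite lt_min eta10 divr_gt0// ltr_wpDl.
move=> i j t s Ui Uj; rewrite !le_min => /andP[G1 _] /andP[_ ts].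
have mGij : measurable_fun setT (fun x => G i x - G j x).
  by apply: measurable_funB; exact: mG.
have Gij x : `|G i x - G j x| <= 2 * xi x.
  have -> : G i x - G j x = (G i x - G i0 x) - (G j x - G i0 x) by ring.
  apply: le_trans (ler_normB _ _) _.
  by rewrite mulr_natl mulr2n; apply: lerD; exact: G_xi.
have iwG : mu.-integrable setT (fun x => (w x * `|G i x - G j x|)%:E).
  apply: (integrable_bound (g := fun z => w z * (2 * xi z))) => //.
    by apply: measurable_funM => //; exact: measurableT_comp.
  have w0 x := ltW (w_gt0 x).
  by move=> x; rewrite normrM normr_id ger0_norm// ler_wpM2l.
have iL2ts : mu.-integrable setT (fun x => (L2 x * `|t - s|)%:E).
  have -> : (fun x => (L2 x * `|t - s|)%:E) = (fun x => `|t - s|%:E * (L2 x)%:E)%E.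
    by apply/funext => z; rewrite -EFinM mulrC.
  exact: integrableZl.
have iHB : mu.-integrable setT (EFin \o (fun x => H i t x - H j s x)).
  exact: (integrableB measurableT (intH t Ui) (intH s Uj)).
rewrite -RintegralB//; [|exact: intH|exact: intH].
apply: le_trans (le_normr_Rintegral measurableT iHB) _.
apply: (@le_trans _ _ (\int[mu]_x (w x * `|G i x - G j x| + L2 x * `|t - s|))).
  apply: le_Rintegral => //.
  - apply: (integrable_bound (g := fun x => `|H i t x - H j s x|)).
    + apply: measurableT_comp => //; apply/measurable_EFinP.
      exact: measurable_int iHB.
    + exact: (integrable_abse iHB).
    + by move=> x; rewrite normr_id.
  - exact: (integrableD measurableT iwG iL2ts).
  - by move=> x _; exact: lip1.
rewrite RintegralD// RintegralZr// [leRHS]splitr; apply: lerD.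
  exact: etaP.
have := ts; rewrite ler_pdivlMr ?ltr_wpDl// => {}ts.
by apply: le_trans ts; rewrite mulrC ler_wpM2l// lerDl.
Qed.

(** The exceptional set is built from a countable family, so it is measurable. A violation anywhere
    in the class is strict and persists at a nearby member of that family, provided the sample [z]
    is one at which [C] is dense. *)
Lemma class_tail n (C : set I) (c : R) : countable C -> C `<=` U -> 0 < c ->
  exists E : set (n.+1.-tuple S), [/\ measurable E,
    (pp n.+1 E <= (144 * (2 * M + 1) * (Num.sqrt n.+1%:R * V) / c)%:E)%E &
    forall z, (forall i eta, U i -> 0 < eta -> exists2 j, C j &
        \int[mu]_x `|G i x - G j x| < eta /\
        forall k, `|G i (tnth z k) - G j (tnth z k)| < eta) ->
      ~ E z -> forall i t, U i -> `|t - t0| <= A ->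
      `|\sum_(k < n.+1) ((H i t (tnth z k) - H i0 t0 (tnth z k))
          - \int[mu]_x (H i t x - H i0 t0 x))| <= c].
Proof.
move=> /countable_injP[q q_inj] CU c0.
(* Rationals are projected onto [[-A, A]], which does not increase distances to points of the
   interval and also handles [A = 0]. *)
pose clamp (x : R) := Num.max (- A) (Num.min x A).
have clampA x : `|clamp x| <= A.
  by rewrite ler_norml /clamp le_max lexx/= ge_max ge_min lexx orbT (le_trans _ A_ge0)// oppr_le0.
have clamp_dist x y : `|x| <= A -> `|x - clamp y| <= `|x - y|.
  rewrite ler_norml /clamp => /andP[x1 x2].
  rewrite ler_norml lerBlDr; have := ler_norm (x - y); have := ler_norm (y - x).
  rewrite distrC => h1 h2; case: (leP y A) => yA; case: (leP (- A) _) => Ay; apply/andP; split; lra.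
(* Pairs of a point of [C] and a rational are enumerated by their codes. A code that belongs to no
   point of [C] yields [i0], which lies in [U]. *)
pose th (k : nat) : I := xget i0 [set i | C i /\
  Some (q i) = omap fst (unpickle k : option (nat * rat))].
pose ta (k : nat) : R := t0 + clamp
  (if (unpickle k : option (nat * rat)) is Some p then ratr p.2 else 0).
have Uth k : U (th k) by rewrite /th; case: xgetP => [i _ [/CU]|].
have taA k : `|ta k - t0| <= A by rewrite /ta addrAC subrr add0r.
have [mE PE] := maximal_tail n Uth taA c0.
exists [set z : n.+1.-tuple S | exists k, c <
     `|\sum_(j < n.+1) ((H (th k) (ta k) (tnth z j) - H i0 t0 (tnth z j))
       - \int[mu]_x (H (th k) (ta k) x - H i0 t0 x))|].
split => // z zC nE i t Ui tA; rewrite leNgt; apply/negP => cY.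
pose Y i t := \sum_(k < n.+1) ((H i t (tnth z k) - H i0 t0 (tnth z k))
          - \int[mu]_x (H i t x - H i0 t0 x)).
(* [a] is the excess over the bound; [a / 4] is spent on the sum over the sample and [a / 4] on the
   means. *)
pose a := `|Y i t| - c; have a0 : 0 < a by rewrite subr_gt0.
suff [k Yk] : exists k, `|Y i t - Y (th k) (ta k)| < a.
  apply: nE; exists k; rewrite -/(Y (th k) (ta k)).
  have := lerB_dist (Y i t) (Y (th k) (ta k)) => h.
  by have := le_lt_trans h Yk; rewrite /a; lra.
pose W := \sum_(k < n.+1) (w (tnth z k) + L2 (tnth z k)).
have W0 : 0 <= W by apply: sumr_ge0 => k _; rewrite addr_ge0// ltW.
have e0 : 0 < a / 4 / n.+1%:R by rewrite !divr_gt0.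
have [eta1 eta10 etaP] := mean_dist e0.
pose eta := Num.min eta1 (a / 4 / (W + 1)).
have eta0 : 0 < eta by rewrite lt_min eta10 !divr_gt0// ltr_wpDl.
have [j Cj [GL1 Gz]] := zC i eta Ui eta0.
have [r rP] : exists r : rat, `|t - (t0 + clamp (ratr r))| < eta.
  have tt : t - t0 < t - t0 + eta by rewrite ltrDl.
  have [r] := rat_in_itvoo tt; rewrite in_itv/= => /andP[r1 r2]; exists r.
  rewrite opprD addrA; apply: le_lt_trans (clamp_dist _ _ tA) _.
  by rewrite ltr_norml; apply/andP; split; lra.
exists (pickle (q j, r)).
have thE : th (pickle (q j, r)) = j.
  rewrite /th; case: xgetP => [i' _ [Ci' ]|/(_ j)]; rewrite pickleK//=.
    by move=> -[] /q_inj -> //; rewrite inE.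
  by case.
have taE : ta (pickle (q j, r)) = t0 + clamp (ratr r) by rewrite /ta pickleK.
rewrite thE taE; set s := t0 + _ in rP *.
have Uj := CU _ Cj.
have -> : Y i t - Y j s = \sum_(k < n.+1) (H i t (tnth z k) - H j s (tnth z k))
    - n.+1%:R * (\int[mu]_x H i t x - \int[mu]_x H j s x).
  rewrite /Y !RintegralB//; do ?exact: intH.
  rewrite mulr_natl -[X in _ - _ *+ X]card_ord -sumr_const -!sumrB.
  by apply: eq_bigr => k _; ring.
apply: le_lt_trans (ler_normB _ _) _.
have h1 : `|\sum_(k < n.+1) (H i t (tnth z k) - H j s (tnth z k))| <= a / 4.
  apply: le_trans (ler_norm_sum _ _ _) _.
  apply: (@le_trans _ _ (\sum_(k < n.+1) (w (tnth z k) + L2 (tnth z k)) * eta)).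
    apply: ler_sum => k _; apply: le_trans (lip1 _ _ _ Ui Uj) _.
    rewrite mulrDl; apply: lerD; rewrite ler_wpM2l//; last exact: ltW.
    - exact/ltW.
    - exact/ltW/Gz.
  rewrite -mulr_suml -/W.
  apply: (@le_trans _ _ ((W + 1) * (a / 4 / (W + 1)))).
    apply: ler_pM => //; first exact: ltW.
      by rewrite lerDl.
    by rewrite /eta ge_min lexx orbT.
  by rewrite mulrC divfK// gt_eqF// ltr_wpDl.
have h2 : `|n.+1%:R * (\int[mu]_x H i t x - \int[mu]_x H j s x)| <= a / 4.
  rewrite normrM normr_nat mulrC -ler_pdivlMr//; apply: etaP => //.
  - by apply: le_trans (ltW GL1) _; rewrite /eta ge_min lexx.
  - by apply: le_trans (ltW rP) _; rewrite /eta ge_min lexx.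
by apply: le_lt_trans (lerD h1 h2) _; lra.
Qed.

End maximal_inequality.

(** * The law of the sample *)

Section sample_law.
Context d d' (Omega : measurableType d) (S : measurableType d') {R : realType}
  (P : probability Omega R) (mu : probability S R) (Z : nat -> {RV P >-> S}).

Definition sample n (omega : Omega) : n.-tuple S := [tuple Z i omega | i < n].

Lemma measurable_sample n : measurable_fun setT (sample n).
Proof.
apply/measurable_fun_tnthP => i.
have -> : (tnth (T:=S))^~ i \o sample n = Z i.
  by apply/funext => omega /=; rewrite tnth_mktuple.
exact: measurable_funPT.
Qed.

HB.instance Definition _ n :=
  isMeasurableFun.Build _ _ Omega (n.-tuple S) (sample n) (@measurable_sample n).

Definition tuple_box n (A : nat -> set S) : set (n.-tuple S) :=
  [set z | forall i : 'I_n, A i (tnth z i)].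

Arguments tuple_box : clear implicits.

Lemma measurable_tuple_box n A : (forall i, measurable (A i)) ->
  measurable (tuple_box n A).
Proof.
move=> mA.
have -> : tuple_box n A = \big[setI/setT]_(i < n) ((fun z => tnth z i) @^-1` A i).
  apply/seteqP; split => z; rewrite -bigcap_seq /= => zA i; first by move=> _; exact: zA.
  by apply: (zA i); rewrite /= mem_index_enum.
apply: bigsetI_measurable => i _; rewrite -[X in measurable X]setTI.
exact: measurable_tnth.
Qed.

Lemma product_power_box n (A : nat -> set S) : (forall i, measurable (A i)) ->
  product_power mu n (tuple_box n A) = (\prod_(i < n) mu (A i))%E.
Proof.
elim: n A => [|n IH] A mA.
  rewrite big_ord0 /=.
  have h : (\d_([tuple] : 0.-tuple S) (tuple_box 0 A) = 1 :> \bar R)%E.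
    by rewrite diracE mem_set// => -[].
  exact: h.
rewrite big_ord_recl -(IH (fun i => A i.+1))//=.
rewrite -product_measure1E//; last exact: measurable_tuple_box.
rewrite /distribution /pushforward; congr (_ _).
apply/seteqP; split => [[x z] xzA|[x z] [/= Ax zA]].
  split; first exact: (xzA ord0).
  by move=> i /=; have := xzA (lift ord0 i); rewrite tnth_cons.
by move=> i; case: (unliftP ord0 i) => [j|] ->//; rewrite tnth_cons; exact: zA.
Qed.

(** Boxes form a pi-system that generates the sigma-algebra of tuples; independence and the common
    law give the two measures the same product on each box. *)
Lemma sample_law (Z_iid : iid mu Z) n (A : set (n.-tuple S)) : measurable A ->
  P (sample n @^-1` A) = product_power mu n A.
Proof.
move=> mA; have [Zind Zlaw] := Z_iid.
pose B := [set X | exists2 A, (forall i, measurable (A i)) & X = tuple_box n A].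
apply: (@measure_unique _ _ _ B (fun=> setT) _ _ _ _
  (distribution P (sample n)) (product_power mu n)) => //.
- apply/seteqP; split.
    apply: smallest_sub; first exact: smallest_sigma_algebra.
    rewrite -bigcup_seq => X [i _] [Y mY <-]; apply: sub_sigma_algebra.
    exists (fun k : nat => if k == i then Y else setT).
      by move=> k; case: ifP.
    rewrite setTI; apply/seteqP; split => z /= zY; first by move=> k; case: ifP => // /eqP ki; rewrite (_ : k = i)//; exact: val_inj.
    by have := zY i; rewrite eqxx.
  apply: smallest_sub; first exact: sigma_algebra_measurable.
  by move=> _ [A' mA' ->]; exact: measurable_tuple_box.
- move=> _ _ [A1 mA1 ->] [A2 mA2 ->]; exists (fun i => A1 i `&` A2 i).
    by move=> i; exact: measurableI.
  apply/seteqP; split => [z [z1 z2] i|z z12]; first by split; [exact: z1|exact: z2].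
  by split=> i; have [] := z12 i.
- by move=> _; exists (fun=> setT) => //; apply/seteqP; split.
- by rewrite bigcup_const.
- move=> _ [A' mA' ->]; apply: etrans (esym (product_power_box n mA')).
  transitivity (P (\bigcap_(j in [set` iota 0 n]) Z j @^-1` A' j)).
    rewrite /distribution /= /pushforward; congr (P _); apply/seteqP; split => w /=.
      move=> wA j /=; rewrite mem_iota add0n => /= jn.
      by have := wA (Ordinal jn); rewrite tnth_mktuple.
    move=> wA i; rewrite tnth_mktuple; apply: wA => /=.
    by rewrite mem_iota add0n /=.
  rewrite Zind ?iota_uniq//.
  rewrite -[in LHS](subn0 n) -/(index_iota 0 n) big_mkord.
  by apply: eq_bigr => i _; exact: (Zlaw i).
- by move=> k; rewrite (le_lt_trans (probability_le1 _ _))// ltry.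
Qed.

End sample_law.

(** * Translation of Lebesgue integrals and comparison of increments *)

Section translation.
Context {R : realType}.
Local Notation leb := (@lebesgue_measure R).

Lemma measurable_shift (c : R) : measurable_fun setT (fun x : R => c + x).
Proof. exact: measurable_funD. Qed.

(** The pushforward under a translation has the right value on half-open intervals, which determine
    Lebesgue measure. *)
Lemma lebesgue_measure_shift (c : R) (A : set R) : measurable A ->
  lebesgue_measure A = lebesgue_measure ((fun x => c + x) @^-1` A).
Proof.
move=> mA.
have mc : measurable_fun setT ((fun x => c + x) : measurableTypeR R -> measurableTypeR R).
  exact: measurable_shift.
pose cf : {mfun measurableTypeR R >-> measurableTypeR R} := 
  HB.pack ((fun x => c + x) : measurableTypeR R -> measurableTypeR R)
    (isMeasurableFun.Build _ _ _ _ _ mc).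
have -> : lebesgue_measure ((fun x => c + x) @^-1` A) = pushforward leb cf A by [].
apply: lebesgue_measure_unique mA => _ [[a b] _ <-] /=.
rewrite /pushforward /=.
have -> : (fun x => c + x) @^-1` `]a, b]%classic = `]a - c, b - c]%classic.
  by apply/seteqP; split => x /=; rewrite !in_itv/= ltrBlDl lerBrDl.
rewrite !lebesgue_measure_itv /= !lte_fin ltrD2r.
by case: ifPn => // _; rewrite -!EFinB; congr (_%:E); ring.
Qed.

Lemma integral_shift (c a b : R) (f : R -> R) :
  measurable_fun setT f -> leb.-integrable `[c + a, c + b] (EFin \o f) ->
  leb.-integrable `[a, b] (EFin \o (fun u => f (c + u))) /\
  (\int[leb]_(x in `[(c + a)%R, (c + b)%R]) (f x)%:E =
   \int[leb]_(x in `[a, b]) (f (c + x))%:E)%E.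
Proof.
move=> mf intf.
have mc : measurable_fun setT ((fun x => c + x) : measurableTypeR R -> measurableTypeR R).
  exact: measurable_shift.
pose cf : {mfun measurableTypeR R >-> measurableTypeR R} := 
  HB.pack ((fun x => c + x) : measurableTypeR R -> measurableTypeR R)
    (isMeasurableFun.Build _ _ _ _ _ mc).
have preim : `[a, b]%classic = cf @^-1` `[c + a, c + b]%classic.
  by apply/seteqP; split => x /=; rewrite !in_itv/= !lerD2l.
have mD : measurable (`[c + a, c + b]%classic : set (measurableTypeR R)).
  exact: measurable_itv.
have mD' : measurable (`[a, b]%classic : set (measurableTypeR R)).
  exact: measurable_itv.
have shiftE (A : set (measurableTypeR R)) : measurable A -> leb A = pushforward leb cf A.
  by move=> mA; exact: lebesgue_measure_shift.
have mfE : measurable_fun setT (EFin \o f) by exact/measurable_EFinP.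
have mfc : measurable_fun setT (fun u => f (c + u)) by exact: measurableT_comp.
have posneg (g : R -> \bar R) : measurable_fun setT g -> (forall x, 0 <= g x)%E ->
    (\int[leb]_(x in `[(c + a)%R, (c + b)%R]) g x = \int[leb]_(x in `[a, b]) g (c + x)%R)%E.
  move=> mg g0.
  rewrite (@eq_measure_integral _ _ _ _ (pushforward leb cf)); last first.
    by move=> A mA _; exact: shiftE.
  rewrite (ge0_integral_pushforward mc)//.
  - by rewrite -preim.
  - exact: measurable_funTS.
have eqf : (\int[leb]_(x in `[(c + a)%R, (c + b)%R]) (f x)%:E =
   \int[leb]_(x in `[a, b]) (f (c + x))%:E)%E.
  rewrite integralE [RHS]integralE; congr (_ - _)%E.
    transitivity (\int[leb]_(x in `[(c + a)%R, (c + b)%R]) (EFin \o f)^\+ x)%E; first by [].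
    have h := posneg _ (measurable_funepos mfE) (funepos_ge0 _).
    by rewrite h; apply: eq_integral => x _; rewrite unlock.
  transitivity (\int[leb]_(x in `[(c + a)%R, (c + b)%R]) (EFin \o f)^\- x)%E; first by [].
  have h := posneg _ (measurable_funeneg mfE) (funeneg_ge0 _).
  by rewrite h; apply: eq_integral => x _; rewrite unlock.
split=> //; move/integrableP : intf => [_ ioo].
apply/integrableP; split; first exact/measurable_EFinP/measurable_funTS.
rewrite -(posneg (fun x => `|(f x)%:E|)%E)//.
exact: measurableT_comp.
Qed.

(** Condition (viii) only equates the integral of the density with a real number. In the extended
    reals a difference is finite only if both terms are, so the positive and negative parts have
    finite integrals. *)
Lemma integral_fin_integrable d (T : measurableType d) (mu : {measure set T -> \bar R})
    (D : set T) (f : T -> R) (r : R) : measurable D -> measurable_fun D f ->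
  (\int[mu]_(x in D) (f x)%:E = r%:E)%E -> mu.-integrable D (EFin \o f).
Proof.
move=> mD mf fr.
have mfE : measurable_fun D (EFin \o f) by exact/measurable_EFinP.
apply/integrableP; split=> //.
have -> : (fun x => `|(EFin \o f) x|)%E = ((EFin \o f)^\+ \+ (EFin \o f)^\-)%E.
  exact: fune_abse.
rewrite ge0_integralD//; [|exact: measurable_funepos|exact: measurable_funeneg].
move: fr; rewrite integralE.
set u := integral _ _ _; set v := integral _ _ _ => uv.
have : (u - v)%E \is a fin_num by rewrite uv.
by rewrite fin_numB => /andP[uf vf]; rewrite ltey_eq fin_numD uf vf.
Qed.

(** The two increments are integrals of densities around the different points [p1] and [p2];
    translation brings both to one interval around 0, where the densities are compared pointwise. *)
Lemma increment_dist (h1 h2 m1 m2 : R -> R) (p1 p2 L delta : R) :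
  measurable_fun setT m1 -> measurable_fun setT m2 ->
  (forall s t, s < t ->
    (h1 t - h1 s)%:E = (\int[leb]_(u in `[s, t]) (m1 u)%:E)%E) ->
  (forall s t, s < t ->
    (h2 t - h2 s)%:E = (\int[leb]_(u in `[s, t]) (m2 u)%:E)%E) ->
  (forall x, - delta <= x <= delta -> `|m1 (p1 + x) - m2 (p2 + x)| <= L) ->
  forall x, - delta <= x <= delta ->
  `|(h1 (p1 + x) - h1 p1) - (h2 (p2 + x) - h2 p2)| <= L * `|x|.
Proof.
move=> mm1 mm2 h1m h2m mL.
have key a b : - delta <= a -> b <= delta -> a < b ->
    `|(h1 (p1 + b) - h1 (p1 + a)) - (h2 (p2 + b) - h2 (p2 + a))| <= L * (b - a).
  move=> da bd ab.
  have ab1 : p1 + a < p1 + b by rewrite ltrD2l.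
  have ab2 : p2 + a < p2 + b by rewrite ltrD2l.
  have i1 : leb.-integrable `[p1 + a, p1 + b] (EFin \o m1).
    apply: integral_fin_integrable (esym (h1m _ _ ab1)) => //.
    exact: measurable_funTS.
  have i2 : leb.-integrable `[p2 + a, p2 + b] (EFin \o m2).
    apply: integral_fin_integrable (esym (h2m _ _ ab2)) => //.
    exact: measurable_funTS.
  have [i1' e1] := integral_shift mm1 i1.
  have [i2' e2] := integral_shift mm2 i2.
  have -> : h1 (p1 + b) - h1 (p1 + a) = \int[leb]_(u in `[a, b]) m1 (p1 + u).
    by rewrite /Rintegral -e1 -h1m.
  have -> : h2 (p2 + b) - h2 (p2 + a) = \int[leb]_(u in `[a, b]) m2 (p2 + u).
    by rewrite /Rintegral -e2 -h2m.
  rewrite -RintegralB//.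
  have iB : leb.-integrable `[a, b] (EFin \o (fun u => m1 (p1 + u) - m2 (p2 + u))).
    exact: (integrableB _ i1' i2').
  apply: le_trans (le_normr_Rintegral _ iB) _ => //.
  have -> : L * (b - a) = \int[leb]_(u in `[a, b]) L.
    rewrite Rintegral_cst//= lebesgue_measure_itv/= lte_fin ab -EFinB//.
  apply: le_Rintegral => //.
  - exact: (integrable_abse iB).
  - apply/integrableP; split; first exact: measurable_cst.
    rewrite integral_cst//= lebesgue_measure_itv/= lte_fin ab -EFinB -EFinM ltry//.
  - move=> u /=; rewrite in_itv/= => /andP[au ub]; apply: mL.
    by rewrite (le_trans da au) (le_trans ub bd).
move=> x /andP[dx xd].
have [x0|x0|->] := ltgtP x 0.
- have d0 : 0 <= delta by lra.
  have := key x 0 dx d0 x0; rewrite !addr0 sub0r => h; rewrite (ltr0_norm x0) -normrN.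
  by apply: le_trans h; rewrite le_eqVlt; apply/orP; left; apply/eqP; congr (`|_|); ring.
- have d0 : - delta <= 0 by lra.
  by have := key 0 x d0 xd x0; rewrite !addr0 subr0 (gtr0_norm x0).
- by rewrite !addr0 !subrr !(subr0, normr0) mulr0.
Qed.

End translation.

(** * The Euclidean norm *)

Section euclidean_facts.
Context {R : realType}.

Lemma enorm_ge0 k (x : 'rV[R]_k) : 0 <= enorm x.
Proof. exact: sqrtr_ge0. Qed.

Lemma enorm_row_mx k (x : 'rV[R]_k) (a : R) :
  enorm (row_mx x (const_mx a : 'rV[R]_1)) <= enorm x + `|a|.
Proof.
rewrite /enorm big_split_ord/= big_ord1.
under eq_bigr do rewrite row_mxEl.
rewrite row_mxEr mxE; set s := \sum_(i < k) _.
have s0 : 0 <= s by apply: sumr_ge0 => i _; exact: sqr_ge0.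
rewrite -(@ler_pXn2r _ 2)// ?nnegrE ?addr_ge0 ?sqrtr_ge0//.
rewrite sqr_sqrtr ?addr_ge0 ?sqr_ge0// sqrrD sqr_sqrtr// real_normK ?num_real//.
by rewrite lerD2r lerDl mulrn_wge0// mulr_ge0 ?sqrtr_ge0.
Qed.

Lemma measurable_coord k (i : 'I_k) :
  measurable_fun setT (fun x : borelRV R k => (x : 'rV[R]_k) 0 i).
Proof.
apply: (measurability _ (RGenOInfty.measurableE R)) => _ [_ [a ->] <-].
rewrite setTI; apply: sub_sigma_algebra.
have /continuousP/(_ `]a, +oo[%classic) : continuous (fun x : 'rV[R]_k => x 0 i).
  exact: coord_continuous.
by apply; exact: interval_open.
Qed.

Lemma measurable_enorm_dist k (c : 'rV[R]_k) :
  measurable_fun setT (fun x : borelRV R k => enorm ((x : 'rV[R]_k) - c)).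
Proof.
have msqrt : measurable_fun setT (@Num.sqrt R).
  by apply: continuous_measurable_fun; exact: sqrt_continuous.
apply: (measurableT_comp msqrt); apply: measurable_sum => i.
apply: measurable_funX.
have -> : (fun x : borelRV R k => ((x : 'rV[R]_k) - c) 0 i) =
    (fun x : borelRV R k => (x : 'rV[R]_k) 0 i - c 0 i).
  by apply/funext => x; rewrite !mxE.
by apply: measurable_funB => //; exact: measurable_coord.
Qed.

Lemma coord_le_norm k (z : 'rV[R]_k) i j : `|z i j| <= `|z|.
Proof.
rewrite [leRHS]/Num.norm /= mx_normE.
exact: (le_bigmax _ (fun ij => `|z ij.1 ij.2|%:nng) (i, j)).
Qed.

(** Compactness bounds the set of distances, so that its real supremum is an upper bound. *)
Lemma enorm_le_ediam k (A : set 'rV[R]_k) x y : compact A -> A x -> A y ->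
  enorm (x - y) <= ediam A.
Proof.
move=> /compact_bounded[M [_ AM]] Ax Ay.
have {}AM z : A z -> `|z| <= M + 1 by apply: AM; rewrite ltrDl.
have M0 : 0 <= M + 1 by exact: le_trans (normr_ge0 _) (AM x Ax).
apply: ub_le_sup; last by exists x, y.
exists (Num.sqrt (\sum_(i < k) (2 * (M + 1)) ^+ 2)) => _ [x' [y' [Ax' Ay' ->]]].
rewrite /enorm ler_sqrt; last by apply: sumr_ge0 => i _; exact: sqr_ge0.
apply: ler_sum => i _.
have coord (z : 'rV[R]_k) : A z -> `|z 0 i| <= M + 1.
  move=> Az; apply: le_trans (AM z Az).
  exact: (coord_le_norm z 0 i).
rewrite -[leLHS]real_normK ?num_real// ler_pXn2r ?nnegrE ?mulr_ge0//.
rewrite !mxE; apply: le_trans (ler_normB _ _) _.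
by rewrite mulr_natl mulr2n; apply: lerD; exact: coord.
Qed.

End euclidean_facts.

(** * Square integrable functions *)

Section square_integrable.
Context d (S : measurableType d) {R : realType} (mu : probability S R).

Lemma Lfun2_measurable (f : S -> R) : f \in Lfun mu 2%:E -> measurable_fun setT f.
Proof. by rewrite inE => /andP[/[!inE]]. Qed.

Lemma integrable_sqr (f : S -> R) : measurable_fun setT f ->
  mu.-integrable setT (fun x => (f x ^+ 2)%:E) -> mu.-integrable setT (EFin \o f).
Proof.
move=> mf if2.
apply: (integrable_bound (g := fun x => 1 + f x ^+ 2)) => //.
  have := integrableD measurableT (finite_measure_integrable_cst mu 1 measurableT) if2.
  by [].
move=> x; rewrite -[f x ^+ 2]real_normK ?num_real//.
by have := sqr_ge0 (`|f x| - 1); nra.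
Qed.

Lemma Lfun2_sqr (f : S -> R) : f \in Lfun mu 2%:E ->
  mu.-integrable setT (fun x => (f x ^+ 2)%:E).
Proof. exact: Lfun2_integrable_sqr. Qed.

Lemma Lfun2_integrable (f : S -> R) : f \in Lfun mu 2%:E ->
  mu.-integrable setT (EFin \o f).
Proof. by move=> f2; apply: integrable_sqr (Lfun2_sqr f2); exact: Lfun2_measurable. Qed.

Lemma Lnorm2_le (f : S -> R) (c : R) : measurable_fun setT f -> 0 <= c ->
  (Lnorm mu 2%:E (fun x => (f x)%:E) <= c%:E)%E ->
  (\int[mu]_x (f x ^+ 2)%:E <= (c ^+ 2)%:E)%E /\
  mu.-integrable setT (fun x => (f x ^+ 2)%:E).
Proof.
move=> mf c0 fc.
have h : (\int[mu]_x (f x ^+ 2)%:E <= (c ^+ 2)%:E)%E.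
  rewrite -Lnorm2_sq -powR_mulrn// -poweR_EFin.
  by apply: gt0_ler_poweR fc; rewrite ?in_itv/= ?leey ?andbT ?Lnorm_ge0 ?lee_fin.
split=> //; apply/integrableP; split.
  by apply/measurable_EFinP; exact: measurable_funX.
under eq_integral do rewrite gee0_abs ?lee_fin ?sqr_ge0//.
by apply: le_lt_trans h _; rewrite ltry.
Qed.

(** Integrate [f <= f^2 / (2 c) + c / 2]. *)
Lemma Rintegral_le_sqr (f : S -> R) (c : R) : measurable_fun setT f -> 0 < c ->
  mu.-integrable setT (fun x => (f x ^+ 2)%:E) ->
  (\int[mu]_x (f x ^+ 2)%:E <= (c ^+ 2)%:E)%E -> \int[mu]_x f x <= c.
Proof.
move=> mf c0 if2 fc.
have if1 := integrable_sqr mf if2.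
have icst : mu.-integrable setT (EFin \o cst (c / 2)) := finite_measure_integrable_cst mu (c / 2) measurableT.
have ifc : mu.-integrable setT (fun x => ((2 * c)^-1 * f x ^+ 2)%:E).
  exact: (integrableZl measurableT _ if2).
apply: (@le_trans _ _ (\int[mu]_x ((2 * c)^-1 * f x ^+ 2 + c / 2))).
  apply: le_Rintegral => //; first exact: (integrableD measurableT ifc icst).
  move=> x _; rewrite -subr_ge0.
  have -> : (2 * c)^-1 * f x ^+ 2 + c / 2 - f x = (f x - c) ^+ 2 / (2 * c).
    by field; rewrite gt_eqF.
  by rewrite divr_ge0 ?sqr_ge0// mulr_ge0// ltW.
have -> : \int[mu]_x ((2 * c)^-1 * f x ^+ 2 + c / 2) =
    (2 * c)^-1 * \int[mu]_x (f x ^+ 2) + c / 2.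
  rewrite RintegralD//; congr (_ + _); first by rewrite RintegralZl.
  by rewrite /Rintegral integral_prob_cst.
have : \int[mu]_x (f x ^+ 2) <= c ^+ 2.
  by rewrite -lee_fin fineK// integrable_fin_num.
move=> h.
apply: (@le_trans _ _ ((2 * c)^-1 * c ^+ 2 + c / 2)).
  by rewrite lerD2r ler_wpM2l// invr_ge0 mulr_ge0// ltW.
by rewrite le_eqVlt; apply/orP; left; apply/eqP; field; rewrite gt_eqF.
Qed.

End square_integrable.

(** * Expectations under the common law *)

Section identical_law.
Context d d' (Omega : measurableType d) (S : measurableType d') {R : realType}
  (P : probability Omega R) (mu : probability S R) (X : {RV P >-> S}).
Hypothesis law : forall A, measurable A -> distribution P X A = mu A.

Lemma expectation_law (f : S -> R) : mu.-integrable setT (EFin \o f) ->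
  'E_P[f \o X]%E = (\int[mu]_x (f x)%:E)%E.
Proof.
move=> fi; rewrite unlock.
have mf : measurable_fun setT (EFin \o f) := measurable_int _ fi.
have ge0 (g : S -> \bar R) : measurable_fun setT g -> (forall x, 0 <= g x)%E ->
    (\int[mu]_x g x = \int[P]_w g (X w))%E.
  move=> mg g0; rewrite -(ge0_integral_distribution X)//.
  by apply: eq_measure_integral => A mA _; exact/esym/law.
have fXi : P.-integrable setT ((EFin \o f) \o X).
  apply/integrableP; split; first exact: measurableT_comp.
  rewrite /comp -(ge0 (fun x => `|(f x)%:E|)%E)//; last exact: measurableT_comp.
  by move/integrableP : fi => [].
rewrite -(integral_distribution mf fXi).
by apply: eq_measure_integral => A mA _; exact: law.
Qed.

End identical_law.

(** * Arithmetic of the rate *)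

(** Everything rests on [sqrt N = rho^(2 - beta)]. With [u = delta * rho >= 1], [sqrt N * delta^2 =
    u^(2 - beta) * delta^beta] and [sqrt N * delta^beta = rho^(2 - 2 beta) * u^beta], with
    [2 - beta >= 1] and nonnegative exponents in the second product. *)
Lemma rate_powers (R : realType) (N beta delta D : R) :
  1 <= N -> 0 < beta -> beta <= 1 -> 0 < delta -> delta <= D ->
  let rho := N `^ (1 / (4 - 2 * beta)) in
  1 <= delta * rho ->
  [/\ 1 <= rho, delta * rho * delta `^ beta <= Num.sqrt N * delta ^+ 2,
      1 <= Num.sqrt N * delta `^ beta & delta * rho <= D * Num.sqrt N].
Proof.
move=> N1 b0 b1 d0 dD rho u1.
have N0 : 0 <= N by lra.
have e0 : 0 <= 1 / (4 - 2 * beta) by rewrite divr_ge0//; lra.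
have rho1 : 1 <= rho by rewrite -(powRr0 N) /rho ler_powR.
have rho0 : 0 < rho by lra.
have sE : Num.sqrt N = rho `^ (2 - beta).
  rewrite -powR12_sqrt// /rho -powRrM; congr (_ `^ _).
  by field; rewrite gt_eqF//; lra.
have u0 : 0 < delta * rho by lra.
split=> //.
- have -> : Num.sqrt N * delta ^+ 2 = (delta * rho) `^ (2 - beta) * delta `^ beta.
    rewrite sE powRM ?ltW// -powR_mulrn ?ltW//.
    have -> : delta `^ 2 = delta `^ (2 - beta) * delta `^ beta.
      rewrite -powRD; last by rewrite (gt_eqF d0) implybT.
      by rewrite subrK.
    ring.
  by rewrite ler_wpM2r ?powR_ge0// le1r_powR//; lra.
- have -> : Num.sqrt N * delta `^ beta = rho `^ (2 - 2 * beta) * (delta * rho) `^ beta.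
    rewrite sE powRM ?ltW//.
    have -> : rho `^ (2 - beta) = rho `^ (2 - 2 * beta) * rho `^ beta.
      rewrite -powRD; last by rewrite (gt_eqF rho0) implybT.
      by congr (_ `^ _); ring.
    ring.
  rewrite -[X in X <= _]mulr1 ler_pM//.
  + by rewrite -[X in X <= _](powRr0 rho) ler_powR//; lra.
  + by rewrite -[X in X <= _](powRr0 (delta * rho)) ler_powR//; lra.
- by apply: ler_pM; rewrite ?(ltW d0) ?(ltW rho0)// sE le1r_powR//; lra.
Qed.

Lemma invr_min3 (R : realType) (x y z : R) : 0 < x -> 0 < y -> 0 < z ->
  (Num.min (Num.min x y) z)^-1 <= x^-1 + y^-1 + z^-1.
Proof.
move=> x0 y0 z0; have x'0 : 0 < x^-1 by rewrite invr_gt0.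
have y'0 : 0 < y^-1 by rewrite invr_gt0.
have z'0 : 0 < z^-1 by rewrite invr_gt0.
by case: (leP x y) => _; [case: (leP x z)|case: (leP y z)] => _; lra.
Qed.

(** Here [s] stands for [sqrt N], [v] for [sqrt(delta * rho)], [q] for [delta^beta], [M] for
    [Mbar_1] and [E] for the mean of [L2]. The ratio [q / (s * delta^2)] is at most [v^(-2)]; the
    factor [v] in [A] degrades this to [v^(-1)] in the first summand and supplies [v^(-1)] in the
    part of the third that is divided by [A]. *)
Lemma shell_rate (R : realType)
    (s v q delta D DB M l2 lG E M1 kappa delta1 A cX : R) :
  0 < s -> 1 <= v -> 0 < q -> 0 < delta -> 0 < D -> 0 < M -> 0 <= l2 ->
  0 <= lG -> 0 <= E -> 0 < M1 -> 0 < kappa -> 0 < delta1 ->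
  v ^+ 2 * q <= s * delta ^+ 2 -> 1 <= s * q -> v ^+ 2 <= D * s -> q <= DB ->
  A = 2 * (M * v * q) ->
  cX = s ^+ 2 * Num.min (Num.min delta1 (A / 2))
    (M1 * delta ^+ 2 / (16 * kappa * q)) ->
  s * ((M * q + A * l2) / (s ^+ 2 * (M1 * delta ^+ 2 / 32))
    + M * q / (s ^+ 2 * (M1 * delta ^+ 2 / (16 * (E + 1)))) + 2 * (M * q + lG) / cX)
  <= (32 * M * (1 + 2 * l2) / M1 + 16 * M * (E + 1) / M1
      + 2 * (M * DB + lG) * (D / delta1 + M^-1 + 16 * kappa / M1)) / v.
Proof.
move=> s0 v1 q0 d0 D0 M0 l20 lG0 E0 M10 k0 d10 F1 F2 F3 qDB AE cXE.
have v0 : 0 < v by lra.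
have E10 : 0 < E + 1 by lra.
have A0 : 0 < A by rewrite AE !mulr_gt0.
have iv : 0 < v^-1 by rewrite invr_gt0.
have iv2 : (v ^+ 2)^-1 <= v^-1.
  by rewrite lef_pV2 ?posrE ?exprn_gt0// expr2 ler_peMl// ltW.
have e1 : q / (s * delta ^+ 2) <= (v ^+ 2)^-1.
  rewrite ler_pdivrMr ?mulr_gt0 ?exprn_gt0// mulrC ler_pdivlMr ?exprn_gt0//.
  by rewrite mulrC.
have e2 : (s * q)^-1 <= 1 by rewrite invf_le1 ?mulr_gt0.
have e3 : s^-1 <= D / v ^+ 2.
  by rewrite ler_pdivlMr ?exprn_gt0// mulrC ler_pdivrMr.
have T1 : s * ((M * q + A * l2) / (s ^+ 2 * (M1 * delta ^+ 2 / 32)))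
    <= 32 * M * (1 + 2 * l2) / M1 / v.
  apply: (@le_trans _ _ (32 * M * (1 + 2 * l2) / M1 * v * (q / (s * delta ^+ 2)))).
    have -> : s * ((M * q + A * l2) / (s ^+ 2 * (M1 * delta ^+ 2 / 32))) =
        32 * M / M1 * (1 + 2 * l2 * v) * (q / (s * delta ^+ 2)).
      by rewrite AE; field; rewrite !gt_eqF.
    rewrite ler_wpM2r ?divr_ge0 ?mulr_ge0 ?exprn_ge0 ?(ltW q0) ?(ltW s0) ?(ltW d0)//.
    have -> : 32 * M * (1 + 2 * l2) / M1 * v = 32 * M / M1 * (v + 2 * l2 * v) by ring.
    by rewrite ler_wpM2l ?lerD2r// divr_ge0 ?mulr_ge0// ltW.
  have -> : 32 * M * (1 + 2 * l2) / M1 / v = 32 * M * (1 + 2 * l2) / M1 * v * (v ^+ 2)^-1.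
    by field; rewrite !gt_eqF.
  by rewrite ler_wpM2l// !mulr_ge0 ?invr_ge0 ?addr_ge0 ?mulr_ge0// ltW.
have T2 : s * (M * q / (s ^+ 2 * (M1 * delta ^+ 2 / (16 * (E + 1)))))
    <= 16 * M * (E + 1) / M1 / v.
  have -> : s * (M * q / (s ^+ 2 * (M1 * delta ^+ 2 / (16 * (E + 1))))) =
      16 * M * (E + 1) / M1 * (q / (s * delta ^+ 2)) by field; rewrite !gt_eqF.
  by rewrite ler_wpM2l ?(le_trans e1)// divr_ge0 ?mulr_ge0// ltW.
have T3 : s * (2 * (M * q + lG) / cX)
    <= 2 * (M * DB + lG) * (D / delta1 + M^-1 + 16 * kappa / M1) / v.
  have cXV : s / cX <= (D / delta1 + M^-1 + 16 * kappa / M1) / v.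
    apply: (@le_trans _ _ (s^-1 * (delta1^-1 + (A / 2)^-1
        + (M1 * delta ^+ 2 / (16 * kappa * q))^-1))).
      rewrite cXE invfM mulrA expr2 invfM mulrA divff ?gt_eqF// mul1r.
      rewrite ler_pM2l ?invr_gt0//; apply: invr_min3 => //.
        by rewrite divr_gt0.
      by rewrite divr_gt0 ?mulr_gt0 ?exprn_gt0.
    rewrite mulrDr mulrDr.
    rewrite (mulrDl (D / delta1 + M^-1)) (mulrDl (D / delta1)).
    apply: lerD; [apply: lerD|].
    - apply: (@le_trans _ _ (D / v ^+ 2 * delta1^-1)).
        by rewrite ler_wpM2r// invr_ge0 ltW.
      rewrite mulrAC ler_wpM2l// divr_ge0// ltW//.
    - have -> : s^-1 * (A / 2)^-1 = M^-1 / v * (s * q)^-1.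
        by rewrite AE; field; rewrite !gt_eqF.
      by rewrite ler_piMr// divr_ge0 ?invr_ge0// ltW.
    - have -> : s^-1 * (M1 * delta ^+ 2 / (16 * kappa * q))^-1 =
        16 * kappa / M1 * (q / (s * delta ^+ 2)) by field; rewrite !gt_eqF.
      by rewrite ler_wpM2l ?(le_trans e1)// divr_ge0 ?mulr_ge0// ltW.
  have -> : s * (2 * (M * q + lG) / cX) = 2 * (M * q + lG) * (s / cX) by ring.
  rewrite -[leRHS]mulrA; apply: ler_pM => //.
  - by rewrite mulr_ge0// addr_ge0// mulr_ge0// ltW.
  - rewrite divr_ge0 ?(ltW s0)// cXE mulr_ge0 ?sqr_ge0// !le_min (ltW d10)/=.
    by rewrite !divr_ge0 ?mulr_ge0 ?sqr_ge0// ?ltW.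
  - by rewrite ler_pM2l// lerD2r ler_pM2l.
rewrite (mulrDl (32 * M * (1 + 2 * l2) / M1 + 16 * M * (E + 1) / M1)).
rewrite (mulrDl (32 * M * (1 + 2 * l2) / M1)) mulrDr mulrDr.
by apply: lerD => //; apply: lerD.
Qed.

(** * Population risk and the deterministic inequality on a good sample *)

Section rate.
Context (R : realType) (m d : nat) (dO : measure_display)
  (Omega : measurableType dO) (P : probability Omega R)
  (PZ : probability (borelRV R d) R) (Z : nat -> {RV P >-> borelRV R d}).
Hypothesis Z_iid : iid PZ Z.
Variable Theta : set 'rV[R]_m.
Hypothesis Theta_compact : compact Theta.
Variables (G : 'rV[R]_m -> borelRV R d -> R)
  (H : 'rV[R]_m -> R -> borelRV R d -> R).
Hypothesis G_integrable : forall theta, Theta theta ->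
  PZ.-integrable setT (EFin \o G theta).
Variable xiG : borelRV R d -> R.
Hypotheses (xiG_gt0 : forall z, 0 < xiG z) (xiG_L2 : xiG \in Lfun PZ 2%:E)
  (xiG_bound : forall theta z, Theta theta -> `|G theta z| <= xiG z).
Hypotheses (H_measurable : forall theta t, Theta theta ->
     measurable_fun setT (H theta t))
  (H_integrable : forall theta, Theta theta ->
     PZ.-integrable setT (EFin \o H theta (psi_bar Z G theta))).
Variables L1 L2 : borelRV R d -> R.
Hypotheses (L1_ge0 : forall z, 0 <= L1 z) (L2_ge0 : forall z, 0 <= L2 z)
  (L1_L2 : L1 \in Lfun PZ 2%:E) (L2_L2 : L2 \in Lfun PZ 2%:E).
Hypothesis H_lipschitz : forall theta vartheta t s z,
  Theta theta -> Theta vartheta ->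
  `|H theta t z - H vartheta s z| ^+ 2
    <= L1 z ^+ 2 * `|G theta z - G vartheta z| ^+ 2 + L2 z ^+ 2 * `|t - s| ^+ 2.
Variable thetas : 'rV[R]_m.
Hypothesis thetas_in : Theta thetas.
Variables (delta1 : R) (K : R) (mTR : 'rV[R]_m -> R -> R).
Hypotheses (delta1_gt0 : 0 < delta1) (K_ge0 : 0 <= K).
Hypothesis mTR_measurable :
  measurable_fun ((Theta `*` [set: R]) : set (borelRV R m * R))
    (fun p : borelRV R m * R => mTR p.1 p.2).
Hypothesis mTR_lipschitz : forall theta x, Theta theta ->
  - delta1 <= x <= delta1 ->
  `|mTR theta (psi_bar Z G theta + x) - mTR thetas (psi_bar Z G thetas + x)|
    <= K * enorm (row_mx (theta - thetas)
         (const_mx (psi_bar Z G theta - psi_bar Z G thetas) : 'rV[R]_1)).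
Hypothesis mTR_integral : forall theta s t, Theta theta -> s < t ->
  ('E_P[H theta t \o Z 0%N] - 'E_P[H theta s \o Z 0%N]
    = \int[lebesgue_measure]_(u in `[s, t]) (mTR theta u)%:E)%E.

Local Notation mean f := (\int[PZ]_z f z).
Local Notation t0 := (psi_bar Z G thetas).
Local Notation pp := (product_power PZ).

(* The lower bound 1 lets one weighted cover serve [G] and [H] alike. *)
Definition weight (z : borelRV R d) : R := Num.max (L1 z) 1.
Local Notation w := weight.

Lemma weight_ge1 z : 1 <= w z.
Proof. by rewrite le_max lexx orbT. Qed.

Lemma weight_gt0 z : 0 < w z.
Proof. exact: lt_le_trans ltr01 (weight_ge1 z). Qed.

Lemma measurable_weight : measurable_fun setT w.
Proof. by apply: measurable_maxr => //; exact: Lfun2_measurable L1_L2. Qed.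

Lemma measurable_G theta : Theta theta -> measurable_fun setT (G theta).
Proof. by move=> /G_integrable/measurable_int/measurable_EFinP. Qed.

Lemma H_lip theta vartheta t s z : Theta theta -> Theta vartheta ->
  (H theta t z - H vartheta s z) ^+ 2 <=
  w z ^+ 2 * (G theta z - G vartheta z) ^+ 2 + L2 z ^+ 2 * (t - s) ^+ 2.
Proof.
move=> th vth; have := H_lipschitz t s z th vth; rewrite !real_normK ?num_real//.
move/le_trans; apply; rewrite lerD2r ler_wpM2r ?sqr_ge0//.
rewrite ler_pXn2r ?nnegrE ?(ltW (weight_gt0 z))//.
by rewrite le_max lexx.
Qed.

Lemma H_lip2 theta t s z : Theta theta ->
  `|H theta t z - H theta s z| <= L2 z * `|t - s|.
Proof.
move=> th; rewrite -(@ler_pXn2r _ 2)// ?nnegrE ?mulr_ge0// exprMn.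
by have := H_lipschitz t s z th th; rewrite subrr normr0 expr0n/= mulr0 add0r.
Qed.

Lemma L2_integrable : PZ.-integrable setT (EFin \o L2).
Proof. exact: Lfun2_integrable. Qed.

(** Integrability at [psi_bar] extends to every [t] by the Lipschitz condition in [t]. *)
Lemma integrable_H theta t : Theta theta -> PZ.-integrable setT (EFin \o H theta t).
Proof.
move=> th; set s := psi_bar Z G theta.
apply: (integrable_bound (g := fun z => `|H theta s z| + `|t - s| * L2 z)).
- exact: H_measurable.
- have i1 := integrable_abse (H_integrable th).
  have i2 := integrableZl measurableT `|t - s| L2_integrable.
  exact: (integrableD measurableT i1 i2).
- move=> z; rewrite -lerBlDl; apply: le_trans (lerB_dist _ _) _.
  by rewrite mulrC; exact: H_lip2.
Qed.

Definition risk theta t : R := mean (H theta t).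

Lemma psi_barE theta : Theta theta -> psi_bar Z G theta = mean (G theta).
Proof.
move=> th; rewrite /psi_bar (expectation_law (mu := PZ))//; last exact: G_integrable.
by move=> A mA; have [_] := Z_iid; apply.
Qed.

Lemma expectation_H theta t : Theta theta ->
  ('E_P[H theta t \o Z 0%N] = (risk theta t)%:E)%E.
Proof.
move=> th; rewrite (expectation_law (mu := PZ)); [|by have [_] := Z_iid; apply|exact: integrable_H].
by rewrite /risk /Rintegral fineK// integrable_fin_num//; exact: integrable_H.
Qed.

Lemma psi_HE theta : Theta theta -> psi_H Z G H theta = risk theta (psi_bar Z G theta).
Proof. by move=> th; rewrite /psi_H expectation_H. Qed.

Lemma risk_lip theta t s : Theta theta ->
  `|risk theta t - risk theta s| <= mean L2 * `|t - s|.
Proof.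
move=> th; have i1 := integrable_H t th; have i2 := integrable_H s th.
rewrite /risk -RintegralB//.
have iB : PZ.-integrable setT (EFin \o (fun z => H theta t z - H theta s z)).
  exact: (integrableB measurableT i1 i2).
apply: le_trans (le_normr_Rintegral measurableT iB) _.
rewrite -RintegralZr//; last exact: L2_integrable.
apply: le_Rintegral => //.
- exact: (integrable_abse iB).
- have -> : EFin \o (fun x => L2 x * `|t - s|) = (fun x => `|t - s|%:E * (EFin \o L2) x)%E.
    by apply/funext => z /=; rewrite -EFinM mulrC.
  exact: (integrableZl measurableT _ L2_integrable).
- by move=> z _; exact: H_lip2.
Qed.

(** A section of a jointly measurable map; [Theta] is closed, hence Borel. *)
Lemma measurable_mTR theta : Theta theta -> measurable_fun setT (mTR theta).
Proof.
move=> th.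
have mTheta : measurable (Theta : set (borelRV R m)).
  have -> : Theta = ~` ~` Theta by rewrite setCK.
  apply: measurableC; apply: sub_sigma_algebra => /=.
  by rewrite openC; exact: compact_closed Theta_compact.
apply: (@measurable_comp _ _ _ _ _ _ ((Theta `*` [set: R]) : set (borelRV R m * R))
  (fun p : borelRV R m * R => mTR p.1 p.2) _ (fun u : R => (theta, u))) => //.
- exact: measurableX.
- by move=> _ [u _ <-].
- exact: pair1_measurable.
Qed.

Lemma risk_increment theta x : Theta theta -> - delta1 <= x <= delta1 ->
  `|(risk theta (psi_bar Z G theta + x) - risk theta (psi_bar Z G theta))
    - (risk thetas (t0 + x) - risk thetas t0)|
  <= K * (enorm (theta - thetas) + `|psi_bar Z G theta - t0|) * `|x|.
Proof.
move=> th xd.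
have riskE vartheta : Theta vartheta -> forall s t, s < t ->
    (risk vartheta t - risk vartheta s)%:E =
    (\int[lebesgue_measure]_(u in `[s, t]) (mTR vartheta u)%:E)%E.
  by move=> vth s t st; rewrite -mTR_integral// !expectation_H.
apply: (increment_dist (measurable_mTR th) (measurable_mTR thetas_in)
  (riskE _ th) (riskE _ thetas_in) _ xd) => y yd.
apply: le_trans (mTR_lipschitz th yd) _.
by rewrite ler_wpM2l// enorm_row_mx.
Qed.

(** Let [X] and [Xs] be the errors of the inner mean at [theta] and [thetas]. Replacing both
    objectives by risks costs [2 * cH]. The risk of [thetas] is then moved from [t0 + Xs] to
    [t0 + X], at the price of the increment [X - Xs] bounded through [cG]. Now both risks are
    shifted by the same [X], and the comparison of densities leaves a product of [cX] with the
    distance of the parameters. *)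
Lemma good_sample n (z : n.+1.-tuple (borelRV R d)) theta (A B cH cG cX : R) :
  let N : R := n.+1%:R in
  let emp vartheta := N^-1 * \sum_(k < n.+1) G vartheta (tnth z k) in
  let obj vartheta := N^-1 * \sum_(k < n.+1) H vartheta (emp vartheta) (tnth z k) in
  let devH vartheta t := \sum_(k < n.+1)
    ((H vartheta t (tnth z k) - H thetas t0 (tnth z k))
     - mean (fun x => H vartheta t x - H thetas t0 x)) in
  let devG vartheta := \sum_(k < n.+1) (G vartheta (tnth z k) - mean (G vartheta)) in
  Theta theta -> obj theta <= obj thetas ->
  (forall t, `|t - t0| <= A -> `|devH theta t| <= cH /\ `|devH thetas t| <= cH) ->
  `|devG theta| <= cX -> `|devG thetas| <= cX -> `|devG theta - devG thetas| <= cG ->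
  cX <= N * delta1 -> cX + N * B <= N * A -> 0 <= B ->
  `|psi_bar Z G theta - t0| <= B ->
  psi_H Z G H theta - psi_H Z G H thetas <=
    (2 * cH + mean L2 * cG + K * (enorm (theta - thetas) + B) * cX) / N.
Proof.
move=> N emp obj devH devG th obj_le dH dX dXs dG cXd cXA B0 psiB.
have N0 : 0 < N by [].
have devHE vartheta t : Theta vartheta -> devH vartheta t =
    \sum_(k < n.+1) H vartheta t (tnth z k) - \sum_(k < n.+1) H thetas t0 (tnth z k)
    - N * (risk vartheta t - risk thetas t0).
  move=> vth; rewrite /devH sumrB sumr_const card_ord -mulr_natl sumrB.
  by rewrite RintegralB//; exact: integrable_H.
have devGE vartheta : Theta vartheta -> devG vartheta = N * (emp vartheta - psi_bar Z G vartheta).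
  move=> vth; rewrite /devG sumrB sumr_const card_ord -mulr_natl mulrBr.
  by rewrite psi_barE// /emp mulrA divff ?gt_eqF// mul1r.
pose X := emp theta - psi_bar Z G theta; pose Xs := emp thetas - t0.
have XN c vartheta : Theta vartheta -> `|devG vartheta| <= c -> `|emp vartheta - psi_bar Z G vartheta| <= c / N.
  by move=> vth; rewrite devGE// normrM (gtr0_norm N0) ler_pdivlMr// mulrC.
have Xc : `|X| <= cX / N by exact: XN.
have Xsc : `|Xs| <= cX / N by exact: XN.
have XXs : `|X - Xs| <= cG / N.
  by move: dG; rewrite !devGE// -mulrBr normrM (gtr0_norm N0) ler_pdivlMr// mulrC.
have cXN : cX / N <= delta1 by rewrite ler_pdivrMr// mulrC.
have cXNA : cX / N + B <= A.
  by rewrite -(ler_pM2l N0) mulrDr mulrCA divff ?gt_eqF// mulr1.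
have tA : `|emp theta - t0| <= A.
  have -> : emp theta - t0 = X + (psi_bar Z G theta - t0) by rewrite /X; ring.
  by apply: le_trans (ler_normD _ _) (le_trans (lerD Xc psiB) cXNA).
have sA : `|emp thetas - t0| <= A.
  by apply: le_trans Xsc (le_trans _ cXNA); rewrite lerDl.
have [dHt _] := dH _ tA; have [_ dHs] := dH _ sA.
have XB : - delta1 <= X <= delta1 by rewrite -ler_norml; exact: le_trans Xc cXN.
have inc := risk_increment th XB.
have incB : K * (enorm (theta - thetas) + `|psi_bar Z G theta - t0|) * `|X|
    <= K * (enorm (theta - thetas) + B) * (cX / N).
  apply: ler_pM => //; first by rewrite !mulr_ge0// addr_ge0// enorm_ge0.
  by rewrite ler_wpM2l// lerD2l.
have lip : `|risk thetas (emp thetas) - risk thetas (t0 + X)| <= mean L2 * (cG / N).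
  apply: le_trans (risk_lip _ _ thetas_in) _.
  have -> : emp thetas - (t0 + X) = - (X - Xs) by rewrite /X /Xs; ring.
  by rewrite normrN ler_wpM2l//; apply: Rintegral_ge0 => *; exact: L2_ge0.
rewrite !psi_HE//.
have tE : psi_bar Z G theta + X = emp theta by rewrite /X; ring.
rewrite tE in inc.
have hY vartheta t : Theta vartheta -> `|devH vartheta t| <= cH ->
   `|N^-1 * \sum_(k < n.+1) H vartheta t (tnth z k)
     - N^-1 * \sum_(k < n.+1) H thetas t0 (tnth z k)
     - (risk vartheta t - risk thetas t0)| <= cH / N.
  move=> vth; rewrite devHE// => h.
  have -> : forall a b c, N^-1 * a - N^-1 * b - c = N^-1 * (a - b - N * c).
    by move=> a b c; rewrite !mulrBr (mulrA _ N) mulVf ?gt_eqF// mul1r.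
  by rewrite normrM gtr0_norm ?invr_gt0// mulrC ler_pM2r ?invr_gt0.
have := hY _ _ th dHt; have := hY _ _ thetas_in dHs.
move: obj_le; rewrite /obj.
set o1 := N^-1 * _; set o2 := N^-1 * _; set o3 := N^-1 * _.
move=> o12 y2 y1.
have -> : (2 * cH + mean L2 * cG + K * (enorm (theta - thetas) + B) * cX) / N =
    2 * (cH / N) + mean L2 * (cG / N) + K * (enorm (theta - thetas) + B) * (cX / N).
  by rewrite !mulrDl !mulrA.
have := le_trans inc incB; move: lip y1 y2; rewrite !ler_norml.
move: (cH / N) (mean L2 * (cG / N)) (K * _ * _) => q1 q2 q3.
move=> /andP[l1 l2] /andP[a1 a2] /andP[b1 b2] /andP[c1 c2].
lra.
Qed.

(** * Exceptional sets in a neighbourhood of the minimizer *)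

Hypothesis G_separable : forall delta : R, 0 < delta ->
  exists (C : set 'rV[R]_m) (N : forall n, set (n.-tuple (borelRV R d))),
    [/\ countable C, C `<=` eball_in Theta thetas delta,
        forall n, (0 < n)%N -> (pp n).-negligible (N n) &
        forall theta n (z : n.-tuple (borelRV R d)),
          eball_in Theta thetas delta theta -> (0 < n)%N -> ~ N n z ->
          ereal_inf
            [set ('E_P[(fun w => `|G theta (Z 0%N w) - G vartheta (Z 0%N w)|)%R]
                  + (\big[Num.max/0]_(j < n)
                       `|G theta (tnth z j) - G vartheta (tnth z j)|)%R%:E)%E
            | vartheta in C] = 0%E].
Variables (beta Mbar_1 Mbar1 : R) (xi_ : R -> borelRV R d -> R).
Hypotheses (beta_gt0 : 0 < beta) (beta_le1 : beta <= 1).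
Hypotheses (Mbar_1_gt0 : 0 < Mbar_1) (Mbar1_gt0 : 0 < Mbar1).
Hypothesis xi_envelope : forall delta : R, 0 < delta <= ediam Theta ->
  positive_envelope (local_class_G Theta G thetas delta) (xi_ delta).
Hypothesis xi_bound : forall delta : R, 0 < delta <= ediam Theta ->
  (Lnorm PZ 2%:E (fun z => (Num.max (L1 z) 1 * xi_ delta z)%:E)
    <= (Mbar_1 * delta `^ beta)%:E)%E.
Hypothesis entropy_bound : forall delta : R, 0 < delta <= ediam Theta ->
  (entropy_integral (local_class_G Theta G thetas delta) (xi_ delta) 8^-1
   <= Mbar1%:E)%E.

Lemma eball_center delta : 0 < delta -> eball_in Theta thetas delta thetas.
Proof.
move=> d0; split=> //; rewrite subrr /enorm big1 ?sqrtr0 ?(ltW d0)// => i _.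
by rewrite mxE expr0n.
Qed.

Lemma measurable_xi delta : 0 < delta <= ediam Theta -> measurable_fun setT (xi_ delta).
Proof. by move=> /xi_envelope[]. Qed.

Lemma xi_gt0 delta z : 0 < delta <= ediam Theta -> 0 < xi_ delta z.
Proof. by move=> /xi_envelope[_ + _]; apply. Qed.

Lemma G_dist_xi delta theta z : 0 < delta <= ediam Theta ->
  eball_in Theta thetas delta theta -> `|G theta z - G thetas z| <= xi_ delta z.
Proof.
by move=> /xi_envelope[_ _ h] th; apply: (h (fun z => G theta z - G thetas z)); exists theta.
Qed.

Lemma weighted_xi delta : 0 < delta <= ediam Theta ->
  (\int[PZ]_z ((w z * xi_ delta z) ^+ 2)%:E <= ((Mbar_1 * delta `^ beta) ^+ 2)%:E)%E /\
  PZ.-integrable setT (fun z => ((w z * xi_ delta z) ^+ 2)%:E).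
Proof.
move=> dD; apply: Lnorm2_le.
- by apply: measurable_funM; [exact: measurable_weight|exact: measurable_xi].
- by rewrite mulr_ge0 ?(ltW Mbar_1_gt0)// powR_ge0.
- exact: xi_bound.
Qed.

(** The weight is at least 1, so the bound on the weighted envelope also controls the means of
    [G]. *)
Lemma psi_bar_dist delta theta : 0 < delta <= ediam Theta ->
  eball_in Theta thetas delta theta ->
  `|psi_bar Z G theta - t0| <= Mbar_1 * delta `^ beta.
Proof.
move=> dD [th thd]; have d0 : 0 < delta by case/andP: dD.
have i1 := G_integrable th; have i2 := G_integrable thetas_in.
rewrite !psi_barE// -RintegralB//.
have iB : PZ.-integrable setT (EFin \o (fun z => G theta z - G thetas z)).
  exact: (integrableB measurableT i1 i2).
apply: le_trans (le_normr_Rintegral measurableT iB) _.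
have mwx : measurable_fun setT (fun z => w z * xi_ delta z).
  by apply: measurable_funM; [exact: measurable_weight|exact: measurable_xi].
have [xb xi2] := weighted_xi dD.
apply: (@le_trans _ _ (mean (fun z => w z * xi_ delta z))).
  apply: le_Rintegral => //.
  - exact: (integrable_abse iB).
  - exact: integrable_sqr.
  - move=> z _; apply: le_trans (G_dist_xi z dD _) _ => //.
    by rewrite ler_peMl ?weight_ge1// ltW// xi_gt0.
apply: Rintegral_le_sqr => //.
by rewrite mulr_gt0// powR_gt0.
Qed.

(** The separability condition in the form that [class_tail] consumes: the negligible set is
    enlarged to a measurable null set, and an infimum 0 of sums of two nonnegative terms gives a
    point where both are small. *)
Lemma local_approx delta n : 0 < delta -> exists2 C : set 'rV[R]_m,
  countable C /\ C `<=` eball_in Theta thetas delta &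
  exists E : set (n.+1.-tuple (borelRV R d)), [/\ measurable E, pp n.+1 E = 0%E &
  forall z, ~ E z -> forall i eta, eball_in Theta thetas delta i -> 0 < eta ->
    exists2 j, C j & mean (fun x => `|G i x - G j x|) < eta /\
      forall k, `|G i (tnth z k) - G j (tnth z k)| < eta].
Proof.
move=> d0; have [C [N [cC CU negl inf0]]] := G_separable d0.
exists C => //; have [E [mE E0 NE]] := negl n.+1 isT.
exists E; split=> // z nEz i eta Ui eta0.
have nNz : ~ N n.+1 z by move=> /NE.
have : (ereal_inf
            [set ('E_P[(fun w => `|G i (Z 0%N w) - G vartheta (Z 0%N w)|)%R]
                  + (\big[Num.max/0]_(j < n.+1)
                       `|G i (tnth z j) - G vartheta (tnth z j)|)%R%:E)%E
            | vartheta in C] < eta%:E)%E.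
  by rewrite (inf0 i n.+1 z Ui isT nNz) lte_fin.
move=> /ereal_inf_lt[_ [j Cj <-]].
have [Tj _] := CU _ Cj; have [Ti _] := Ui.
have iB : PZ.-integrable setT (EFin \o (fun x => `|G i x - G j x|)).
  exact: (integrable_abse (integrableB measurableT (G_integrable Ti) (G_integrable Tj))).
have -> : ('E_P[(fun w => `|G i (Z 0%N w) - G j (Z 0%N w)|)%R] =
    (mean (fun x => `|G i x - G j x|))%:E)%E.
  rewrite (expectation_law (X := Z 0%N) (mu := PZ) _ iB); last by have [_] := Z_iid; apply.
  by rewrite /Rintegral fineK// integrable_fin_num.
rewrite -EFinD lte_fin => lt_eta; exists j => //.
have mean0 : 0 <= mean (fun x => `|G i x - G j x|) by exact: Rintegral_ge0.
have max0 : 0 <= \big[Num.max/0]_(j0 < n.+1) `|G i (tnth z j0) - G j (tnth z j0)|.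
  exact: bigmax_ge_id.
split; first by apply: le_lt_trans lt_eta; rewrite lerDl.
move=> k; apply: le_lt_trans lt_eta; apply: (@le_trans _ _
  (\big[Num.max/0]_(j0 < n.+1) `|G i (tnth z j0) - G j (tnth z j0)|)).
  exact: (le_bigmax _ (fun k => `|G i (tnth z k) - G j (tnth z k)|)).
by rewrite lerDr.
Qed.

Definition entropy_const : R := 144 * (2 * Mbar1 + 1).

(** Stated for a general [H'] since it serves three classes: [H], [G] without dependence on [t], and
    a family containing [G] uncentred. The factor [a >= 1] rescales the weight and keeps it at least
    1. *)
Lemma local_tail delta n (H' : 'rV[R]_m -> R -> borelRV R d -> R)
    (L2' : borelRV R d -> R) (t0' a A c l : R) :
  0 < delta <= ediam Theta -> 1 <= a -> 0 <= A -> 0 < c -> 0 <= l ->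
  (forall z, 0 <= L2' z) -> measurable_fun setT L2' ->
  PZ.-integrable setT (EFin \o L2') ->
  (\int[PZ]_z (L2' z ^+ 2)%:E <= (l ^+ 2)%:E)%E ->
  (forall theta t, Theta theta -> PZ.-integrable setT (EFin \o H' theta t)) ->
  (forall theta vartheta t s z, Theta theta -> Theta vartheta ->
    (H' theta t z - H' vartheta s z) ^+ 2 <=
    (a * w z) ^+ 2 * (G theta z - G vartheta z) ^+ 2 + L2' z ^+ 2 * (t - s) ^+ 2) ->
  exists E : set (n.+1.-tuple (borelRV R d)), [/\ measurable E,
    (pp n.+1 E <= (entropy_const * (Num.sqrt n.+1%:R
       * (a * (Mbar_1 * delta `^ beta) + A * l)) / c)%:E)%E &
    forall z, ~ E z -> forall theta t, eball_in Theta thetas delta theta ->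
      `|t - t0'| <= A ->
      `|\sum_(k < n.+1) ((H' theta t (tnth z k) - H' thetas t0' (tnth z k))
          - mean (fun x => H' theta t x - H' thetas t0' x))| <= c].
Proof.
move=> dD a1 A0 c0 l0 L20 mL2 iL2 L2l iH' lipH'.
have d0 : 0 < delta by case/andP: dD.
have a0 : 0 < a := lt_le_trans ltr01 a1.
have mb0 : 0 < Mbar_1 * delta `^ beta by rewrite mulr_gt0// powR_gt0.
have [C [cC CU] [E0 [mE0 E00 E0approx]]] := local_approx n d0.
pose V := a * (Mbar_1 * delta `^ beta) + A * l.
have V0 : 0 < V by rewrite ltr_wpDr ?mulr_ge0// mulr_gt0.
have aw1 z : 1 <= a * w z.
  by rewrite -[X in X <= _]mulr1 ler_pM ?weight_ge1.
have mxi := measurable_xi dD.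
have maw : measurable_fun setT (fun z => a * w z).
  by apply: measurable_funM => //; exact: measurable_weight.
have [wxb iwx2] := weighted_xi dD.
have bV : (\int[PZ]_z ((fun z0 => (a * w z0) ^+ 2 * xi_ delta z0 ^+ 2
    + A ^+ 2 * L2' z0 ^+ 2) z)%:E <= (V ^+ 2)%:E)%E.
  apply: (@le_trans _ _ (((a * (Mbar_1 * delta `^ beta)) ^+ 2)%:E + ((A * l) ^+ 2)%:E)%E); last first.
    by rewrite -EFinD lee_fin /V sqrrD lerD2r lerDl mulrn_wge0// !mulr_ge0 ?powR_ge0 ?(ltW a0) ?(ltW Mbar_1_gt0).
  have -> : (\int[PZ]_z ((a * w z) ^+ 2 * xi_ delta z ^+ 2 + A ^+ 2 * L2' z ^+ 2)%:E =
     (a ^+ 2)%:E * \int[PZ]_z ((w z * xi_ delta z) ^+ 2)%:E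
     + (A ^+ 2)%:E * \int[PZ]_z (L2' z ^+ 2)%:E)%E.
    rewrite -!ge0_integralZl//; do ?[by move=> z _; rewrite lee_fin sqr_ge0|by rewrite lee_fin sqr_ge0].
    - rewrite -ge0_integralD//.
      + by apply: eq_integral => z _; rewrite -!EFinM -EFinD; congr (_%:E); ring.
      + by move=> z _; rewrite -EFinM lee_fin mulr_ge0 ?sqr_ge0.
      + apply: emeasurable_funM => //; exact: measurable_int iwx2.
      + by move=> z _; rewrite -EFinM lee_fin mulr_ge0 ?sqr_ge0.
      + apply: emeasurable_funM => //; apply/measurable_EFinP; exact: measurable_funX.
    - by apply/measurable_EFinP; exact: measurable_funX.
    - exact: measurable_int iwx2.
  apply: leeD.
    rewrite (exprMn _ a) (EFinM (a ^+ 2)); apply: lee_wpmul2l => //.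
    by rewrite lee_fin sqr_ge0.
  rewrite (exprMn _ A) (EFinM (A ^+ 2)); apply: lee_wpmul2l => //.
  by rewrite lee_fin sqr_ge0.
have iwxi : PZ.-integrable setT (fun z => (a * w z * xi_ delta z)%:E).
  have -> : (fun z => (a * w z * xi_ delta z)%:E) = (fun z => a%:E * (w z * xi_ delta z)%:E)%E.
    by apply/funext => z; rewrite -EFinM mulrA.
  apply: integrableZl => //; apply: integrable_sqr => //.
  by apply: measurable_funM => //; exact: measurable_weight.
have entr : (entropy_integral [set (fun z : borelRV R d => (G i z - G thetas z)%R)
   | i in eball_in Theta thetas delta] (xi_ delta) 8^-1 <= Mbar1%:E)%E.
  exact: entropy_bound.
have mGU i : eball_in Theta thetas delta i -> measurable_fun setT (G i).
  by move=> [Ti _]; exact: measurable_G.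
have iHU i t : eball_in Theta thetas delta i -> PZ.-integrable setT (EFin \o H' i t).
  by move=> [Ti _]; exact: iH'.
have lipU i j t s z : eball_in Theta thetas delta i -> eball_in Theta thetas delta j ->
  (H' i t z - H' j s z) ^+ 2 <=
    (a * w z) ^+ 2 * (G i z - G j z) ^+ 2 + L2' z ^+ 2 * (t - s) ^+ 2.
  by move=> [Ti _] [Tj _]; exact: lipH'.
have aw0 z : 0 < a * w z := lt_le_trans ltr01 (aw1 z).
have [E [mE PE nE]] := class_tail t0' (eball_center d0) mGU iHU aw0 maw mL2 mxi
  (fun z => xi_gt0 z dD) (fun i z Ui => G_dist_xi z dD Ui) lipU entr A0
  (ltW Mbar1_gt0) V0 bV aw1 L20 iL2 iwxi n cC CU c0.
exists (E0 `|` E); split; first exact: measurableU.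
  apply: le_trans (measureU2 _ mE0 mE) _; rewrite [X in (X + _)%E]E00 add0e.
  exact: PE.
move=> z /not_orP[nE0z nEz] theta t Uth tA.
by apply: (nE z (E0approx z nE0z) nEz).
Qed.

Let l2 : R := Num.sqrt (mean (fun z => L2 z ^+ 2)).
Let lG : R := Num.sqrt (mean (fun z => xiG z ^+ 2)).

Let sqrt_mean_sqr (f : borelRV R d -> R) : f \in Lfun PZ 2%:E ->
  (\int[PZ]_z (f z ^+ 2)%:E)%E = (Num.sqrt (mean (fun z => f z ^+ 2)) ^+ 2)%:E.
Proof.
move=> f2; rewrite sqr_sqrtr; last by apply: Rintegral_ge0 => *; exact: sqr_ge0.
by rewrite /Rintegral fineK// integrable_fin_num//; exact: Lfun2_sqr.
Qed.

Let devH n (z : n.+1.-tuple (borelRV R d)) theta t :=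
  \sum_(k < n.+1) ((H theta t (tnth z k) - H thetas t0 (tnth z k))
     - mean (fun x => H theta t x - H thetas t0 x)).

Let devG n (z : n.+1.-tuple (borelRV R d)) theta :=
  \sum_(k < n.+1) (G theta (tnth z k) - mean (G theta)).

Lemma shell_event delta n (A cH cG cX : R) :
  0 < delta <= ediam Theta -> 0 <= A -> 0 < cH -> 0 < cG -> 0 < cX ->
  let q := Mbar_1 * delta `^ beta in
  exists E : set (n.+1.-tuple (borelRV R d)), [/\ measurable E,
    (pp n.+1 E <= (entropy_const * Num.sqrt n.+1%:R *
       ((q + A * l2) / cH + q / cG + 2 * (q + lG) / cX))%:E)%E &
    forall z, ~ E z -> forall theta, eball_in Theta thetas delta theta ->
      [/\ forall t, `|t - t0| <= A -> `|devH z theta t| <= cH,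
          `|devG z theta - devG z thetas| <= cG & `|devG z theta| <= cX]].
Proof.
move=> dD A0 cH0 cG0 cX0 q.
have d0 : 0 < delta by case/andP: dD.
have lipH1 theta vartheta t s z : Theta theta -> Theta vartheta ->
    (H theta t z - H vartheta s z) ^+ 2 <=
    (1 * w z) ^+ 2 * (G theta z - G vartheta z) ^+ 2 + L2 z ^+ 2 * (t - s) ^+ 2.
  by move=> th vth; rewrite mul1r; exact: H_lip.
have L2l : (\int[PZ]_z (L2 z ^+ 2)%:E <= (l2 ^+ 2)%:E)%E by rewrite sqrt_mean_sqr.
have [EH [mEH PEH nEH]] := local_tail n t0 dD (lexx 1) A0 cH0 (sqrtr_ge0 _) L2_ge0
  (Lfun2_measurable L2_L2) L2_integrable L2l (fun th t Uth => integrable_H t Uth) lipH1.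
have i0 : PZ.-integrable setT (EFin \o (fun=> 0 : R)) by exact: integrable0.
have z2 : (\int[PZ]_z (((fun=> 0 : R) z) ^+ 2)%:E <= (0 ^+ 2)%:E)%E.
  by rewrite integral0_eq// => z _; rewrite expr0n.
have lipG1 theta vartheta (t s : R) z : Theta theta -> Theta vartheta ->
    (G theta z - G vartheta z) ^+ 2 <=
    (1 * w z) ^+ 2 * (G theta z - G vartheta z) ^+ 2
    + ((fun=> 0 : R) z) ^+ 2 * (t - s) ^+ 2.
  move=> _ _; rewrite expr0n mul0r addr0 mul1r ler_peMl ?sqr_ge0//.
  by rewrite exprn_ege1// weight_ge1.
(* [G] counts as an [H'] constant in [t]: the Lipschitz factor in [t] is 0 and so is the radius. *)
have [EG [mEG PEG nEG]] := local_tail (H' := fun th _ => G th) n 0 dD (lexx 1) (lexx 0)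
  cG0 (lexx 0) (fun=> lexx 0) (measurable_cst (0 : R)) i0 z2 (fun th _ Uth => G_integrable Uth) lipG1.
(* At [t = 1] this is [G theta]: the maximal inequality for increments then
   also covers the uncentred class. *)
pose HX theta (t : R) z := G theta z - (1 - t) * G thetas z.
have iHX theta t : Theta theta -> PZ.-integrable setT (EFin \o HX theta t).
  move=> th; have -> : EFin \o HX theta t =
      ((EFin \o G theta) \- (fun z => (1 - t)%:E * (EFin \o G thetas) z))%E.
    by apply/funext => z.
  apply: integrableB => //; first exact: G_integrable.
  by apply: integrableZl => //; exact: G_integrable.
have lipX theta vartheta (t s : R) z : Theta theta -> Theta vartheta ->
    (HX theta t z - HX vartheta s z) ^+ 2 <=
    (2 * w z) ^+ 2 * (G theta z - G vartheta z) ^+ 2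
    + (2 * xiG z) ^+ 2 * (t - s) ^+ 2.
  move=> _ _; have -> : HX theta t z - HX vartheta s z =
      (G theta z - G vartheta z) + (t - s) * G thetas z by rewrite /HX; ring.
  have w2 : 1 <= w z ^+ 2 by rewrite exprn_ege1// weight_ge1.
  have g2 : G thetas z ^+ 2 <= xiG z ^+ 2.
    rewrite -[leLHS]real_normK ?num_real// ler_pXn2r ?nnegrE ?(ltW (xiG_gt0 _))//.
    exact: xiG_bound.
  apply: (@le_trans _ _ (2 * (G theta z - G vartheta z) ^+ 2 + 2 * ((t - s) * G thetas z) ^+ 2)).
    rewrite -subr_ge0; have -> : forall a b : R, 2 * a ^+ 2 + 2 * b ^+ 2 - (a + b) ^+ 2 = (a - b) ^+ 2.
      by move=> a b; ring.
    exact: sqr_ge0.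
  rewrite !exprMn; apply: lerD.
    by rewrite ler_wpM2r ?sqr_ge0//; lra.
  rewrite (mulrC ((t - s) ^+ 2)) mulrA ler_wpM2r ?sqr_ge0//; have := sqr_ge0 (xiG z); lra.
have ixiG2 : PZ.-integrable setT (EFin \o (fun z => 2 * xiG z)).
  exact: (integrableZl measurableT 2 (Lfun2_integrable xiG_L2)).
have mxiG2 : measurable_fun setT (fun z => 2 * xiG z).
  by apply: measurable_funM => //; exact: Lfun2_measurable xiG_L2.
have xiGl : (\int[PZ]_z ((2 * xiG z) ^+ 2)%:E <= ((2 * lG) ^+ 2)%:E)%E.
  have -> : (\int[PZ]_z ((2 * xiG z) ^+ 2)%:E = (2 ^+ 2)%:E * \int[PZ]_z (xiG z ^+ 2)%:E)%E.
    rewrite -ge0_integralZl//.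
    - by apply: eq_integral => z _; rewrite -EFinM exprMn.
    - by apply/measurable_EFinP/measurable_funX; exact: Lfun2_measurable xiG_L2.
    - by move=> z _; rewrite lee_fin sqr_ge0.
  by rewrite sqrt_mean_sqr// -EFinM lee_fin exprMn.
have xiG20 z : 0 <= 2 * xiG z by rewrite mulr_ge0// ltW.
have lG20 : 0 <= 2 * lG by rewrite mulr_ge0// sqrtr_ge0.
have one2 : 1 <= 2 :> R by lra.
(* The base point is [t = 0] and the value [t = 1] is needed, hence radius 1; [a = 2] and the
   envelope [2 * xiG] absorb [(x + y)^2 <= 2 x^2 + 2 y^2]. *)
have [EX [mEX PEX nEX]] := local_tail n 0 dD one2 ler01 cX0 lG20 xiG20 mxiG2 ixiG2 xiGl iHX lipX.
exists (EH `|` EG `|` EX); split; first by do 2 apply: measurableU => //.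
  apply: le_trans (measureU2 _ (measurableU _ _ mEH mEG) mEX) _.
  apply: (@le_trans _ _ (pp n.+1 EH + pp n.+1 EG + pp n.+1 EX)%E).
    by apply: leeD2r; exact: measureU2.
  apply: le_trans (leeD (leeD PEH PEG) PEX) _; rewrite -!EFinD lee_fin.
  rewrite -/q -/l2 !mul1r mul0r addr0 le_eqVlt; apply/orP; left; apply/eqP.
  by field; rewrite !gt_eqF.
move=> z /not_orP[/not_orP[nH nG] nX] theta Uth; have [Tth _] := Uth.
split.
- by move=> t tA; exact: nEH.
- have := nEG z nG theta 0 Uth; rewrite subrr normr0 lexx => /(_ isT).
  rewrite /devG; congr (`|_| <= _); rewrite -sumrB; apply: eq_bigr => k _.
  by rewrite RintegralB//; [ring|exact: G_integrable|exact: G_integrable].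
- have := nEX z nX theta 1 Uth; rewrite subr0 normr1 lexx => /(_ isT).
  rewrite /devG; congr (`|_| <= _); apply: eq_bigr => k _.
  have HXE x : HX theta 1 x - HX thetas 0 x = G theta x by rewrite /HX; ring.
  by rewrite HXE; under eq_Rintegral do rewrite HXE.
Qed.

(** * Probability that a shell contains a minimizer *)

Variable M1 : R.
Hypothesis M1_gt0 : 0 < M1.
Hypothesis psi_H_growth : forall theta, Theta theta ->
  M1 * enorm (theta - thetas) ^+ 2
    <= psi_H Z G H theta - psi_H Z G H thetas.

Definition sample_objective n (z : n.-tuple (borelRV R d)) theta :=
  n%:R^-1 * \sum_(j < n) H theta (n%:R^-1 * \sum_(k < n) G theta (tnth z k)) (tnth z j).

(** Chosen so that [K * (delta + Mbar_1 * delta^beta) <= kappa * delta^beta] for all [delta] up to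
    the diameter; the [+ 1] keeps it positive when [K = 0]. *)
Let kappa : R := K * (ediam Theta `^ (1 - beta) + Mbar_1) + 1.
Let EL2 := mean L2.

(** Beyond [delta / 2] the growth condition gives more than [M1 * delta^2 / 4], while the thresholds
    hold each of the three error terms to [M1 * delta^2 / 16]. *)
Lemma shell_empty n (z : n.+1.-tuple (borelRV R d)) theta delta A cX :
  let N : R := n.+1%:R in let q := delta `^ beta in
  0 < delta <= ediam Theta -> 2 * (Mbar_1 * q) <= A ->
  0 < cX -> cX <= N * delta1 -> cX <= N * (A / 2) ->
  cX <= N * (M1 * delta ^+ 2 / (16 * kappa * q)) ->
  [/\ forall t, `|t - t0| <= A -> `|devH z theta t| <= N * (M1 * delta ^+ 2 / 32),
     forall t, `|t - t0| <= A -> `|devH z thetas t| <= N * (M1 * delta ^+ 2 / 32),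
     `|devG z theta - devG z thetas| <= N * (M1 * delta ^+ 2 / (16 * (EL2 + 1))),
     `|devG z theta| <= cX & `|devG z thetas| <= cX] ->
  Theta theta -> delta / 2 < enorm (theta - thetas) <= delta ->
  ~ (sample_objective z theta <= sample_objective z thetas).
Proof.
move=> N q dD qA cX0 cX1 cX2 cX3 [dH dHs dG dX dXs] th /andP[e1 e2] obj_le.
have N0 : 0 < N by [].
have d0 : 0 < delta by case/andP: dD.
have q0 : 0 < q by rewrite powR_gt0.
have Mq0 : 0 < Mbar_1 * q by rewrite mulr_gt0.
have EL20 : 0 <= EL2 by apply: Rintegral_ge0 => *; exact: L2_ge0.
have D0 : 0 <= ediam Theta `^ (1 - beta) by exact: powR_ge0.
have k0 : 0 < kappa by rewrite ltr_wpDl// mulr_ge0// addr_ge0// ltW.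
have AN : cX + N * (Mbar_1 * q) <= N * A.
  apply: (@le_trans _ _ (N * (A / 2) + N * (A / 2))); last first.
    by rewrite -mulrDr -splitr.
  by apply: lerD => //; rewrite ler_pM2l//; lra.
have := le_trans (psi_H_growth th) (@good_sample n z theta A (Mbar_1 * q)
  (N * (M1 * delta ^+ 2 / 32)) (N * (M1 * delta ^+ 2 / (16 * (EL2 + 1)))) cX th obj_le
  (fun t tA => conj (dH t tA) (dHs t tA)) dX dXs dG cX1 AN (ltW Mq0)
  (psi_bar_dist dD (conj th e2))).
have M1d : 0 < M1 * delta ^+ 2 by rewrite mulr_gt0 ?exprn_gt0.
set en := enorm _ in e1 e2 *.
have dq : delta <= ediam Theta `^ (1 - beta) * q.
  have [_ dD'] := andP dD.
  apply: (@le_trans _ _ (delta `^ (1 - beta) * q)).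
    rewrite /q -powRD; last by rewrite (gt_eqF d0) implybT.
    by rewrite subrK powRr1// ltW.
  rewrite ler_wpM2r ?(ltW q0)//; apply: ge0_ler_powR => //.
  - by rewrite subr_ge0.
  - by rewrite nnegrE ltW.
  - by rewrite nnegrE (le_trans (ltW d0)).
have Kq : K * (en + Mbar_1 * q) <= kappa * q.
  apply: (@le_trans _ _ (K * (ediam Theta `^ (1 - beta) * q + Mbar_1 * q))).
    by rewrite ler_wpM2l// lerD2r (le_trans e2).
  by rewrite -mulrDl mulrA ler_wpM2r ?(ltW q0)// /kappa lerDl.
have KcX : K * (en + Mbar_1 * q) * (cX / N) <= M1 * delta ^+ 2 / 16.
  have -> : M1 * delta ^+ 2 / 16 = kappa * q * (M1 * delta ^+ 2 / (16 * kappa * q)).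
    by field; rewrite !gt_eqF.
  apply: ler_pM => //.
  - by rewrite mulr_ge0// addr_ge0 ?enorm_ge0// ltW.
  - by rewrite divr_ge0// ltW.
  - by rewrite ler_pdivrMr// mulrC.
have EL2b : EL2 * (M1 * delta ^+ 2 / (16 * (EL2 + 1))) <= M1 * delta ^+ 2 / 16.
  have -> : EL2 * (M1 * delta ^+ 2 / (16 * (EL2 + 1))) =
      M1 * delta ^+ 2 / 16 * (EL2 / (EL2 + 1)) by field; rewrite gt_eqF// ltr_wpDl.
  rewrite ler_piMr ?divr_ge0 ?(ltW M1d)// ler_pdivrMr ?mul1r ?lerDl//.
  by rewrite ltr_wpDl.
have -> : (2 * (N * (M1 * delta ^+ 2 / 32)) + EL2 * (N * (M1 * delta ^+ 2 / (16 * (EL2 + 1))))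
    + K * (en + Mbar_1 * q) * cX) / N =
  M1 * delta ^+ 2 / 16 + EL2 * (M1 * delta ^+ 2 / (16 * (EL2 + 1)))
  + K * (en + Mbar_1 * q) * (cX / N).
  by field; rewrite !gt_eqF// ltr_wpDl.
have en2 : M1 * delta ^+ 2 / 4 < M1 * en ^+ 2.
  rewrite -mulrA ltr_pM2l//.
  have -> : delta ^+ 2 / 4 = (delta / 2) ^+ 2 by field.
  by rewrite ltr_pXn2r ?nnegrE ?enorm_ge0 ?divr_ge0// ltW.
move=> gs; have := lt_le_trans en2 (le_trans gs
  (lerD (lerD (lexx (M1 * delta ^+ 2 / 16)) EL2b) KcX)).
by move: (M1 * delta ^+ 2) M1d => x x0; lra.
Qed.

Lemma shell_prob : exists2 C : R, 0 <= C & forall n delta,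
  0 < delta <= ediam Theta -> 1 <= delta * n.+1%:R `^ (1 / (4 - 2 * beta)) ->
  exists E : set (n.+1.-tuple (borelRV R d)), [/\ measurable E,
    (pp n.+1 E <= (C / Num.sqrt (delta * n.+1%:R `^ (1 / (4 - 2 * beta))))%:E)%E &
    forall z, ~ E z -> forall theta, Theta theta ->
      delta / 2 < enorm (theta - thetas) <= delta ->
      ~ (sample_objective z theta <= sample_objective z thetas)].
Proof.
have EL20 : 0 <= EL2 by apply: Rintegral_ge0 => *; exact: L2_ge0.
have DB0 : 0 <= ediam Theta `^ beta by exact: powR_ge0.
have k0 : 0 < kappa.
  by rewrite ltr_wpDl// mulr_ge0// addr_ge0 ?powR_ge0// ltW.
have Kc0 : 0 <= entropy_const by rewrite mulr_ge0// addr_ge0// mulr_ge0// ltW.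
have l20 : 0 <= l2 by exact: sqrtr_ge0.
have lG0 : 0 <= lG by exact: sqrtr_ge0.
have [D0|D0] := leP (ediam Theta) 0.
  by exists 0 => // n delta /andP[d0 dD]; have := lt_le_trans d0 (le_trans dD D0); rewrite ltxx.
pose C0 := 32 * Mbar_1 * (1 + 2 * l2) / M1 + 16 * Mbar_1 * (EL2 + 1) / M1
  + 2 * (Mbar_1 * ediam Theta `^ beta + lG)
    * (ediam Theta / delta1 + Mbar_1^-1 + 16 * kappa / M1).
have C00 : 0 <= C0.
  have a1 : 0 <= 32 * Mbar_1 * (1 + 2 * l2) / M1.
    by rewrite divr_ge0 ?(ltW M1_gt0)// !mulr_ge0 ?(ltW Mbar_1_gt0)// addr_ge0// mulr_ge0.
  have a2 : 0 <= 16 * Mbar_1 * (EL2 + 1) / M1.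
    by rewrite divr_ge0 ?(ltW M1_gt0)// !mulr_ge0 ?(ltW Mbar_1_gt0)// addr_ge0.
  have a3 : 0 <= 2 * (Mbar_1 * ediam Theta `^ beta + lG).
    by rewrite mulr_ge0// addr_ge0// mulr_ge0// ltW.
  rewrite addr_ge0 ?addr_ge0// mulr_ge0// !addr_ge0//.
  - by rewrite divr_ge0// ltW.
  - by rewrite invr_ge0 ltW.
  - by rewrite divr_ge0 ?(ltW M1_gt0)// mulr_ge0// ltW.
exists (entropy_const * C0); first by rewrite mulr_ge0.
move=> n delta dD; set N : R := n.+1%:R; set rho := N `^ _ => u1.
have [d0 dD'] := andP dD.
have N1 : 1 <= N by rewrite /N ler1n.
have N0 : 0 < N by [].
have [rho1 F1 F2 F3] := rate_powers N1 beta_gt0 beta_le1 d0 dD' u1.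
pose v := Num.sqrt (delta * rho); pose s := Num.sqrt N; pose q := delta `^ beta.
have u0 : 0 <= delta * rho := le_trans ler01 u1.
have v2 : v ^+ 2 = delta * rho by rewrite /v sqr_sqrtr.
have v1 : 1 <= v by rewrite -[X in X <= _](sqrtr1 R) /v ler_sqrt.
have v0 : 0 < v := lt_le_trans ltr01 v1.
have s0 : 0 < s by rewrite sqrtr_gt0.
have s2 : s ^+ 2 = N by rewrite /s sqr_sqrtr// ltW.
have q0 : 0 < q by rewrite powR_gt0.
(* As [v >= 1], one half of [A] accommodates the distance of the means, at most [Mbar_1 * q]; the
   other half is left to the error of the inner mean. *)
pose A := 2 * (Mbar_1 * v * q).
have A0 : 0 < A by rewrite !mulr_gt0.
(* The largest threshold that meets the three requirements of [shell_empty]: the range [delta1] of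
   the Lipschitz condition, the half of [A], and the error term with [kappa]. *)
pose cX := s ^+ 2 * Num.min (Num.min delta1 (A / 2))
    (M1 * delta ^+ 2 / (16 * kappa * q)).
have M1d : 0 < M1 * delta ^+ 2 by rewrite mulr_gt0 ?exprn_gt0.
have cH0 : 0 < N * (M1 * delta ^+ 2 / 32) by rewrite mulr_gt0// divr_gt0.
have cG0 : 0 < N * (M1 * delta ^+ 2 / (16 * (EL2 + 1))).
  by rewrite mulr_gt0// divr_gt0// mulr_gt0// ltr_wpDl.
have cX0 : 0 < cX.
  rewrite /cX s2 mulr_gt0// !lt_min delta1_gt0/= !divr_gt0// !mulr_gt0//.
have [E [mE PE nE]] := shell_event n dD (ltW A0) cH0 cG0 cX0.
exists E; split => //.
  apply: le_trans PE _; rewrite lee_fin -/N -/s -/q -(mulrA entropy_const s) -(mulrA entropy_const C0) ler_wpM2l// -/v.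
  have qDB : q <= ediam Theta `^ beta.
    by apply: ge0_ler_powR; rewrite ?nnegrE ?(ltW beta_gt0) ?(ltW d0) ?(ltW D0).
  rewrite -s2.
  apply: (shell_rate (A := A) (cX := cX) s0 v1 q0 d0 D0 Mbar_1_gt0 l20 lG0 EL20
    M1_gt0 k0 delta1_gt0 _ F2 _ qDB (erefl _) (erefl _)).
  - by rewrite v2.
  - by rewrite v2.
move=> z nEz theta th e12.
have Uth : eball_in Theta thetas delta theta by split=> //; case/andP: e12.
have [dH dG dX] := nE z nEz theta Uth.
have [dHs _ dXs] := nE z nEz thetas (eball_center d0).
apply: (shell_empty (A := A) (cX := cX) dD _ cX0 _ _ _ (And5 dH dHs dG dX dXs)) => //.
- rewrite /A ler_pM2l// -mulrA ler_pM2l// ler_peMl// ltW//.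
- by rewrite /cX s2 ler_pM2l// !ge_min lexx.
- by rewrite /cX s2 ler_pM2l// !ge_min lexx orbT.
- by rewrite /cX s2 ler_pM2l// !ge_min lexx !orbT.
Qed.

End rate.

(** * Summation over the shells *)

Section peeling.
Context {R : realType}.

(** [2^(-1/2) <= 3/4], and the geometric series of ratio 3/4 has sum 4. *)
Lemma sum_sqrt_geometric (I : nat) : \sum_(i < I) (Num.sqrt (2 ^+ i))^-1 <= 4 :> R.
Proof.
have h (i : nat) : (Num.sqrt (2 ^+ i))^-1 <= (3 / 4) ^+ i :> R.
  have p0 : 0 <= (3 / 4 : R) ^+ i by rewrite exprn_ge0// divr_ge0.
  rewrite -(@ler_pXn2r _ 2)// ?nnegrE ?invr_ge0 ?sqrtr_ge0//.
  rewrite exprVn sqr_sqrtr ?exprn_ge0// -exprVn -exprM mulnC exprM.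
  by rewrite lerXn2r ?nnegrE ?exprn_ge0 ?divr_ge0// expr2; lra.
apply: (@le_trans _ _ (\sum_(i < I) (3 / 4 : R) ^+ i)).
  by apply: ler_sum => i _; exact: h.
have -> : \sum_(i < I) (3 / 4 : R) ^+ i = 4 * (1 - (3 / 4) ^+ I).
  elim: I => [|I IH]; first by rewrite big_ord0 expr0 subrr mulr0.
  by rewrite big_ord_recr/= IH exprSr; field.
have : 0 <= (3 / 4 : R) ^+ I by rewrite exprn_ge0// divr_ge0.
lra.
Qed.

Lemma dyadic_bracket (x e : R) (I : nat) : x < e -> e <= x * 2 ^+ I ->
  exists2 i : nat, (i < I)%N & x * 2 ^+ i < e <= x * 2 ^+ i.+1.
Proof.
move=> xe; elim: I => [|I IH].
  by rewrite expr0 mulr1 => /(lt_le_trans xe); rewrite ltxx.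
move=> eI; have [eI'|Ie] := leP e (x * 2 ^+ I).
  by have [i iI ie] := IH eI'; exists i => //; exact: ltnW.
by exists I => //; rewrite Ie.
Qed.

(** The shells double in radius from [eps / rho] on, and since [e] is bounded by [D] finitely many
    suffice. The bound on the shell of index [i] is of order [(eps * 2^i)^(-1/2)], which is
    summable. *)
Lemma peeling_bound dO d' (Omega : measurableType dO) (T : measurableType d')
    (P : probability Omega R) (Q : probability T R) (X : {mfun Omega >-> T})
    (e : Omega -> R) (D C rho eps : R) :
  (forall A, measurable A -> P (X @^-1` A) = Q A) ->
  measurable_fun setT e -> (forall w, e w <= D) -> 0 <= C -> 0 < rho -> 1 <= eps ->
  (forall delta, 0 < delta <= D -> 1 <= delta * rho -> exists E : set T,
    [/\ measurable E, (Q E <= (C / Num.sqrt (delta * rho))%:E)%E &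
      forall w, ~ E (X w) -> ~ (delta / 2 < e w <= delta)]) ->
  (P [set w | eps < rho * e w]%R <= (4 * C / Num.sqrt eps)%:E)%E.
Proof.
move=> law me eD C0 rho0 eps1 shell.
have eps0 : 0 < eps by lra.
pose x := eps / rho; have x0 : 0 < x by rewrite divr_gt0.
have x2 i : 0 < x * 2 ^+ i by rewrite mulr_gt0// exprn_gt0.
have /choice[E EP] : forall i : nat, exists E : set T, [/\ measurable E,
    (Q E <= (C / Num.sqrt eps / Num.sqrt (2 ^+ i))%:E)%E &
    forall w, ~ E (X w) -> ~ (x * 2 ^+ i < e w <= x * 2 ^+ i.+1)].
  move=> i; have [Dx|xD] := leP D (x * 2 ^+ i).
    exists set0; split => //.
      by rewrite measure0 lee_fin !divr_ge0// sqrtr_ge0.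
    move=> w _ /andP[xe _]; have := lt_le_trans xe (le_trans (eD w) Dx).
    by rewrite ltxx.
  (* Local bounds hold only up to [D], so the outer radius is cut there. It stays above [x * 2^i],
     and its half below, so it still covers the whole shell. *)
  pose delta := Num.min D (x * 2 ^+ i.+1).
  have xS : x * 2 ^+ i.+1 = 2 * (x * 2 ^+ i) by rewrite exprS; ring.
  have xd : x * 2 ^+ i <= delta.
    by rewrite le_min (ltW xD) xS ler_peMl ?ler1n// ltW.
  have d0 : 0 < delta := lt_le_trans (x2 i) xd.
  have dD : 0 < delta <= D by rewrite d0 ge_min lexx.
  have i1 : 1 <= 2 ^+ i :> R by rewrite exprn_ege1// ler1n.
  have epsd : eps * 2 ^+ i <= delta * rho.
    have -> : eps * 2 ^+ i = x * 2 ^+ i * rho by rewrite /x; field; rewrite gt_eqF.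
    by rewrite ler_wpM2r// ltW.
  have epsi : 1 <= eps * 2 ^+ i by rewrite -[X in X <= _]mulr1 ler_pM.
  have [E [mE QE nE]] := shell delta dD (le_trans epsi epsd).
  exists E; split => //.
    apply: le_trans QE _; rewrite lee_fin -mulrA -invfM -sqrtrM ?(ltW eps0)//.
    have p1 : 0 < eps * 2 ^+ i := lt_le_trans ltr01 epsi.
    have p2 : 0 < delta * rho := lt_le_trans p1 epsd.
    by rewrite ler_wpM2l// lef_pV2 ?posrE ?sqrtr_gt0// ler_sqrt// ltW.
  move=> w nEw /andP[e1 e2]; apply: (nE w nEw); rewrite le_min (eD w) e2/= andbT.
  apply: le_lt_trans e1; rewrite ler_pdivrMr// mulrC -xS.
  by rewrite /delta ge_min lexx orbT.
have [I DI] : exists I : nat, D <= x * 2 ^+ I.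
  pose I := (Num.truncn (D / x)).+1; exists I.
  rewrite mulrC -ler_pdivrMr//; apply: le_trans (ltW (truncnS_gt _)) _.
  by rewrite -natrX ler_nat ltnW// ltn_expl.
pose B := \big[setU/set0]_(i < I) E i.
have mB : measurable B by apply: bigsetU_measurable => i _; have [] := EP i.
have sub : [set w | eps < rho * e w] `<=` X @^-1` B.
  move=> w /= ew; have xe : x < e w by rewrite ltr_pdivrMr// mulrC.
  have [i iI ie] := dyadic_bracket xe (le_trans (eD w) DI).
  rewrite /B -bigcup_mkord; exists i => //.
  by apply: contrapT => nE; have [_ _ /(_ w nE)] := EP i.
have mEv : measurable [set w | eps < rho * e w].
  have mre : measurable_fun setT (fun w => rho * e w) by exact: measurable_funM.
  rewrite -[X in measurable X]setTI -preimage_itvoy.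
  exact: mre.
apply: (@le_trans _ _ (P (X @^-1` B))).
  apply: le_measure => //; rewrite inE//.
  by rewrite -[X in measurable X]setTI; exact: measurable_funPT.
rewrite law//; apply: le_trans (Boole_inequality _ _) _.
  by move=> i _; have [] := EP i.
apply: (@le_trans _ _ (\sum_(i < I) (C / Num.sqrt eps / Num.sqrt (2 ^+ i))%:E)%E).
  by apply: lee_sum => i _; have [] := EP i.
rewrite sumEFin lee_fin -mulr_sumr -mulrA mulrC.
by rewrite ler_wpM2r ?divr_ge0 ?sqrtr_ge0// sum_sqrt_geometric.
Qed.

End peeling.

(** * Conclusion: uniform tightness of the rescaled error *)

Theorem corollary3p8 (R : realType) (m d : nat) (hd : (0 < d)%N)
  (dO : measure_display) (Omega : measurableType dO)
  (P : probability Omega R)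
  (P_complete : measure_is_complete P) (P_atomless : atomless P)
  (PZ : probability (borelRV R d) R)
  (Z : nat -> {RV P >-> borelRV R d}) (Z_iid : iid PZ Z)
  (Theta : set 'rV[R]_m)
  (Theta_compact : compact Theta) (Theta_diam : 0 < ediam Theta)
  (G : 'rV[R]_m -> borelRV R d -> R)
  (H : 'rV[R]_m -> R -> borelRV R d -> R)
  (thetahat : nat -> {RV P >-> borelRV R m})
  (thetahat_in : forall n w, (0 < n)%N -> Theta (thetahat n w))
  (thetahat_min : forall n w, (0 < n)%N -> forall theta, Theta theta ->
     empirical_objective Z G H n (thetahat n w) w
       <= empirical_objective Z G H n theta w)
  (* (i) *)
  (G_integrable : forall theta, Theta theta ->
     PZ.-integrable setT (EFin \o G theta))
  (G_cvg : forall (theta_ : nat -> 'rV[R]_m) (theta : 'rV[R]_m),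
     (forall k, Theta (theta_ k)) -> Theta theta ->
     theta_ @ \oo --> theta ->
     cvg_in_probability PZ (fun k => G (theta_ k)) (G theta))
  (* (ii) *)
  (xiG : borelRV R d -> R)
  (xiG_gt0 : forall z, 0 < xiG z) (xiG_L2 : xiG \in Lfun PZ 2%:E)
  (xiG_bound : forall theta z, Theta theta -> `|G theta z| <= xiG z)
  (* (iii) *)
  (H_measurable : forall theta t, Theta theta ->
     measurable_fun setT (H theta t))
  (H_integrable : forall theta, Theta theta ->
     PZ.-integrable setT (EFin \o H theta (psi_bar Z G theta)))
  (* (iv) *)
  (L1 L2 : borelRV R d -> R)
  (L1_ge0 : forall z, 0 <= L1 z) (L2_ge0 : forall z, 0 <= L2 z)
  (L1_L2 : L1 \in Lfun PZ 2%:E) (L2_L2 : L2 \in Lfun PZ 2%:E)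
  (H_lipschitz : forall theta vartheta t s z, Theta theta -> Theta vartheta ->
     `|H theta t z - H vartheta s z| ^+ 2
       <= L1 z ^+ 2 * `|G theta z - G vartheta z| ^+ 2
          + L2 z ^+ 2 * `|t - s| ^+ 2)
  (* (v) *)
  (thetas : 'rV[R]_m) (thetas_in : Theta thetas)
  (thetas_min : forall theta, Theta theta ->
     psi_H Z G H thetas <= psi_H Z G H theta)
  (thetas_uniq : forall theta, Theta theta ->
     (forall vartheta, Theta vartheta ->
        psi_H Z G H theta <= psi_H Z G H vartheta) ->
     theta = thetas)
  (M1 : R) (M1_gt0 : 0 < M1)
  (psi_H_growth : forall theta, Theta theta ->
     M1 * enorm (theta - thetas) ^+ 2
       <= psi_H Z G H theta - psi_H Z G H thetas)
  (* (vi) *)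
  (G_separable : forall delta : R, 0 < delta ->
     exists (C : set 'rV[R]_m) (N : forall n, set (n.-tuple (borelRV R d))),
       [/\ countable C, C `<=` eball_in Theta thetas delta,
           forall n, (0 < n)%N -> (product_power PZ n).-negligible (N n) &
           forall theta n (z : n.-tuple (borelRV R d)),
             eball_in Theta thetas delta theta -> (0 < n)%N -> ~ N n z ->
             ereal_inf
               [set ('E_P[(fun w => `|G theta (Z 0%N w) - G vartheta (Z 0%N w)|)%R]
                     + (\big[Num.max/0]_(j < n)
                          `|G theta (tnth z j) - G vartheta (tnth z j)|)%R%:E)%E
               | vartheta in C] = 0%E])
  (* (vii) *)
  (beta : R) (beta_gt0 : 0 < beta) (beta_le1 : beta <= 1)
  (Mbar_1 Mbar1 : R) (Mbar_1_gt0 : 0 < Mbar_1) (Mbar1_gt0 : 0 < Mbar1)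
  (xi_ : R -> borelRV R d -> R)
  (xi_envelope : forall delta : R, 0 < delta <= ediam Theta ->
     positive_envelope (local_class_G Theta G thetas delta) (xi_ delta))
  (xi_L2 : forall delta : R, 0 < delta <= ediam Theta ->
     xi_ delta \in Lfun PZ 2%:E)
  (xi_bound : forall delta : R, 0 < delta <= ediam Theta ->
     (Lnorm PZ 2%:E (fun z => (Num.max (L1 z) 1 * xi_ delta z)%:E)
       <= (Mbar_1 * delta `^ beta)%:E)%E)
  (entropy_bound : forall delta : R, 0 < delta <= ediam Theta ->
     (maxe (entropy_integral (local_class_G Theta G thetas delta)
              (xi_ delta) 8^-1)
           (entropy_integral (class_G Theta G) xiG 8^-1) <= Mbar1%:E)%E)
  (* (viii) *)
  (delta1 : R) (delta1_gt0 : 0 < delta1) (K : R) (K_ge0 : 0 <= K)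
  (mTR : 'rV[R]_m -> R -> R)
  (mTR_measurable :
     measurable_fun ((Theta `*` [set: R]) : set (borelRV R m * R))
       (fun p : borelRV R m * R => mTR p.1 p.2))
  (mTR_lipschitz : forall theta x, Theta theta -> - delta1 <= x <= delta1 ->
     `|mTR theta (psi_bar Z G theta + x) - mTR thetas (psi_bar Z G thetas + x)|
       <= K * enorm (row_mx (theta - thetas)
                (const_mx (psi_bar Z G theta - psi_bar Z G thetas)
                   : 'rV[R]_1)))
  (mTR_integral : forall theta s t, Theta theta -> s < t ->
     ('E_P[H theta t \o Z 0%N] - 'E_P[H theta s \o Z 0%N]
       = \int[lebesgue_measure]_(u in `[s, t]) (mTR theta u)%:E)%E) :
  ereal_sup
    [set P [set w | eps < n%:R `^ (1 / (4 - 2 * beta))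
                          * enorm (thetahat n w - thetas)]
    | n in [set n : nat | (0 < n)%N]] @[eps --> +oo] --> 0%E.
Proof.
have [_ Zlaw] := Z_iid.
have entropy1 delta : 0 < delta <= ediam Theta ->
    (entropy_integral (local_class_G Theta G thetas delta) (xi_ delta) 8^-1
     <= Mbar1%:E)%E.
  by move=> /entropy_bound; rewrite ge_max => /andP[].
have [C C0 shell] := shell_prob Z_iid Theta_compact G_integrable xiG_gt0 xiG_L2
  xiG_bound H_measurable H_integrable L1_ge0 L2_ge0 L1_L2 L2_L2 H_lipschitz
  thetas_in delta1_gt0 K_ge0 mTR_measurable mTR_lipschitz mTR_integral G_separable
  beta_gt0 beta_le1 Mbar_1_gt0 Mbar1_gt0 xi_envelope xi_bound entropy1 M1_gt0
  psi_H_growth.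
have tail (eps : R) n : 1 <= eps -> (0 < n)%N ->
    (P [set w | eps < n%:R `^ (1 / (4 - 2 * beta)) * enorm (thetahat n w - thetas)]%R
     <= (4 * C / Num.sqrt eps)%:E)%E.
  case: n => // n eps1 _; set rho := _ `^ _.
  have rho0 : 0 < rho by rewrite powR_gt0.
  apply: (peeling_bound (D := ediam Theta) (Q := product_power PZ n.+1)
    (X := sample Z n.+1)) => //.
  - by move=> A mA; exact: sample_law.
  - have me := measurable_enorm_dist thetas.
    exact: (measurableT_comp me (measurable_funPT (thetahat n.+1))).
  - by move=> w; apply: enorm_le_ediam => //; exact: thetahat_in.
  - move=> delta dD u1; have [E [mE QE nE]] := shell n delta dD u1.
    exists E; split=> // w nEw e12.
    apply: (nE _ nEw (thetahat n.+1 w) (thetahat_in n.+1 w isT) e12).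
    have objE theta : sample_objective G H (sample Z n.+1 w) theta =
        empirical_objective Z G H n.+1 theta w.
      rewrite /sample_objective /empirical_objective /empirical_mean.
      congr (_ * _); apply: eq_bigr => j _; rewrite tnth_mktuple.
      congr (H _ (_ * _) _); apply: eq_bigr => k _; by rewrite tnth_mktuple.
    by rewrite !objE; exact: thetahat_min.
(* The tail bound does not depend on [n], so it passes to the supremum for [eps >= 1]; the supremum
   is nonnegative because its member at [n = 1] is. *)
apply: (@squeeze_cvge _ _ _ _ (fun=> 0%E) _ (fun eps => (4 * C / Num.sqrt eps)%:E)).
- near=> eps; have eps1 : 1 <= eps by near: eps; exact: nbhs_pinfty_ge.
  apply/andP; split.
    apply: (le_trans (measure_ge0 P [set w | eps < 1%:R `^ (1 / (4 - 2 * beta))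
      * enorm (thetahat 1%N w - thetas)])).
    by apply: ereal_sup_ubound; exists 1%N.
  apply: ge_ereal_sup => _ [n n0 <-]; exact: tail.
- exact: cvg_cst.
- apply/fine_cvgP; split; first by apply: nearW.
  apply/cvgrPdist_lt => e e0.
  (* The [+ 1] keeps [a] positive when [C = 0] and makes the final inequality strict. *)
  pose a := (4 * C + 1) / e; have a0 : 0 < a by rewrite divr_gt0// ltr_wpDl// mulr_ge0.
  near=> eps => /=.
  have epsa : a ^+ 2 < eps by near: eps; apply: nbhs_pinfty_gt; exact: num_real.
  have seps : a < Num.sqrt eps.
    have eps0 : 0 < eps := le_lt_trans (sqr_ge0 a) epsa.
    by rewrite -(ger0_norm (ltW a0)) -sqrtr_sqr ltr_sqrt.
  have seps0 : 0 < Num.sqrt eps := lt_trans a0 seps.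
  rewrite sub0r normrN ger0_norm ?divr_ge0 ?mulr_ge0 ?(ltW seps0)//.
  rewrite ltr_pdivrMr//; apply: lt_trans (_ : 4 * C + 1 < _); first by rewrite ltrDl.
  by rewrite (mulrC e) -ltr_pdivrMr.
Unshelve. all: by end_near.
Qed.
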